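(* The following identity holds: $$\int_{-\infty}^{\infty}\frac{\left|\zeta\!\left(\frac12+iv\right)\right|^{2}\left(\sqrt2\,\cos(v\ln 2)-1\right)}{\cosh^{2}(\pi v)}\,dv=-\frac1\pi\int_{1/2}^{1}\psi(v)^{2}\,dv+\frac{5\pi}{24}+\frac1\pi\left(\frac12\ln^{2}(\pi)-\ln^{2}(2)-\frac{\gamma^{2}}{2}-\gamma(1)\right).$$
   Context: $\zeta$ is the Riemann zeta function, $\psi=\Gamma'/\Gamma$ is the digamma function, $\gamma$ is the Euler–Mascheroni constant, and $\gamma(1)=-0.0728158\ldots$ is the first Stieltjes constant, defined by the Laurent expansion $\zeta(s)=\frac{1}{s-1}+\gamma-\gamma(1)(s-1)+O((s-1)^2)$ at $s=1$. *)

(* Defs.v *)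
From mathcomp Require Import all_boot all_order all_algebra.
From mathcomp Require Import all_classical all_reals all_analysis.
From mathcomp Require Export complex.
Set Implicit Arguments.
Unset Strict Implicit.
Unset Printing Implicit Defensive.
Import Order.TTheory GRing.Theory Num.Theory.
Import numFieldNormedType.Exports.
Local Open Scope classical_set_scope.
Local Open Scope ring_scope.
Local Open Scope complex_scope.

Section special_functions.
Context {R : realType}.
(* The topology of the complex plane is found on the regular algebra R[i]^o. *)
Local Notation C := R[i]^o.
Implicit Types (s z : C) (x : R).

Definition cosh x : R := (expR x + expR (- x)) / 2.

Definition euler_mascheroni : R :=
  limn (fun n : nat => \sum_(1 <= k < n.+1) k%:R^-1 - ln n%:R).

(* Only meaningful for 0 < x, where the integral converges. *)
Definition Gamma x : R :=
  \int[lebesgue_measure]_(t in `]0, +oo[) (t `^ (x - 1) * expR (- t)).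

Definition digamma x : R := derive1 Gamma x / Gamma x.

Definition cexp z : C :=
  (expR (complex.Re z) * cos (complex.Im z))
    +i* (expR (complex.Re z) * sin (complex.Im z)).

Definition analytic_at (f : C -> C) z0 :=
  exists a : nat -> C, \forall z \near z0,
    series (fun k => a k * (z - z0) ^+ k) @ \oo --> f z.

(* zeta is the analytic continuation to C \ {1} of the Dirichlet series
   \sum_(n >= 1) n^-s, where n^-s = exp(- s ln n); its value at the pole s = 1
   is left unconstrained. *)
Definition is_riemann_zeta (zeta : C -> C) :=
  (forall s, 1 < complex.Re s ->
     series (fun n => cexp (- s * (ln n.+1%:R)%:C)) @ \oo --> zeta s) /\
  (forall s, s != 1 -> analytic_at zeta s).

(* zeta(s) = 1/(s-1) + gamma - gamma1 (s-1) + O((s-1)^2) as s -> 1, s != 1;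
   this determines gamma1. *)
Definition is_stieltjes1 (zeta : C -> C) (gamma1 : R) :=
  (fun s => zeta s
     - ((s - 1)^-1 + euler_mascheroni%:C - gamma1%:C * (s - 1)))
  =O_ ((1 : C)^') (fun s => (s - 1) ^+ 2).

End special_functions.

(* Main.v *)
Require Import Defs.
From mathcomp Require Import all_boot all_order all_algebra.
From mathcomp Require Import all_classical all_reals all_analysis.
From mathcomp Require Import measurable_realfun.
From mathcomp Require Import ring lra.
Set Implicit Arguments.
Unset Strict Implicit.
Unset Printing Implicit Defensive.
Import Order.TTheory GRing.Theory Num.Theory.
Import numFieldNormedType.Exports.
Local Open Scope classical_set_scope.
Local Open Scope ring_scope.

(** All integrals over x > 0 are written in the variable u = ln x.  The function
    g(u) = e^(u/2) (psi(1 + x) - ln x) is the convolution of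
    phi(w) = frac(e^w) e^(-w/2) and kern(r) = e^(-r/2) / (4 cosh^2(r/2)), whose
    Fourier transforms at v are - zeta(s) / s and pi s / cosh(pi v), where
    s = 1/2 + iv.  Fourier inversion for the autocorrelation of g, evaluated at
    the shifts 0 and ln 2, and the duplication formula of psi turn the left-hand
    side into pi^-1 times the integral over x > 0 of
    (psi(1 + x) - ln x)^2 - (psi(1/2 + x) - ln x)^2.  The terms psi^2 telescope
    to the integral of psi^2 over [1/2, 1].  What remains is the logarithmic
    moment of p(x) = psi(1 + x) - psi(1/2 + x): up to the factor 1 / (2 e), the
    Mellin transform of 1 / (2 x) - p is an explicit product of Gamma(1 + e),
    (2 pi)^-e, 2 - 2^-e, e zeta(1 + e) and the transform of 1 / cosh, and the
    moment is read off the coefficient of e^2 at e = 0. *)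

(** Integrability of the left-hand side is obtained without any growth bound on zeta. Up to a
    constant, [|zeta|^2 / cosh^2] is the transform of an autocorrelation, hence nonnegative, and a
    bounded continuous integrable even function with nonnegative transform has an integrable
    transform. This is why the argument uses an autocorrelation and L1 inversion rather than an L2
    theory. In the product of the two transforms the factors [1 / s] and [s] cancel, so no weight
    survives. The combination [sqrt 2 cos (v ln 2) - 1] is the one that duplication can handle: with
    [a = psi(1 + x) - ln x], [b = psi(1/2 + x) - ln x] and [c = psi(1 + 2 x) - ln (2 x) = (a + b) /
    2], one has [a^2 - b^2 = 4 a c - 4 c^2], a shifted minus an unshifted correlation. In the final
    expansion [5 pi^2 / 24] is [pi^2 / 12] from Gamma plus [pi^2 / 8] from [1 / cosh]. Transforms
    are split into cosine and sine parts, so complex numbers occur only where [zeta] itself is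
    unfolded. *)

Section calculus.
Context {R : realType}.
Implicit Types (f g h : R -> R) (x a b c : R).
(** Derivatives are kept as a relation on explicit functions, so that [dauto] can read off the shape
    of the function and produce a derivative, which [drv_eq] then matches with the wanted
    expression. *)
Definition drv x f (d : R) : Prop := is_derive (x : R) (1 : R) (f : R -> R) (d : R).
Definition cont f : Prop := continuous f.

Lemma drv_eq x f a b : drv x f a -> a = b -> drv x f b.
Proof. by move=> h <-. Qed.
Lemma drv_cst x c : drv x (fun=> c) 0.
Proof. exact: is_derive_cst. Qed.
Lemma drv_id x : drv x (fun y => y) 1.
Proof. exact: is_derive_id. Qed.
Lemma drvD x f g a b : drv x f a -> drv x g b -> drv x (fun y => f y + g y) (a + b).
Proof. by move=> h1 h2; exact: is_deriveD. Qed.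
Lemma drvN x f a : drv x f a -> drv x (fun y => - f y) (- a).
Proof. by move=> h1; exact: is_deriveN. Qed.
Lemma drvB x f g a b : drv x f a -> drv x g b -> drv x (fun y => f y - g y) (a - b).
Proof. by move=> h1 h2; exact: is_deriveB. Qed.
Lemma drvM x f g a b : drv x f a -> drv x g b ->
  drv x (fun y => f y * g y) (a * g x + f x * b).
Proof.
move=> h1 h2; have := is_deriveM h1 h2 => /drv_eq; apply.
by rewrite /GRing.scale /=; ring.
Qed.
Lemma drvX x f a n : drv x f a -> drv x (fun y => f y ^+ n) (n%:R * f x ^+ n.-1 * a).
Proof.
move=> h1; elim: n => [|n ih].
  by rewrite mul0r mul0r; exact: drv_cst.
under eq_fun do rewrite exprS.
apply: drv_eq (drvM h1 ih) _ => /=.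
case: n ih => [|n] _ /=; first by rewrite expr0; ring.
by rewrite exprS -[n.+2]addn1 natrD; ring.
Qed.
Lemma drvV x f a : f x != 0 -> drv x f a -> drv x (fun y => (f y)^-1) (- (f x) ^- 2 * a).
Proof. by move=> h1 h2; exact: is_deriveV. Qed.
Lemma drv_comp x f g a b : drv (g x) f a -> drv x g b -> drv x (fun y => f (g y)) (a * b).
Proof.
move=> h1 h2.
by have := @is_derive1_comp R f g x a b h1 h2; rewrite mulrC.
Qed.
Lemma drv_exp x f a : drv x f a -> drv x (fun y => expR (f y)) (expR (f x) * a).
Proof. by move=> h; apply: drv_comp h; exact: is_derive_expR. Qed.
Lemma drv_cos x f a : drv x f a -> drv x (fun y => cos (f y)) (- sin (f x) * a).
Proof. by move=> h; apply: (drv_comp (f := cos)) h; exact: is_derive_cos. Qed.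
Lemma drv_sin x f a : drv x f a -> drv x (fun y => sin (f y)) (cos (f x) * a).
Proof. by move=> h; apply: (drv_comp (f := sin)) h; exact: is_derive_sin. Qed.
Lemma drv_ln x f a : 0 < f x -> drv x f a -> drv x (fun y => ln (f y)) ((f x)^-1 * a).
Proof. by move=> h0 h; apply: (drv_comp (f := @ln R)) h; exact: is_derive1_ln. Qed.

Lemma drv_continuous f g : (forall x, drv x f (g x)) -> cont f.
Proof.
move=> dF x; apply: differentiable_continuous; apply/derivable1_diffP.
by have [] := dF x.
Qed.

Lemma cont_cst c : cont (fun _ : R => c).
Proof. exact: cst_continuous. Qed.
Lemma cont_id : cont (fun x : R => x).
Proof. by move=> x; exact: cvg_id. Qed.
Lemma contD f g : cont f -> cont g -> cont (fun y => f y + g y).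
Proof. by move=> h1 h2 x; exact: (cvgD (h1 x) (h2 x)). Qed.
Lemma contN f : cont f -> cont (fun y => - f y).
Proof. by move=> h1 x; exact: (cvgN (h1 x)). Qed.
Lemma contM f g : cont f -> cont g -> cont (fun y => f y * g y).
Proof. by move=> h1 h2 x; exact: (cvgM (h1 x) (h2 x)). Qed.
Lemma contV f : (forall x, f x != 0) -> cont f -> cont (fun y => (f y)^-1).
Proof. by move=> h0 h1 x; exact: (cvgV (h0 x) (h1 x)). Qed.
Lemma cont_comp g f : cont g -> cont f -> cont (fun y => g (f y)).
Proof. by move=> h1 h2 x; apply: continuous_comp; [exact: h2|exact: h1]. Qed.
Lemma contX n f : cont f -> cont (fun y => f y ^+ n).
Proof.
move=> hf; elim: n => [|n ih]; first exact: cont_cst.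
by under eq_fun do rewrite exprS; exact: contM.
Qed.
Lemma cont_exp f : cont f -> cont (fun y => expR (f y)).
Proof. by move=> hf; apply: cont_comp hf; exact: continuous_expR. Qed.
Lemma cont_cos f : cont f -> cont (fun y => cos (f y)).
Proof. by move=> hf; apply: cont_comp hf; exact: continuous_cos. Qed.
Lemma cont_sin f : cont f -> cont (fun y => sin (f y)).
Proof. by move=> hf; apply: cont_comp hf; exact: continuous_sin. Qed.
Lemma cont_norm f : cont f -> cont (fun y => `|f y|).
Proof. by move=> hf; apply: cont_comp hf; exact: norm_continuous. Qed.
Lemma mvt f f' a b : a < b -> (forall x, a <= x -> x <= b -> drv x f (f' x)) ->
  exists2 c, (a < c) && (c < b) & f b - f a = f' c * (b - a).
Proof.
move=> ab df.
have [||c] := @MVT R f f' a b ab.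
- by move=> x /[!in_itv]/= /andP[/ltW h1 /ltW h2]; exact: df.
- apply: derivable_within_continuous => x /[!in_itv]/= /andP[h1 h2].
  by have [] := df x h1 h2.
by rewrite in_itv /= => h1 h2; exists c.
Qed.
End calculus.

(** * Limits of real sequences *)

Section sequences.
Context {R : realType}.
Implicit Types (u v w : nat -> R) (l m : R).

Definition tends u l : Prop := u @ \oo --> l.

Lemma tends_near u v l : tends u l -> (\forall n \near \oo, u n = v n) -> tends v l.
Proof. by move=> h e; apply: cvg_trans h; apply: near_eq_cvg. Qed.
Lemma tends_ext u v l : tends u l -> (forall n, u n = v n) -> tends v l.
Proof. by move=> h e; apply: tends_near h _; apply: nearW. Qed.
Lemma tends_eq u l m : tends u l -> l = m -> tends u m.
Proof. by move=> h <-. Qed.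
Lemma tends_cst l : tends (fun=> l) l.
Proof. exact: cvg_cst. Qed.
Lemma tendsD u v l m : tends u l -> tends v m -> tends (fun n => u n + v n) (l + m).
Proof. by move=> h1 h2; exact: (cvgD h1 h2). Qed.
Lemma tendsB u v l m : tends u l -> tends v m -> tends (fun n => u n - v n) (l - m).
Proof. by move=> h1 h2; exact: (cvgB h1 h2). Qed.
Lemma tendsN u l : tends u l -> tends (fun n => - u n) (- l).
Proof. by move=> h1; exact: (cvgN h1). Qed.
Lemma tendsM u v l m : tends u l -> tends v m -> tends (fun n => u n * v n) (l * m).
Proof. by move=> h1 h2; exact: (cvgM h1 h2). Qed.
Lemma tendsV u l : l != 0 -> tends u l -> tends (fun n => (u n)^-1) (l^-1).
Proof. by move=> h1 h2; exact: (cvgV h1 h2). Qed.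
Lemma tendsX u l k : tends u l -> tends (fun n => u n ^+ k) (l ^+ k).
Proof.
move=> h; elim: k => [|k ih]; first by rewrite expr0; under eq_fun do rewrite expr0; exact: tends_cst.
by rewrite exprS; under eq_fun do rewrite exprS; exact: tendsM.
Qed.
Lemma tends_norm u l : tends u l -> tends (fun n => `|u n|) `|l|.
Proof. by move=> h1; exact: (cvg_norm h1). Qed.
Lemma tends_at (f : R -> R) u l : {for l, continuous f} -> tends u l -> tends (fun n => f (u n)) (f l).
Proof. by move=> cf h; apply: (cvg_comp u f h); exact: cf. Qed.
Lemma tends_cont (f : R -> R) u l : cont f -> tends u l -> tends (fun n => f (u n)) (f l).
Proof. by move=> cf; apply: tends_at; exact: cf. Qed.
Lemma tends_exp u l : tends u l -> tends (fun n => expR (u n)) (expR l).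
Proof. by apply: tends_cont; exact: continuous_expR. Qed.
Lemma tends_unique u l m : tends u l -> tends u m -> l = m.
Proof. exact: cvg_unique. Qed.
Lemma tends_le u l M : tends u l -> (\forall n \near \oo, u n <= M) -> l <= M.
Proof. by move=> h hM; rewrite -(cvg_lim _ h) //; apply: limr_le => //; exact: cvgP h. Qed.
Lemma tends_ge u l M : tends u l -> (\forall n \near \oo, M <= u n) -> M <= l.
Proof. by move=> h hM; rewrite -(cvg_lim _ h) //; apply: limr_ge => //; exact: cvgP h. Qed.
Lemma tends_squeeze u v w l : (\forall n \near \oo, (u n <= v n) && (v n <= w n)) ->
  tends u l -> tends w l -> tends v l.
Proof. by move=> h; exact: squeeze_cvgr. Qed.
Lemma tends_shift u l k : tends (fun n => u (n + k)%N) l <-> tends u l.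
Proof. by rewrite /tends -(cvg_shiftn k u). Qed.
Lemma tends_sub u l (k : nat -> nat) : tends u l -> (forall n, (n <= k n)%N) -> tends (fun n => u (k n)) l.
Proof.
move=> h kn; apply: (cvg_comp k u _ h).
by move=> A [N _ hA]; exists N => // n /= Nn; apply: hA; apply: leq_trans (kn n).
Qed.
Lemma tends_norm0 u v : (\forall n \near \oo, `|u n| <= v n) -> tends v 0 -> tends u 0.
Proof.
move=> h hv; apply: (@tends_squeeze (fun n => - v n) u v 0).
- by apply: filterS h => n; rewrite ler_norml.
- by rewrite -oppr0; exact: tendsN.
- exact: hv.
Qed.
Lemma tends_invn : tends (fun n => n.+1%:R^-1) 0.
Proof. exact: cvg_harmonic. Qed.
Lemma tends_dist0 u l : tends u l <-> tends (fun n => u n - l) 0.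
Proof.
split=> h; first by rewrite -[X in tends _ X](subrr l); exact: (tendsB h (@tends_cst l)).
apply: (@tends_ext (fun n => (u n - l) + l)) => [|n]; last by rewrite subrK.
by rewrite -[X in tends _ X](add0r l); exact: (tendsD h (@tends_cst l)).
Qed.
End sequences.

Ltac cauto := repeat lazymatch goal with
  | |- cont (fun _ => ?c) => exact: cont_cst
  | |- cont (fun y => y) => exact: cont_id
  | |- cont (fun y => @?f y + @?g y) => apply: (@contD _ f g)
  | |- cont (fun y => @?f y * @?g y) => apply: (@contM _ f g)
  | |- cont (fun y => - @?f y) => apply: (@contN _ f)
  | |- cont (fun y => (@?f y)^-1) => apply: (@contV _ f)
  | |- cont (fun y => (@?f y) ^+ ?n) => apply: (@contX _ n f)
  | |- cont (fun y => expR (@?f y)) => apply: (@cont_exp _ f)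
  | |- cont (fun y => cos (@?f y)) => apply: (@cont_cos _ f)
  | |- cont (fun y => sin (@?f y)) => apply: (@cont_sin _ f)
  | |- cont (fun y => `|@?f y|) => apply: (@cont_norm _ f)
  | |- cont _ => assumption
  end.

Ltac dauto := repeat lazymatch goal with
  | |- drv _ (fun _ => ?c) _ => exact: drv_cst
  | |- drv _ (fun y => y) _ => exact: drv_id
  | |- drv _ (fun y => @?f y - @?g y) _ => apply: (@drvB _ _ f g)
  | |- drv _ (fun y => @?f y + @?g y) _ => apply: (@drvD _ _ f g)
  | |- drv _ (fun y => @?f y * @?g y) _ => apply: (@drvM _ _ f g)
  | |- drv _ (fun y => - @?f y) _ => apply: (@drvN _ _ f)
  | |- drv _ (fun y => (@?f y)^-1) _ => apply: (@drvV _ _ f)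
  | |- drv _ (fun y => (@?f y) ^+ ?n) _ => apply: (@drvX _ _ f _ n)
  | |- drv _ (fun y => expR (@?f y)) _ => apply: (@drv_exp _ _ f)
  | |- drv _ (fun y => cos (@?f y)) _ => apply: (@drv_cos _ _ f)
  | |- drv _ (fun y => sin (@?f y)) _ => apply: (@drv_sin _ _ f)
  | |- drv _ (fun y => ln (@?f y)) _ => apply: (@drv_ln _ _ f)
  | |- drv _ _ _ => eassumption
  end.

(** * Integration over the real line *)

Section line_integral.
Context {R : realType}.
Notation mu := (@lebesgue_measure R).
Implicit Types (f g F : R -> R).

Definition itg f := mu.-integrable setT (EFin \o f).
Definition J f : R := \int[mu]_x f x.

Lemma itg_meas f : itg f -> measurable_fun setT f.
Proof. by move=> /measurable_int /measurable_EFinP. Qed.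

Lemma J_EFin f : itg f -> (\int[mu]_x (f x)%:E)%E = (J f)%:E.
Proof. by move=> h; rewrite /J /Rintegral fineK //; exact: integrable_fin_num h. Qed.

Lemma itg_le f g : measurable_fun setT f -> itg g ->
  (forall x, `|f x| <= g x) -> itg f.
Proof.
move=> mf ig fg; apply: le_integrable ig => //; first exact/measurable_EFinP.
move=> x _ /=; rewrite lee_fin (le_trans (fg x)) //; exact: ler_norm.
Qed.

Lemma itgD f g : itg f -> itg g -> itg (fun x => f x + g x).
Proof. by move=> h1 h2; exact: (integrableD measurableT h1 h2). Qed.

Lemma itgB f g : itg f -> itg g -> itg (fun x => f x - g x).
Proof. by move=> h1 h2; exact: (integrableB measurableT h1 h2). Qed.

Lemma itgZ c f : itg f -> itg (fun x => c * f x).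
Proof. by move=> h1; exact: (integrableZl measurableT c h1). Qed.

Lemma itg_norm f : itg f -> itg (fun x => `|f x|).
Proof.
by move=> h; apply: integrable_norm.
Qed.

Lemma itg_bddM f g M : itg f -> measurable_fun setT g ->
  (forall x, `|g x| <= M) -> itg (fun x => f x * g x).
Proof.
move=> hf mg gM; apply: (@itg_le _ (fun x => M * `|f x|)).
- exact: measurable_funM (itg_meas hf) mg.
- exact/itgZ/itg_norm.
- by move=> x; rewrite normrM mulrC ler_wpM2r.
Qed.

Lemma eq_J f g : f =1 g -> J f = J g.
Proof. by move=> /funext ->. Qed.

Lemma JD f g : itg f -> itg g -> J (fun x => f x + g x) = J f + J g.
Proof. by move=> h1 h2; rewrite /J RintegralD. Qed.

Lemma JB f g : itg f -> itg g -> J (fun x => f x - g x) = J f - J g.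
Proof. by move=> h1 h2; rewrite /J RintegralB. Qed.

Lemma JZ c f : itg f -> J (fun x => c * f x) = c * J f.
Proof. by move=> h1; rewrite /J RintegralZl. Qed.

Lemma J_ge0 f : (forall x, 0 <= f x) -> 0 <= J f.
Proof. by move=> h; apply: Rintegral_ge0. Qed.

Lemma le_J f g : itg f -> itg g -> (forall x, f x <= g x) -> J f <= J g.
Proof. by move=> h1 h2 h; apply: le_Rintegral. Qed.

Lemma norm_J f : itg f -> `|J f| <= J (fun x => `|f x|).
Proof. by move=> h; apply: le_normr_Rintegral. Qed.

Lemma itg0 : itg (fun=> 0).
Proof. exact: integrable0. Qed.

Lemma dct (f_ : nat -> R -> R) f g : (forall n, measurable_fun setT (f_ n)) ->
  (forall x, f_ ^~ x @ \oo --> f x) -> itg g ->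
  (forall n x, `|f_ n x| <= g x) -> itg f /\ (fun n => J (f_ n)) @ \oo --> J f.
Proof.
move=> mf cf ig bf.
have mfl : measurable_fun setT f.
  apply: (measurable_fun_cvg mf) => x _; exact: cf.
have [| | | | |h1 _ h2] := @dominated_convergence _ _ R mu setT measurableT
  (fun n => EFin \o f_ n) (EFin \o f) (EFin \o g).
- by move=> n; exact: (measurable_EFinP _ _).2 (mf n).
- exact: (measurable_EFinP _ _).2 mfl.
- by apply: aeW => x _; apply: cvg_EFin; [exact: nearW|exact: cf].
- exact: ig.
- by apply: aeW => x n _; rewrite /= lee_fin.
split => //.
rewrite /J /Rintegral.
apply: fine_cvg.
by rewrite fineK //; exact: integrable_fin_num h1.
Qed.

Section change_of_variable.
Variables (phi : R -> R) (k : {nonneg R}).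
Hypothesis mphi : measurable_fun setT (phi : measurableTypeR R -> measurableTypeR R).
Hypothesis phiE : forall A : set R, measurable A ->
  pushforward mu (phi : measurableTypeR R -> measurableTypeR R) A = (k%:num%:E * mu A)%E.

(** The hypothesis [phiE] is shared by translations and the reflection, with [k = 1], and by the
    dilation by [a], with [k = 1 / a]; all three substitutions are instances. *)
Lemma ge0_integral_comp (f : R -> \bar R) : measurable_fun setT f ->
  (forall x, 0 <= f x)%E ->
  (\int[mu]_x f (phi x) = k%:num%:E * \int[mu]_x f x)%E.
Proof.
move=> mf f0.
rewrite -ge0_integral_mscale //.
have := @ge0_integral_pushforward _ _ (measurableTypeR R) (measurableTypeR R) R phi mphi mu setT f measurableT mf (fun x _ => f0 x).
rewrite preimage_setT => <-.
by apply: eq_measure_integral => A mA _; exact: phiE.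
Qed.

Lemma itg_comp f : itg f -> itg (f \o phi).
Proof.
move=> /integrableP[mf fi]; apply/integrableP; split.
  exact: (measurableT_comp mf).
rewrite (@ge0_integral_comp (fun x => `|(f x)%:E|%E)) //.
  by rewrite lte_mul_pinfty // lee_fin.
exact: measurableT_comp.
Qed.

Lemma J_comp f : itg f -> J (f \o phi) = k%:num * J f.
Proof.
move=> fi; have := itg_comp fi => fci.
apply: EFin_inj; rewrite EFinM -(J_EFin fi) -(J_EFin fci).
rewrite (integralE mu setT (fun x => ((f \o phi) x)%:E)) (integralE mu setT (fun x => (f x)%:E)).
have mf : measurable_fun setT (EFin \o f) by exact: measurable_int fi.
have -> : ((fun x => ((f \o phi) x)%:E)^\+ = (fun x => (EFin \o f)^\+ (phi x)))%E.
  by apply/funext => x; rewrite !funeposE.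
have -> : ((fun x => ((f \o phi) x)%:E)^\- = (fun x => (EFin \o f)^\- (phi x)))%E.
  by apply/funext => x; rewrite !funenegE.
rewrite !ge0_integral_comp //; last 2 first.
- exact: measurable_funeneg.
- exact: measurable_funepos.
rewrite [RHS]muleBr //.
exact: (integrable_add_def measurableT fi).
Qed.
End change_of_variable.

(** Uniqueness of Lebesgue measure: it is enough that the pushforward gives every interval []a, b]]
    its length. *)
Lemma pushforward_shift c (A : set R) : measurable A ->
  pushforward mu ((fun x => x + c) : measurableTypeR R -> measurableTypeR R) A = ((1%:nng : {nonneg R})%:num%:E * mu A)%E.
Proof.
move=> mA; rewrite mul1e.
have mc : measurable_fun setT ((fun x => x + c) : measurableTypeR R -> measurableTypeR R) by exact: measurable_funD.
apply/esym/(@lebesgue_measure_unique R (pushforward mu ((fun x => x + c) : measurableTypeR R -> measurableTypeR R))) => //=.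
move=> _ [[a b]] _ <-.
rewrite /pushforward.
rewrite (_ : _ @^-1` _ = `](a - c), (b - c)]%classic); last first.
  by apply/seteqP; split => x /=; rewrite !in_itv/= ltrBlDr lerBrDr.
rewrite /= !lebesgue_measure_itv/=.
by rewrite !lte_fin ltrD2r -!EFinB opprB addrA subrK.
Qed.

Lemma itg_shift c f : itg f -> itg (fun x => f (x + c)).
Proof. by apply: (@itg_comp _ _ _ (pushforward_shift c)); exact: measurable_funD. Qed.

Lemma J_shift c f : itg f -> J (fun x => f (x + c)) = J f.
Proof.
move=> h; rewrite -[RHS]mul1r.
by apply: (J_comp _ (pushforward_shift c)) h; exact: measurable_funD.
Qed.

Lemma pushforward_opp (A : set R) : measurable A ->
  pushforward mu ((fun x => - x) : measurableTypeR R -> measurableTypeR R) A = ((1%:nng : {nonneg R})%:num%:E * mu A)%E.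
Proof. by move=> mA; rewrite mul1e; exact: lebesgue_measureN. Qed.

Lemma itg_opp f : itg f -> itg (fun x => f (- x)).
Proof. by apply: (@itg_comp _ _ _ pushforward_opp); exact: measurable_funN. Qed.

Lemma J_opp f : itg f -> J (fun x => f (- x)) = J f.
Proof.
move=> h; rewrite -[RHS]mul1r.
by apply: (J_comp _ pushforward_opp) h; exact: measurable_funN.
Qed.

Lemma pushforward_scale (a : {posnum R}) (A : set R) : measurable A ->
  pushforward mu ((fun x => a%:num * x) : measurableTypeR R -> measurableTypeR R) A = ((a%:num^-1%:nng)%:num%:E * mu A)%E.
Proof.
move=> mA.
have mc : measurable_fun setT ((fun x => a%:num * x) : measurableTypeR R -> measurableTypeR R) by exact: measurable_funM.
have h : mscale a%:num%:nng (pushforward mu ((fun x => a%:num * x) : measurableTypeR R -> measurableTypeR R)) A = mu A.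
  have /(_ isT mc) L := @lebesgue_measure_unique R (mscale a%:num%:nng (pushforward mu ((fun x => a%:num * x) : measurableTypeR R -> measurableTypeR R))).
  move=> m; apply/esym/L => //=.
  move=> _ [[x y]] _ <-.
  rewrite /mscale /= /pushforward.
  rewrite (_ : _ @^-1` _ = `](a%:num^-1 * x), (a%:num^-1 * y)]%classic); last first.
    by apply/seteqP; split => z /=; rewrite !in_itv/= ![a%:num^-1 * _]mulrC ltr_pdivrMr // ler_pdivlMr // ![z * _]mulrC.
  rewrite /= !lebesgue_measure_itv/=.
  rewrite !lte_fin ltr_pM2l //; case: ifP => _; last by rewrite mule0.
  by rewrite -!EFinB -EFinM -mulrBr mulrA mulfV // mul1r.
by rewrite -(h mc) /mscale /= muleA -EFinM mulVf // mul1e.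
Qed.

Lemma itg_scale a f : 0 < a -> itg f -> itg (fun x => f (a * x)).
Proof. by move=> a0; apply: (@itg_comp _ _ _ (pushforward_scale (PosNum a0))); exact: measurable_funM. Qed.

Lemma J_scale a f : 0 < a -> itg f -> J (fun x => f (a * x)) = a^-1 * J f.
Proof.
move=> a0 h.
by apply: (J_comp _ (pushforward_scale (PosNum a0))) h; exact: measurable_funM.
Qed.

Lemma measurable_ge (c : R) : measurable_fun setT (fun x : R => ((c <= x)%R)%:R : R).
Proof.
rewrite (_ : (fun x : R => _) = \1_(`[c, +oo[%classic : set R)); last first.
  apply/funext => x; rewrite indicE; congr (_%:R); congr nat_of_bool.
  by apply/idP/idP; rewrite inE/= in_itv/= andbT.
exact: measurable_indic.
Qed.

Lemma itg_ge (c : R) f : itg f -> itg (fun x => f x * ((c <= x)%R)%:R).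
Proof.
move=> h; apply: (itg_bddM (M := 1)) => //; first exact: measurable_ge.
by move=> x; case: (c <= x); rewrite ?normr1 ?normr0.
Qed.

Lemma continuous_meas f : cont f -> measurable_fun setT f.
Proof. by move=> h; exact: continuous_measurable_fun. Qed.

Lemma ftc_itv F f (a b : R) : a < b -> (forall x, drv x F (f x)) -> cont f ->
  (\int[mu]_(x in `[a, b]) (f x)%:E = (F b - F a)%:E)%E.
Proof.
move=> ab dF cf.
have cF := drv_continuous dF.
rewrite (@continuous_FTC2 _ f F) //.
- exact: continuous_subspaceT.
- split.
  + by move=> x _; have [] := dF x.
  + exact/cvg_at_right_filter/cF.
  + exact/cvg_at_left_filter/cF.
- by move=> x _; rewrite derive1E; have [_ ->] := dF x.
Qed.

Lemma J_ftc_cut F f (a b : R) : a < b -> (forall x, drv x F (f x)) -> cont f ->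
  J (f \_ `[a, b]) = F b - F a.
Proof.
by move=> ab dF cf; rewrite /J -Rintegral_mkcond /Rintegral (ftc_itv ab dF cf).
Qed.

Lemma J_lim f (a b : nat -> R) : itg f ->
  (forall x, \forall n \near \oo, x \in `[a n, b n]) ->
  (fun n => J (f \_ `[a n, b n])) @ \oo --> J f.
Proof.
move=> hf hx.
have [] // := @dct (fun n => f \_ `[a n, b n]) f (fun x => `|f x|).
- move=> n; apply/measurable_restrict => //; rewrite setTI.
  by apply: measurable_funS (itg_meas hf).
- move=> x; apply: cvg_near_cst; near=> n.
  by rewrite patchE mem_setE; rewrite (near (hx x) n).
- exact: itg_norm.
- move=> n x; rewrite patchE; case: ifP => // _; by rewrite normr0.
Unshelve. all: by end_near. Qed.

(** As [f] is already integrable, its integral is the limit of those over [[-n, n]], so limits of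
    the primitive along the integers suffice. *)
Lemma J_ftc F f (l m : R) : (forall x, drv x F (f x)) -> cont f -> itg f ->
  (fun n : nat => F n%:R) @ \oo --> l -> (fun n : nat => F (- n%:R)) @ \oo --> m ->
  J f = l - m.
Proof.
move=> dF cf hf hl hm.
have h : (fun n : nat => J (f \_ `[- n%:R, n%:R])) @ \oo --> J f.
  apply: J_lim => // x; near=> n.
  have : `|x| <= n%:R by near: n; exact: nbhs_infty_ger.
  by rewrite ler_norml in_itv.
apply: (cvg_unique _ h) => //.
apply: cvg_trans (cvgB hl hm).
apply: near_eq_cvg; near=> n.
rewrite (J_ftc_cut _ dF cf) //.
have n0 : (0 < n%:R :> R) by rewrite ltr0n; near: n; exact: nbhs_infty_gt.
by rewrite (lt_trans _ n0) // oppr_lt0.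
Unshelve. all: by end_near. Qed.

(** By monotone convergence: the integrals over growing intervals are increments of [F], hence at
    most [2 M]. *)
Lemma itg_ftc F f (M : R) : (forall x, drv x F (f x)) -> cont f ->
  (forall x, 0 <= f x) -> (forall x, `|F x| <= M) -> itg f.
Proof.
move=> dF cf f0 FM.
have mf := continuous_meas cf.
apply/integrableP; split; first exact/measurable_EFinP.
(* The successor keeps the interval nondegenerate at [n = 0], as [ftc_itv] requires. *)
pose A (n : nat) : set R := `[- n.+1%:R, n.+1%:R]%classic.
have UA : \bigcup_n A n = setT.
  apply/seteqP; split => // x _.
  have [n hn] : exists n : nat, `|x| <= n.+1%:R.
    exists (Num.truncn `|x|); rewrite ltW //.
    by have /andP[] := Num.Theory.truncn_itv (normr_ge0 x).
  by exists n => //; rewrite /A /= in_itv /= -ler_norml.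
have hc : (\int[mu]_(x in A n) (f x)%:E @[n --> \oo] --> \int[mu]_x (f x)%:E)%E.
  rewrite -UA; apply: ge0_nondecreasing_set_cvg_integral.
  - move=> n m nm; apply/subsetPset => x; rewrite /A /= !in_itv /= => /andP[h1 h2].
    rewrite (le_trans h2) ?ler_nat // andbT (le_trans _ h1) // lerN2 ler_nat.
    by [].
  - by move=> n; exact: measurable_itv.
  - by move=> n; apply/measurable_EFinP; exact: measurable_funS mf.
  - by move=> n x _; rewrite lee_fin.
have -> : (\int[mu]_x `|(EFin \o f) x| = \int[mu]_x (f x)%:E)%E.
  by apply: eq_integral => x _; rewrite /= ger0_norm.
apply: (@le_lt_trans _ _ (M + M)%:E); last exact: ltry.
rewrite -(cvg_lim _ hc) //.
apply: lime_le; first exact: cvgP hc.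
apply: nearW => n; rewrite (ftc_itv _ dF cf); last by rewrite (lt_trans _ (ltr0Sn _ _)) // oppr_lt0 ltr0Sn.
rewrite lee_fin lerD //; first by rewrite (le_trans (ler_norm _)).
by rewrite (le_trans (ler_norm _)) // normrN.
Qed.

Lemma J_ftc_half F f (l : R) : (forall x, drv x F (f x)) -> cont f ->
  itg (fun x => f x * ((0 <= x)%R)%:R) -> (fun n : nat => F n%:R) @ \oo --> l ->
  J (fun x => f x * ((0 <= x)%R)%:R) = l - F 0.
Proof.
move=> dF cf hf hl.
have h := @J_lim _ (fun n => - n%:R) (fun n => n%:R) hf.
apply: cvg_unique (h _) _ => //.
  move=> x; near=> n.
  have : `|x| <= n%:R by near: n; exact: nbhs_infty_ger.
  by rewrite ler_norml in_itv.
apply: cvg_trans (cvgB hl (cvg_cst (F 0))).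
apply: near_eq_cvg; near=> n.
have n0 : (0 < n%:R :> R) by rewrite ltr0n; near: n; exact: nbhs_infty_gt.
transitivity (F n%:R - F 0) => //; rewrite -(J_ftc_cut n0 dF cf); apply: eq_J => x.
rewrite !patchE !mem_setE !in_itv /=.
have [x0|x0] := leP 0 x; last by rewrite mulr0 if_same.
by rewrite mulr1 (le_trans _ x0) // oppr_le0.
Unshelve. all: by end_near. Qed.

Lemma J_even f : itg f -> (forall x, f (- x) = f x) ->
  J f = 2 * J (fun x => f x * ((0 <= x)%R)%:R).
Proof.
move=> hf ef.
have h0 := itg_ge 0 hf.
have -> : J f = J (fun x => f x * ((0 <= x)%R)%:R + f x * ((x < 0)%R)%:R).
  by apply: eq_J => x; rewrite -mulrDr; case: ltP; rewrite ?addr0 ?add0r mulr1.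
have h1 : itg (fun x => f x * ((x < 0)%R)%:R).
  have -> : (fun x => f x * ((x < 0)%R)%:R) = (fun x => f x - f x * ((0 <= x)%R)%:R).
    by apply/funext => x; case: ltP => _; rewrite ?mulr0 ?mulr1 ?subr0 ?subrr.
  exact: itgB.
rewrite JD // mulr2n mulrDl !mul1r; congr (_ + _).
rewrite -(J_opp h1).
have -> : (fun x => f (- x) * ((- x < 0)%R)%:R) = f \_ `]0, +oo[%classic.
  by apply/funext => x; rewrite ef patchE mem_setE in_itv /= andbT oppr_lt0; case: ifP; rewrite ?mulr1 ?mulr0.
have -> : (fun x => f x * ((0 <= x)%R)%:R) = f \_ `[0, +oo[%classic.
  by apply/funext => x; rewrite patchE mem_setE in_itv /= andbT; case: ifP; rewrite ?mulr1 ?mulr0.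
rewrite /J -!Rintegral_mkcond Rintegral_itv_obnd_cbnd //.
exact: integrableS hf.
Qed.

(** The logistic density has a bounded primitive on the whole line, so this comparison gives the
    integrability of [e^(-a|x|)] without a split at 0. The constant 4 comes from
    [(1 + q)^2 <= 4 q^2] for [q >= 1]. *)
Lemma expN_logistic (a x : R) : 0 < a ->
  expR (- (a * `|x|)) <= 4 * (expR (a * x) / (1 + expR (a * x)) ^+ 2).
Proof.
move=> a0.
wlog x0 : x / 0 <= x.
  move=> H; have [|x0] := leP 0 x; first exact: H.
  have := H (- x) _; rewrite oppr_ge0 normrN => /(_ (ltW x0)) /le_trans; apply.
  rewrite mulrN expRN; rewrite le_eqVlt; apply/orP; left; apply/eqP; congr (_ * _).
  have := expR_gt0 (a * x); set q := expR _ => q0.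
  by field; rewrite !gt_eqF // addr_gt0.
rewrite (ger0_norm x0) expRN.
have := @expR_gt1 _ (a * x); have := expR_gt0 (a * x).
have : 1 <= expR (a * x) by rewrite -expR0 ler_expR mulr_ge0 // ltW.
set q := expR _ => q1 q0 _.
rewrite mulrA ler_pdivlMr ?exprn_gt0 ?addr_gt0 // mulrC ler_pdivrMr //.
nra.
Qed.

Lemma itg_expN (a : R) : 0 < a -> itg (fun x => expR (- (a * `|x|))).
Proof.
move=> a0.
have q0 x : 0 < expR (a * x) by exact: expR_gt0.
have q1 x : 1 + expR (a * x) != 0 by rewrite gt_eqF // addr_gt0.
apply: (@itg_le _ (fun x => 4 / a * (a * (expR (a * x) * ((1 + expR (a * x)) ^+ 2)^-1)))).
- by apply: continuous_meas; cauto.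
- apply: itgZ.
  apply: (@itg_ftc (fun x => - (1 + expR (a * x))^-1) _ 1).
  + move=> x; apply: drv_eq; first by dauto.
    by rewrite /=; field.
  + by cauto => x; rewrite expf_neq0.
  + by move=> x; rewrite mulr_ge0 ?ltW // divr_gt0 // exprn_gt0 // addr_gt0.
  + by move=> x; rewrite normrN ger0_norm ?invr_ge0 ?addr_ge0 // ?invf_le1 ?addr_gt0 // ?lerDl ltW.
- move=> x; rewrite ger0_norm ?expR_ge0 //.
  rewrite [leRHS]mulrA divfK ?gt_eqF //; exact: expN_logistic.
Qed.

Lemma itg_exp (f : R -> R) C a : 0 < a -> measurable_fun setT f ->
  (forall x, `|f x| <= C * expR (- (a * `|x|))) -> itg f.
Proof. by move=> a0 mf; apply: itg_le => //; apply: itgZ; exact: itg_expN. Qed.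

Section fubini.
Variables (M : R * R -> R) (h : R -> R).
Hypothesis mM : measurable_fun setT M.
Hypothesis iM1 : forall x, itg (fun y => M (x, y)).
Hypothesis iM2 : forall y, itg (fun x => M (x, y)).
Hypothesis ih : itg h.
Hypothesis Mh : forall x, J (fun y => `|M (x, y)|) <= h x.

Let iM : (mu \x mu)%E.-integrable setT (EFin \o M).
Proof.
apply/integrable12ltyP; first exact/measurable_EFinP.
have /integrableP[_] := ih; apply: le_lt_trans.
apply: ge0_le_integral => //.
- by move=> x _; exact: integral_ge0.
- apply: (measurable_fun_fubini_tonelli_F (m2 := mu) (abse \o (EFin \o M))).
    by apply: measurableT_comp => //; exact/measurable_EFinP.
    by move=> x; exact: abse_ge0.
- by apply: measurableT_comp => //; exact: measurable_int ih.
- move=> x _ /=.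
  rewrite (@J_EFin (fun y => `|M (x, y)|)); last exact: itg_norm.
  by rewrite lee_fin (le_trans (Mh x)) // ler_norm.
Qed.

(** Every slice, not merely almost every one, is assumed integrable, so that the real-valued inner
    integral [J] agrees everywhere with the extended one of the Fubini theorem. *)
Lemma itg_fubini1 : itg (fun x => J (fun y => M (x, y))).
Proof.
have := integrable_fubini_F iM; apply: eq_integrable => // x _.
by rewrite /fubini_F /= -(J_EFin (iM1 x)).
Qed.

Lemma itg_fubini2 : itg (fun y => J (fun x => M (x, y))).
Proof.
have mG := measurable_fubini_G iM.
suff : mu.-integrable setT (fubini_G mu (EFin \o M)).
  apply: eq_integrable => // y _.
  by rewrite /fubini_G /= -(J_EFin (iM2 y)).
apply/integrableP; split => //.
have mM' : measurable_fun setT (EFin \o M) by exact/measurable_EFinP.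
have : (\int[mu]_y \int[mu]_x `|(M (x, y))%:E| < +oo)%E.
  exact: (@integrable21ltyP _ _ _ _ R mu mu _ mM').1 iM.
apply: le_lt_trans.
apply: ge0_le_integral => //.
- exact: measurableT_comp.
- apply: (measurable_fun_fubini_tonelli_G (m1 := mu) (abse \o (EFin \o M))).
    exact: measurableT_comp.
  by move=> x; exact: abse_ge0.
- move=> y _; apply: le_abse_integral => //.
  by apply/measurable_EFinP; exact: itg_meas (iM2 y).
Qed.

Lemma J_fubini : J (fun x => J (fun y => M (x, y))) = J (fun y => J (fun x => M (x, y))).
Proof.
apply: EFin_inj; rewrite -!J_EFin; [|exact: itg_fubini2|exact: itg_fubini1].
have := Fubini iM => /=.
under eq_integral do rewrite (J_EFin (iM1 _)).
by under [in X in _ = X -> _]eq_integral do rewrite (J_EFin (iM2 _)).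
Qed.
End fubini.

Section convolution.
Variables (a b : R -> R) (B : R).
Hypothesis ia : itg a.
Hypothesis ib : itg b.
Hypothesis bB : forall x, `|b x| <= B.

Lemma itg_reflect f u : itg f -> itg (fun w => f (u - w)).
Proof.
by move=> hf; have := itg_opp (itg_shift u hf); under eq_fun do rewrite addrC.
Qed.

(** Boundedness of [b] makes the convolution converge at every [u] instead of almost every [u];
    later identities such as [gE] are pointwise and rely on it. *)
Lemma itg_conv_in u : itg (fun w => a w * b (u - w)).
Proof. by apply: itg_bddM ia _ _ => //; exact: itg_meas (itg_reflect u ib). Qed.

Let M (p : R * R) := a p.1 * b (p.2 - p.1).

Let mM : measurable_fun setT M.
Proof.
apply: measurable_funM.
  by apply: measurableT_comp (itg_meas ia) _.
apply: measurableT_comp (itg_meas ib) _.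
exact: measurable_funB.
Qed.

Let iM1 w : itg (fun u => M (w, u)).
Proof. by apply: (@itgZ (a w) (fun u => b (u - w))); exact: itg_shift. Qed.

Let Mh w : J (fun u => `|M (w, u)|) <= `|a w| * J (fun u => `|b u|).
Proof.
under eq_J do rewrite /M /= normrM.
rewrite JZ; last by apply: itg_norm; exact: itg_shift.
by have /= -> := J_shift (- w) (itg_norm ib).
Qed.

Let ih : itg (fun w => `|a w| * J (fun u => `|b u|)).
Proof. by under eq_fun do rewrite mulrC; apply: itgZ; exact: itg_norm. Qed.

Lemma itg_conv : itg (fun u => J (fun w => a w * b (u - w))).
Proof. exact: (itg_fubini2 mM iM1 itg_conv_in ih Mh). Qed.

Lemma J_conv : J (fun u => J (fun w => a w * b (u - w))) = J a * J b.
Proof.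
rewrite -(J_fubini mM iM1 itg_conv_in ih Mh) /M /=.
rewrite mulrC -JZ //; apply: eq_J => w.
by rewrite JZ ?(J_shift (- w) ib) 1?mulrC //; exact: itg_shift.
Qed.
End convolution.

Section product_kernel.
Variables (a b : R -> R) (K : R * R -> R) (C : R).
Hypothesis ia : itg a.
Hypothesis ib : itg b.
Hypothesis mK : measurable_fun setT K.
Hypothesis KC : forall p, `|K p| <= C.

Lemma J_swap : J (fun x => a x * J (fun y => b y * K (x, y))) =
  J (fun y => b y * J (fun x => a x * K (x, y))).
Proof.
pose M (p : R * R) := a p.1 * b p.2 * K p.
have mM : measurable_fun setT M.
  apply: measurable_funM => //; apply: measurable_funM.
    by apply: measurableT_comp (itg_meas ia) _.
  by apply: measurableT_comp (itg_meas ib) _.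
have mK1 x : measurable_fun setT (fun y => K (x, y)).
  by apply: measurableT_comp mK _; exact: measurable_pair1.
have mK2 y : measurable_fun setT (fun x => K (x, y)).
  by apply: measurableT_comp mK _; exact: measurable_pair2.
have ib1 x : itg (fun y => b y * K (x, y)) by apply: (itg_bddM ib).
have ia1 y : itg (fun x => a x * K (x, y)) by apply: (itg_bddM ia).
have iM1 x : itg (fun y => M (x, y)).
  by rewrite /M /=; under eq_fun do rewrite -mulrA; apply: itgZ.
have iM2 y : itg (fun x => M (x, y)).
  by rewrite /M /=; under eq_fun do rewrite mulrAC mulrC; apply: itgZ.
have ih : itg (fun x => (C * J (fun y => `|b y|)) * `|a x|) by apply: itgZ; exact: itg_norm.
have Mh x : J (fun y => `|M (x, y)|) <= (C * J (fun y => `|b y|)) * `|a x|.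
  rewrite mulrAC -JZ; last exact: itg_norm.
  apply: le_J; [exact: itg_norm|by apply: itgZ; exact: itg_norm|move=> y].
  rewrite /M !normrM mulrC mulrA ler_wpM2r // ler_wpM2r //.
have := J_fubini mM iM1 iM2 ih Mh; rewrite /M /=.
under eq_J => x do (under eq_J do rewrite -mulrA; rewrite JZ //).
by under [in X in _ = X -> _]eq_J => y do (under eq_J do rewrite mulrAC mulrC; rewrite JZ //).
Qed.
End product_kernel.

Lemma conv_cont (a b : R -> R) (B : R) : itg a -> cont b -> (forall x, `|b x| <= B) ->
  cont (fun u => J (fun w => a w * b (u - w))).
Proof.
move=> ia cb bB x.
apply: (@continuity_under_integral R _ _ mu (fun u w => a w * b (u - w)) setT measurableT (x - 1) (x + 1) _ _ (fun w => B * `|a w|)).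
- move=> u _; apply: (itg_bddM ia) => //.
  by apply: measurableT_comp (continuous_meas cb) _; exact: measurable_funB.
- apply: aeW => w _ u _.
  have : cont (fun u => a w * b (u - w)).
    by apply: contM; [exact: cont_cst|apply: cont_comp cb _; cauto].
  exact.
- by apply: itgZ; exact: itg_norm.
- by move=> u _; apply: aeW => w _; rewrite normrM mulrC ler_wpM2r.
- rewrite inE /= in_itv /=; lra.
Qed.
(** Convergence may fail at 0. This happens for the geometric expansion of [sech2], whose ratio is 1
    there, and for closed cut-offs ending at the origin. *)
Lemma dct0 (f_ : nat -> R -> R) f g : (forall n, measurable_fun setT (f_ n)) -> measurable_fun setT f ->
  (forall x, x != 0 -> tends (f_ ^~ x) (f x)) -> itg g ->
  (forall n x, `|f_ n x| <= g x) -> itg f /\ tends (fun n => J (f_ n)) (J f).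
Proof.
move=> mf mfl cf ig bf.
have [| | | | |h1 _ h2] := @dominated_convergence _ _ R mu setT measurableT
  (fun n => EFin \o f_ n) (EFin \o f) (EFin \o g).
- by move=> n; exact: (measurable_EFinP _ _).2 (mf n).
- exact: (measurable_EFinP _ _).2 mfl.
- exists [set 0]; split => //; first exact: lebesgue_measure_set1.
  move=> x /= hx; apply: contrapT => /eqP x0; apply: hx => _.
  by apply: cvg_EFin; [exact: nearW|exact: cf].
- exact: ig.
- by apply: aeW => x n _; rewrite /= lee_fin.
split => //.
rewrite /tends /J /Rintegral.
apply: fine_cvg.
by rewrite fineK //; exact: integrable_fin_num h1.
Qed.

Lemma J_sum (n : nat) (F : nat -> R -> R) : (forall j, itg (F j)) ->
  itg (fun x => \sum_(0 <= j < n) F j x) /\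
  J (fun x => \sum_(0 <= j < n) F j x) = \sum_(0 <= j < n) J (F j).
Proof.
move=> h; elim: n => [|n [ih1 ih2]].
  under eq_fun do rewrite big_geq //; rewrite big_geq //; split; first exact: itg0.
  by rewrite /J Rintegral_cst // mul0r.
under eq_fun do rewrite big_nat_recr //=; rewrite big_nat_recr //= -ih2; split; first exact: itgD.
exact: JD.
Qed.

Lemma J_odd f : itg f -> (forall x, f (- x) = - f x) -> J f = 0.
Proof.
move=> h o; have := J_opp h; under eq_J do rewrite o -mulN1r.
by rewrite JZ // => ?; lra.
Qed.
End line_integral.

(** * Partial fractions of tanh and 1 / cosh *)

Section tannery.
Context {R : realType}.

(** Dominated convergence for sums of growing length: the convergent majorant [c] provides a [K]
    beyond which all tails are below [e / 4], and only finitely many terms remain to be compared. *)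
Lemma tannery (a : nat -> nat -> R) (b c : nat -> R) (m : nat -> nat) (B : R) :
  (forall n j, `|a n j| <= c j) -> cvgn (series c) ->
  (forall j, tends (a ^~ j) (b j)) -> (fun n => (m n)%:R : R) @ \oo --> +oo ->
  tends (series b) B ->
  tends (fun n => \sum_(0 <= j < m n) a n j) B.
Proof.
move=> ac cc ab mi bB.
have c0 j : 0 <= c j by apply: le_trans (ac 0%N j).
have bc j : `|b j| <= c j.
  by apply: (tends_le (tends_norm (ab j))); near=> n; exact: ac.
pose C := limn (series c).
have sC n : series c n <= C.
  apply: nondecreasing_cvgn_le => //; apply/nondecreasing_seqP => k.
  by rewrite seriesSr lerDl.
have tail (d : nat -> R) (dc : forall j, `|d j| <= c j) k l : (k <= l)%N ->
    `|series d l - series d k| <= C - series c k.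
  move=> kl; rewrite sub_series_geq //.
  apply: le_trans (ler_norm_sum _ _ _) _.
  apply: le_trans (ler_sum _ (fun j _ => dc j)) _.
  by rewrite -sub_series_geq // lerB.
apply/cvgrPdist_lt => e e0.
have e3 : 0 < e / 4 by rewrite divr_gt0.
have [K _ HK] : \forall k \near \oo, C - series c k < e / 4.
  have /cvgrPdist_lt /(_ _ e3) := cc.
  apply: filterS => k; apply: le_lt_trans; exact: ler_norm.
have HK' := HK K (leqnn K).
have H1 : \forall n \near \oo, `|\sum_(0 <= j < K) a n j - \sum_(0 <= j < K) b j| < e / 4.
  have : (fun n => \sum_(0 <= j < K) a n j) @ \oo --> \sum_(0 <= j < K) b j.
    elim: K {HK HK'} => [|k ih].
      by rewrite big_geq //; under eq_fun do rewrite big_geq //; exact: cvg_cst.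
    rewrite big_nat_recr //=; under eq_fun do rewrite big_nat_recr //=.
    exact: (tendsD ih (ab k)).
  by move=> /cvgrPdist_lt /(_ _ e3); apply: filterS => n; rewrite distrC.
have H2 : `|B - series b K| <= e / 4.
  apply: (tends_le (tends_norm (tendsB bB (@tends_cst R (series b K))))).
  near=> n; apply: le_trans (tail b bc _ _ _) (ltW HK').
  by near: n; exact: nbhs_infty_ge.
near=> n.
have Km : (K <= m n)%N.
  rewrite -(ler_nat R); near: n; move: mi => /cvgryPge; exact.
have H3 := tail (a n) (ac n) _ _ Km.
have H4 : `|\sum_(0 <= j < K) a n j - \sum_(0 <= j < K) b j| < e / 4 by near: n.
rewrite /series /= in H2 H3.
set s := \sum_(0 <= j < m n) a n j in H3 *.
set s1 := \sum_(0 <= j < K) a n j in H3 H4.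
set s2 := \sum_(0 <= j < K) b j in H2 H4.
have -> : B - s = (B - s2) - (s1 - s2) - (s - s1) by ring.
apply: le_lt_trans (ler_normB _ _) _.
apply: le_lt_trans (lerD (ler_normB _ _) (lexx _)) _.
move: H2 H3 H4 HK'; rewrite /series /=; lra.
Unshelve. all: by end_near. Qed.

Lemma cvg_series_invsq : cvgn (series (fun j : nat => (j.+1%:R ^+ 2)^-1 : R)).
Proof.
apply: nondecreasing_is_cvgn.
  by apply/nondecreasing_seqP => k; rewrite seriesSr lerDl invr_ge0 exprn_ge0.
exists 2 => _ [[|n] _ <-]; first by rewrite /series /= big_geq.
(* The sharper bound is what induction can carry, since [1 / (x + 1)^2 <= 1 / x - 1 / (x + 1)]. *)
suff : series (fun j : nat => (j.+1%:R ^+ 2)^-1 : R) n.+1 <= 2 - n.+1%:R^-1.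
  by move=> /le_trans; apply; rewrite gerBl invr_ge0.
elim: n => [|n ih]; first by rewrite /series /= big_nat1 expr1n invr1; lra.
rewrite seriesSr; apply: le_trans (lerD ih (lexx _)) _.
have n0 : 0 < n.+1%:R :> R by [].
rewrite -[n.+2]addn1 natrD.
set x : R := n.+1%:R in n0 *.
rewrite -subr_ge0.
have -> : 2 - (x + 1)^-1 - (2 - x^-1 + ((x + 1) ^+ 2)^-1) = (x * (x + 1) ^+ 2)^-1.
  by field; rewrite !gt_eqF //; lra.
by rewrite invr_ge0 mulr_ge0 ?exprn_ge0 ?ltW // addr_gt0.
Qed.
End tannery.

(** * Doubling formulas for the kernels of the strip *)

Section hyperbolic.
Context {R : realType}.
Implicit Types x y t : R.

Definition sinh x : R := (expR x - expR (- x)) / 2.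

Lemma cosh_ge1 x : 1 <= cosh x.
Proof.
rewrite /cosh expRN; have := expR_gt0 x; set q := expR x => q0.
rewrite -subr_ge0 (_ : _ - 1 = (q - 1) ^+ 2 / (2 * q)); last by field; rewrite gt_eqF.
by rewrite divr_ge0 ?sqr_ge0 // mulr_ge0 // ltW.
Qed.

Lemma cosh2 y : cosh (2 * y) = 2 * cosh y ^+ 2 - 1.
Proof.
rewrite /cosh mulr_natl mulr2n opprD !expRD expRN; field.
by rewrite gt_eqF // expR_gt0.
Qed.

Lemma sinh2 y : sinh (2 * y) = 2 * sinh y * cosh y.
Proof.
rewrite /sinh /cosh mulr_natl mulr2n opprD !expRD expRN; field.
by rewrite gt_eqF // expR_gt0.
Qed.

Lemma sinh_ge0 y : 0 <= y -> 0 <= sinh y.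
Proof. by move=> y0; rewrite divr_ge0 // subr_ge0 ler_expR; lra. Qed.

Lemma cosM2 t : cos (2 * t) = 2 * cos t ^+ 2 - 1.
Proof. by rewrite mulr_natl cos_mulr2n [2 * _]mulr_natl. Qed.

Lemma sinM2 t : sin (2 * t) = 2 * (sin t * cos t).
Proof. by rewrite mulr_natl sin_mulr2n [2 * _]mulr_natl mulrC. Qed.

(** A crude constant is enough for domination. On [[0, pi/4]] the cosine is at least [1/2], so the
    mean value theorem gives [sin z >= z / 2]; the double angle formula extends this to
    [[0, pi/2]]. *)
Lemma sin_lower t : 0 <= t -> t <= pi / 2 -> t / 4 <= sin t.
Proof.
move=> t0 tp.
have pi0 := @pi_gt0 R.
have c4 : cos (pi / 4 : R) ^+ 2 = 1 / 2.
  have := cosM2 (pi / 4 : R); rewrite (_ : 2 * (pi / 4) = pi / 2); last by field.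
  by rewrite cos_pihalf; lra.
have c40 (z : R) : 0 <= z -> z <= pi / 4 -> 1 / 2 <= cos z.
  move=> z0 zp.
  have h : 1 / 2 <= cos (pi / 4 : R).
    have := @cos_gt0_pihalf R (pi / 4) _; nra.
  apply: le_trans h _.
  have [->//|zp'] := eqVneq z (pi / 4).
  by rewrite ltW // ltr_cos ?in_itv /= ?lt_neqAle ?zp' //; lra.
have sz (z : R) : 0 <= z -> z <= pi / 4 -> z / 2 <= sin z.
  move=> z0 zp; have [->|z0'] := eqVneq z 0; first by rewrite sin0 mul0r.
  have zgt0 : 0 < z by rewrite lt_neqAle eq_sym z0' z0.
  have [w /andP[w0 wz]] := mvt zgt0 (fun x _ _ => is_derive_sin x).
  rewrite sin0 !subr0 => ->; rewrite mulrC ler_wpM2r //.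
  by rewrite -[2^-1]mul1r; apply: c40; rewrite ?ltW // (lt_le_trans wz).
have ht : sin t = 2 * (sin (t / 2) * cos (t / 2)) by rewrite -sinM2; congr sin; field.
have h1 := c40 (t / 2); have h2 := sz (t / 2).
have : 1 / 2 <= cos (t / 2) by apply: h1; lra.
have : t / 2 / 2 <= sin (t / 2) by apply: h2; lra.
rewrite ht; set c := cos _; set s := sin _ => hs hc.
nra.
Qed.

Lemma one_sub_cos_lower t : 0 <= t -> t <= pi -> t ^+ 2 / 32 <= 1 - cos t.
Proof.
move=> t0 tp.
have h : t / 2 / 4 <= sin (t / 2) by apply: sin_lower; lra.
have -> : cos t = 1 - 2 * sin (t / 2) ^+ 2.
  by rewrite -[in LHS](_ : 2 * (t / 2) = t) ?cosM2 ?cos2sin2; [ring|field].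
have : 0 <= t / 2 / 4 by lra.
nra.
Qed.

Lemma cosh_sub_cos_lower y t : 0 <= t -> t <= pi -> t ^+ 2 / 32 <= cosh y - cos t.
Proof. by move=> t0 tp; have := one_sub_cos_lower t0 tp; have := cosh_ge1 y; lra. Qed.

Lemma cosh_sub_cos_gt0 y t : 0 < t -> t <= pi -> 0 < cosh y - cos t.
Proof.
move=> t0 tp; apply: lt_le_trans (cosh_sub_cos_lower y (ltW t0) tp).
by rewrite divr_gt0 // exprn_gt0.
Qed.

(* The Poisson kernel of the strip and its harmonic conjugate: the real and
   imaginary parts of coth ((y + i t) / 2). *)
Definition pker y t : R := sinh y / (cosh y - cos t).
Definition qker y t : R := sin t / (cosh y - cos t).

Lemma cosBpi t : cos (pi - t) = - cos t.
Proof. by rewrite cosB cospi sinpi; ring. Qed.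
Lemma sinBpi t : sin (pi - t) = sin t.
Proof. by rewrite sinB cospi sinpi; ring. Qed.

(** This is [2 coth (2 z) = coth z + coth (z + i pi / 2)] at [z = (y + i t) / 2]. The shifted angle
    [t + pi] is reflected to [pi - t], which stays in []0, pi[] where the denominators are
    positive. *)
Lemma pker_double y t : 0 < t -> t < pi ->
  pker (2 * y) (2 * t) = (pker y t + pker y (pi - t)) / 2.
Proof.
move=> t0 tp.
have h1 : cosh y - cos t != 0 by rewrite gt_eqF // cosh_sub_cos_gt0 // ltW.
have h2 : cosh y + cos t != 0.
  have := @cosh_sub_cos_gt0 y (pi - t); rewrite cosBpi opprK => h.
  by rewrite gt_eqF // h //; lra.
rewrite /pker cosh2 sinh2 cosBpi opprK cosM2.
rewrite (_ : 2 * cosh y ^+ 2 - 1 - (2 * cos t ^+ 2 - 1) = 2 * (cosh y - cos t) * (cosh y + cos t)); last by ring.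
by field; rewrite h1 h2.
Qed.

(** The reflection of [t + pi] to [pi - t] changes the sign of this kernel, odd in [t]; hence the
    minus. *)
Lemma qker_double y t : 0 < t -> t < pi ->
  qker (2 * y) (2 * t) = (qker y t - qker y (pi - t)) / 2.
Proof.
move=> t0 tp.
have h1 : cosh y - cos t != 0 by rewrite gt_eqF // cosh_sub_cos_gt0 // ltW.
have h2 : cosh y + cos t != 0.
  have := @cosh_sub_cos_gt0 y (pi - t); rewrite cosBpi opprK => h.
  by rewrite gt_eqF // h //; lra.
rewrite /qker cosh2 cosBpi sinBpi opprK cosM2 sinM2.
rewrite (_ : 2 * cosh y ^+ 2 - 1 - (2 * cos t ^+ 2 - 1) = 2 * (cosh y - cos t) * (cosh y + cos t)); last by ring.
by field; rewrite h1 h2.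
Qed.

(** The zeros of [cosh], that is the poles of [tanh] and [1 / cosh], are plus or minus [i] times
    these numbers. *)
Definition node (j : nat) : R := (2 * j%:R + 1) * (pi / 2).

Lemma node_gt0 j : 0 < node j.
Proof. by rewrite mulr_gt0 ?divr_gt0 ?pi_gt0 // addr_gt0 // ltr_wpDl // mulr_ge0. Qed.

Lemma sum_pow2_fold (G : nat -> R) n : \sum_(0 <= j < 2 ^ n.+1) G j =
  \sum_(0 <= j < 2 ^ n) G j + \sum_(0 <= j < 2 ^ n) G (2 ^ n.+1 - j.+1)%N.
Proof.
have E : (2 ^ n.+1 = 2 ^ n + 2 ^ n)%N by rewrite expnS mul2n -addnn.
rewrite E (@big_cat_nat _ _ _ (2 ^ n)) ?leq_addr //=; congr (_ + _).
rewrite -{1}[(2 ^ n)%N]add0n big_addn addnK big_nat_rev /= add0n.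
rewrite big_nat [RHS]big_nat; apply: eq_bigr => j /andP[_ jn].
by rewrite addnC addnBA.
Qed.

(** Each doubling step replaces a node by itself and its reflection, and [pi - node j / 2^(n+1)] is
    again a node, that of index [2^(n+1) - j - 1]. The sign [e] is 1 for [pker] and -1 for
    [qker]. *)
Lemma ker_iter (F : R -> R -> R) (e : R) (y : R) n : e * e = 1 ->
  (forall y t, 0 < t -> t < pi -> F (2 * y) (2 * t) = (F y t + e * F y (pi - t)) / 2) ->
  F y (pi / 2) = (2 ^+ n)^-1 * \sum_(0 <= j < 2 ^ n) e ^+ j * F (y / 2 ^+ n) (node j / 2 ^+ n).
Proof.
move=> ee FE; have pi0 := @pi_gt0 R.
elim: n => [|n ih].
  by rewrite expn0 big_nat1 !expr0 invr1 !mul1r !mulr1 /node mulr0 add0r mul1r.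
rewrite {}ih.
have N0 : 0 < 2 ^+ n :> R by rewrite exprn_gt0.
have N1 : 0 < 2 ^+ n.+1 :> R by rewrite exprn_gt0.
have step j : (j < 2 ^ n)%N -> F (y / 2 ^+ n) (node j / 2 ^+ n) =
    (F (y / 2 ^+ n.+1) (node j / 2 ^+ n.+1) + e * F (y / 2 ^+ n.+1) (node (2 ^ n.+1 - j.+1) / 2 ^+ n.+1)) / 2.
  move=> jn.
  have -> : y / 2 ^+ n = 2 * (y / 2 ^+ n.+1) by rewrite exprS; field; rewrite gt_eqF.
  have -> : node j / 2 ^+ n = 2 * (node j / 2 ^+ n.+1) by rewrite exprS; field; rewrite gt_eqF.
  rewrite FE; last 2 first.
  - by rewrite divr_gt0 // node_gt0.
  - rewrite ltr_pdivrMr // /node exprS.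
    have : j.+1%:R <= 2 ^+ n :> R by rewrite -natrX ler_nat.
    rewrite -natr1; nra.
  congr ((_ + e * F _ _) / _).
  rewrite /node natrB; last by rewrite expnS; apply: leq_trans jn _; rewrite leq_pmull.
  rewrite natrX -natr1 exprS; field; by rewrite gt_eqF.
rewrite big_nat; under eq_bigr => j /andP[_ jn] do rewrite step //.
rewrite -big_nat.
have e2 k : e ^+ (k + k) = 1 by rewrite addnn -mul2n exprM expr2 ee expr1n.
rewrite sum_pow2_fold.
(* Since [2^(n+1)] is even and [e^2 = 1], the sign at index [2^(n+1) - j - 1] is [e^(j+1)]. *)
rewrite [X in _ = _ * (_ + X)](_ : _ = \sum_(0 <= j < 2 ^ n) e ^+ j.+1 * F (y / 2 ^+ n.+1) (node (2 ^ n.+1 - j.+1) / 2 ^+ n.+1)); last first.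
  rewrite big_nat [RHS]big_nat; apply: eq_bigr => j /andP[_ jn].
  congr (_ * _).
  rewrite -[LHS]mulr1 -{1}(e2 j.+1) exprD mulrA -exprD subnK; last first.
    by rewrite expnS; apply: leq_trans jn _; rewrite leq_pmull.
  by rewrite expnS mul2n -addnn e2 mul1r.
rewrite -big_split /= (_ : (2 ^+ n.+1)^-1 = (2 ^+ n)^-1 / 2); last by rewrite exprS invfM mulrC.
rewrite -mulrA; congr (_ * _).
rewrite mulr_sumr; apply: eq_bigr => j _.
by rewrite exprSr; ring.
Qed.

Lemma sinh_pow y n : 0 <= y -> 2 ^+ n * sinh (y / 2 ^+ n) <= sinh y.
Proof.
move=> y0; elim: n => [|n]; first by rewrite expr0 mul1r divr1.
apply: le_trans.
rewrite exprSr -mulrA ler_pM2l ?exprn_gt0 //.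
have -> : y / 2 ^+ n = 2 * (y / 2 ^+ n.+1).
  by rewrite exprS; field; rewrite gt_eqF // exprn_gt0.
rewrite sinh2 -exprSr ler_peMr ?cosh_ge1 // mulr_ge0 // sinh_ge0 // divr_ge0 // exprn_ge0.
Qed.

Lemma cvg_pow2 : (fun n : nat => 2 ^+ n : R) @ \oo --> +oo.
Proof.
apply/cvgryPge => A; near=> n.
have : A <= n%:R by near: n; exact: nbhs_infty_ger.
move=> /le_trans; apply; rewrite -natrX ler_nat ltnW //; exact: ltn_expl.
Unshelve. all: by end_near. Qed.

Lemma cvg_pow2V : tends (fun n : nat => (2 ^+ n)^-1 : R) 0.
Proof. by apply/gtr0_cvgV0; [near=> n; rewrite exprn_gt0|exact: cvg_pow2].
Unshelve. all: by end_near. Qed.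

Lemma cvg_quot0 (f : R -> R) (a : R) (e : nat -> R) : drv 0 f a -> f 0 = 0 ->
  (forall n, e n != 0) -> tends e 0 -> tends (fun n => (e n)^-1 * f (e n)) a.
Proof.
move=> [d1 d2] f0 e0 ce.
have : (fun h => h^-1 *: ((f \o shift 0) (h *: (1 : R)) - f 0)) @ 0^' --> a.
  by rewrite -d2; exact: d1.
move=> /cvgr_dnbhsP h; have := h e (conj e0 ce).
apply: cvg_trans; apply: near_eq_cvg; apply: nearW => n /=.
by rewrite f0 subr0 addr0 /GRing.scale /= mulr1.
Qed.

Lemma drv_cosh x : drv x (@cosh R) (sinh x).
Proof.
rewrite /cosh; apply: drv_eq; first by dauto.
by rewrite /sinh /=; ring.
Qed.

Lemma drv_sinh x : drv x sinh (cosh x).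
Proof.
rewrite /sinh; apply: drv_eq; first by dauto.
by rewrite /cosh /=; ring.
Qed.

Lemma cosh0 : cosh 0 = 1 :> R.
Proof. by rewrite /cosh oppr0 expR0; field. Qed.
Lemma sinh0 : sinh 0 = 0.
Proof. by rewrite /sinh oppr0 expR0 subrr mul0r. Qed.

Lemma cosh_sub1 y : cosh y - 1 = 2 * sinh (y / 2) ^+ 2.
Proof.
rewrite -[in LHS](_ : 2 * (y / 2) = y) ?cosh2; last by field.
have : cosh (y / 2) ^+ 2 - sinh (y / 2) ^+ 2 = 1.
  rewrite /cosh /sinh expRN; field; by rewrite gt_eqF // expR_gt0.
move=> h; rewrite -[1 in RHS]/(1 : R); nra.
Qed.

Lemma cos_sub1 t : 1 - cos t = 2 * sin (t / 2) ^+ 2.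
Proof.
by rewrite -[in LHS](_ : 2 * (t / 2) = t) ?cosM2 ?cos2sin2; [ring|field].
Qed.

Lemma cvg_sinhN y : tends (fun n : nat => 2 ^+ n * sinh (y / 2 ^+ n)) y.
Proof.
have H : drv 0 (fun h => sinh (y * h)) y.
  apply: drv_eq; first by apply: (@drv_comp _ _ sinh (fun h => y * h) _ _ (drv_sinh _)); dauto.
  by rewrite /= mulr0 cosh0; ring.
have := cvg_quot0 H _ _ cvg_pow2V; rewrite mulr0 sinh0 => /(_ erefl).
under eq_fun do rewrite invrK.
by apply => n; rewrite invr_eq0 gt_eqF // exprn_gt0.
Qed.

Lemma cvg_sinN y : tends (fun n : nat => 2 ^+ n * sin (y / 2 ^+ n)) y.
Proof.
have H : drv 0 (fun h => sin (y * h)) y.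
  apply: drv_eq; first by dauto.
  by rewrite /= mulr0 cos0; ring.
have := cvg_quot0 H _ _ cvg_pow2V; rewrite mulr0 sin0 => /(_ erefl).
under eq_fun do rewrite invrK.
by apply => n; rewrite invr_eq0 gt_eqF // exprn_gt0.
Qed.

(** Writing the difference as [2 sinh^2 (y/2) + 2 sin^2 (t/2)] reduces the second-order limit to
    first-order ones. *)
Lemma cvg_cosh_sub_cos y t :
  tends (fun n : nat => (2 ^+ n) ^+ 2 * (cosh (y / 2 ^+ n) - cos (t / 2 ^+ n))) ((y ^+ 2 + t ^+ 2) / 2).
Proof.
have -> : (y ^+ 2 + t ^+ 2) / 2 = 2 * (y / 2) ^+ 2 + 2 * (t / 2) ^+ 2 by field.
have -> : (fun n : nat => (2 ^+ n) ^+ 2 * (cosh (y / 2 ^+ n) - cos (t / 2 ^+ n))) =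
  (fun n : nat => 2 * (2 ^+ n * sinh (y / 2 / 2 ^+ n)) ^+ 2 + 2 * (2 ^+ n * sin (t / 2 / 2 ^+ n)) ^+ 2).
  apply/funext => n.
  have := cosh_sub1 (y / 2 ^+ n); have := cos_sub1 (t / 2 ^+ n).
  rewrite ![_ / 2 ^+ n / 2]mulrAC => h1 h2.
  have -> : cosh (y / 2 ^+ n) - cos (t / 2 ^+ n) = (cosh (y / 2 ^+ n) - 1) + (1 - cos (t / 2 ^+ n)) by ring.
  by rewrite h1 h2; ring.
apply: tendsD; apply: (tendsM (@tends_cst R 2)); apply: tendsX.
  exact: cvg_sinhN.
exact: cvg_sinN.
Qed.

Lemma sumsq_gt0 y t : 0 < t -> 0 < y ^+ 2 + t ^+ 2.
Proof. by move=> t0; rewrite ltr_wpDl ?sqr_ge0 // exprn_gt0. Qed.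

Lemma cvg_pker y t : 0 < t ->
  tends (fun n : nat => (2 ^+ n)^-1 * pker (y / 2 ^+ n) (t / 2 ^+ n)) (2 * y / (y ^+ 2 + t ^+ 2)).
Proof.
move=> t0; have h := sumsq_gt0 y t0.
have -> : 2 * y / (y ^+ 2 + t ^+ 2) = y * ((y ^+ 2 + t ^+ 2) / 2)^-1.
  by field; rewrite gt_eqF.
apply: tends_ext (tendsM (@cvg_sinhN y) (tendsV (lt0r_neq0 (divr_gt0 h (ltr0Sn _ 1))) (@cvg_cosh_sub_cos y t))) _ => n.
rewrite /pker.
have N0 : 2 ^+ n != 0 :> R by rewrite expf_neq0.
set D := cosh _ - _; set S := sinh _.
have [->|D0] := eqVneq D 0; first by rewrite !(invr0, mulr0).
by field; rewrite N0 D0.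
Qed.

Lemma cvg_qker y t : 0 < t ->
  tends (fun n : nat => (2 ^+ n)^-1 * qker (y / 2 ^+ n) (t / 2 ^+ n)) (2 * t / (y ^+ 2 + t ^+ 2)).
Proof.
move=> t0; have h := sumsq_gt0 y t0.
have -> : 2 * t / (y ^+ 2 + t ^+ 2) = t * ((y ^+ 2 + t ^+ 2) / 2)^-1.
  by field; rewrite gt_eqF.
apply: tends_ext (tendsM (@cvg_sinN t) (tendsV (lt0r_neq0 (divr_gt0 h (ltr0Sn _ 1))) (@cvg_cosh_sub_cos y t))) _ => n.
rewrite /qker.
have N0 : 2 ^+ n != 0 :> R by rewrite expf_neq0.
set D := cosh _ - _; set S := sin _.
have [->|D0] := eqVneq D 0; first by rewrite !(invr0, mulr0).
by field; rewrite N0 D0.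
Qed.

Lemma node_lt j n : (j < 2 ^ n)%N -> node j / 2 ^+ n < pi.
Proof.
move=> jn; have pi0 := @pi_gt0 R.
rewrite ltr_pdivrMr ?exprn_gt0 // /node.
have : j.+1%:R <= 2 ^+ n :> R by rewrite -natrX ler_nat.
rewrite -natr1; nra.
Qed.

Lemma node_lower j : j.+1%:R <= node j.
Proof.
have : 0 <= j%:R :> R by [].
have := @pi_ge2 R; rewrite /node -(natr1 j) => p2 j0.
have : 0 <= (2 * j%:R + 1) * (pi / 2 - 1) :> R by rewrite mulr_ge0 //; lra.
lra.
Qed.

Lemma invsq_node j : ((node j) ^+ 2)^-1 <= (j.+1%:R ^+ 2)^-1.
Proof.
rewrite lef_pV2 ?posrE ?exprn_gt0 ?node_gt0 //.
by rewrite ler_pXn2r ?nnegrE ?node_lower // ltW // node_gt0.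
Qed.

(** The majorant is independent of [n]: the denominator is at least [t^2 / 32] with
    [t = node j / 2^n], while [2^n sinh (y / 2^n) <= sinh y] and [node j >= j + 1]. *)
Lemma pker_bound y j n : 0 <= y -> (j < 2 ^ n)%N ->
  `|(2 ^+ n)^-1 * pker (y / 2 ^+ n) (node j / 2 ^+ n)| <= 32 * sinh y * (j.+1%:R ^+ 2)^-1.
Proof.
move=> y0 jn.
have N0 : 0 < 2 ^+ n :> R by rewrite exprn_gt0.
have th0 := node_gt0 j.
have t0 : 0 < node j / 2 ^+ n by rewrite divr_gt0.
have tp := node_lt jn.
have D0 := cosh_sub_cos_gt0 (y / 2 ^+ n) t0 (ltW tp).
have D1 := cosh_sub_cos_lower (y / 2 ^+ n) (ltW t0) (ltW tp).
have S0 : 0 <= sinh (y / 2 ^+ n) by rewrite sinh_ge0 // divr_ge0 // ltW.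
have S1 := sinh_pow n y0.
rewrite ger0_norm; last by apply: mulr_ge0; [rewrite invr_ge0 ltW|apply: divr_ge0; [|exact: ltW]].
apply: (@le_trans _ _ (32 * sinh y * (node j ^+ 2)^-1)); last first.
  by rewrite ler_wpM2l ?invsq_node // mulr_ge0 // sinh_ge0.
rewrite /pker; apply: (@le_trans _ _ ((2 ^+ n)^-1 * (sinh (y / 2 ^+ n) / ((node j / 2 ^+ n) ^+ 2 / 32)))).
  rewrite ler_pM2l ?invr_gt0 // ler_wpM2l // lef_pV2 ?posrE //.
  by rewrite divr_gt0 // exprn_gt0.
have -> : (2 ^+ n)^-1 * (sinh (y / 2 ^+ n) / ((node j / 2 ^+ n) ^+ 2 / 32)) = 32 * (2 ^+ n * sinh (y / 2 ^+ n)) * (node j ^+ 2)^-1.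
  by field; rewrite !gt_eqF.
apply: ler_wpM2r; first by rewrite invr_ge0 exprn_ge0 // ltW.
by rewrite ler_wpM2l.
Qed.

(** At [t = pi / 2] the cosine vanishes and [pker] is [tanh]; [ker_iter] expresses it by [2^n]
    nodes, and each rescaled term tends to a partial fraction. *)
Lemma series_tanh y : 0 <= y ->
  tends (series (fun j => 2 * y / (y ^+ 2 + node j ^+ 2))) (sinh y / cosh y).
Proof.
move=> y0.
pose c j := 32 * sinh y * (j.+1%:R ^+ 2)^-1.
have cc : cvgn (series c).
  have : cvgn (series ((32 * sinh y) *: (fun j : nat => (j.+1%:R ^+ 2)^-1 : R))).
    by apply: is_cvg_seriesZ; exact: cvg_series_invsq.
  exact.
pose b j := 2 * y / (y ^+ 2 + node j ^+ 2).
have bc j : `|b j| <= c j.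
  have h := pker_bound y0.
  apply: (tends_le (tends_norm (@cvg_pker y _ (node_gt0 j)))).
  near=> n; apply: h.
  have : (j <= n)%N by near: n; exact: nbhs_infty_ge.
  by move=> /leq_ltn_trans; apply; exact: ltn_expl.
have cb : cvgn (series b).
  apply: normed_cvg.
  apply: (@series_le_cvg _ (fun j => `|b j|) c) => // j.
  by apply: le_trans (bc j).
pose a n j := if (j < 2 ^ n)%N then (2 ^+ n)^-1 * pker (y / 2 ^+ n) (node j / 2 ^+ n) else 0.
have H := @tannery R a b c (fun n => 2 ^ n)%N (limn (series b)) _ cc _ _ cb.
suff <- : limn (series b) = sinh y / cosh y by exact: cb.
apply: (tends_unique (H _ _ _)) => //.
- move=> n j; rewrite /a; case: ifP => [jn|_]; first exact: pker_bound.
  by rewrite normr0; apply: le_trans (bc j).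
- move=> j; apply: tends_near (@cvg_pker y _ (node_gt0 j)) _.
  near=> n; rewrite /a ifT //.
  have : (j <= n)%N by near: n; exact: nbhs_infty_ge.
  by move=> /leq_ltn_trans; apply; exact: ltn_expl.
- by under eq_fun do rewrite natrX; exact: cvg_pow2.
apply: cvg_near_cst; apply: nearW => n.
rewrite /a big_nat; under eq_bigr => j /andP[_ jn] do rewrite jn.
rewrite -big_nat -mulr_sumr.
have := @ker_iter pker 1 y n (mulr1 1) _.
under eq_bigr do rewrite expr1n mul1r.
rewrite /pker cos_pihalf subr0 => -> // => {H} z t t0 tp.
by rewrite mul1r; exact: pker_double.
Unshelve. all: by end_near. Qed.

(** A single term decays only like [1 / j], which is not summable; in a difference of neighbours the
    mean value theorem gains the missing factor. *)
Lemma qker_bound y j n : (j.*2.+1 < 2 ^ n)%N ->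
  `|(2 ^+ n)^-1 * (qker (y / 2 ^+ n) (node j.*2 / 2 ^+ n) - qker (y / 2 ^+ n) (node j.*2.+1 / 2 ^+ n))|
  <= 32 * pi * (j.*2.+1%:R ^+ 2)^-1.
Proof.
move=> jn.
have pi0 := @pi_gt0 R.
have N0 : 0 < 2 ^+ n :> R by rewrite exprn_gt0.
have th0 := node_gt0 j.*2.
set eta := y / 2 ^+ n; set a := node j.*2 / 2 ^+ n; set b := node j.*2.+1 / 2 ^+ n.
have a0 : 0 < a by rewrite divr_gt0.
have ba : b - a = pi / 2 ^+ n.
  by rewrite /b /a /node -(natr1 j.*2); field; rewrite gt_eqF.
have ab : a < b by rewrite -subr_gt0 ba divr_gt0.
have bp : b < pi by exact: node_lt.
pose q' t := (cos t * cosh eta - 1) / (cosh eta - cos t) ^+ 2.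
have dq t : a <= t -> t <= b -> drv t (qker eta) (q' t).
  move=> at_ tb.
  have D0 : cosh eta - cos t != 0.
    by rewrite gt_eqF // cosh_sub_cos_gt0 ?(lt_le_trans a0) // (le_trans tb) // ltW.
  rewrite /qker; apply: drv_eq; first by dauto.
  rewrite /q' /=.
  have h : cos t * cosh eta - 1 = cos t * (cosh eta - cos t) - sin t ^+ 2 by rewrite sin2cos2; ring.
  rewrite h; field.
  by rewrite D0.
have [c /andP[ac cb] E] := mvt ab dq.
have tc0 : 0 <= c by rewrite ltW // (lt_trans a0).
have tcp : c <= pi by rewrite ltW // (lt_trans cb).
have D0 : 0 < cosh eta - cos c by rewrite cosh_sub_cos_gt0 ?(lt_trans a0).
have D1 := cosh_sub_cos_lower eta tc0 tcp.
have q'b : `|q' c| <= (a ^+ 2 / 32)^-1.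
  have a1 : 0 < a ^+ 2 / 32 by rewrite divr_gt0 // exprn_gt0.
  have aD : a ^+ 2 / 32 <= cosh eta - cos c.
    apply: le_trans D1; rewrite ler_pM2r // ler_pXn2r ?nnegrE // ltW //.
  apply: (@le_trans _ _ (cosh eta - cos c)^-1); last by rewrite lef_pV2.
  rewrite /q' normrM normfV normrX (gtr0_norm D0) ler_pdivrMr ?exprn_gt0 //.
  rewrite (_ : _^-1 * _ = cosh eta - cos c); last by field; rewrite gt_eqF.
  (* The two inequalities are [(cosh eta - 1) (1 + cos c) >= 0] and
     [(cosh eta + 1) (1 - cos c) >= 0]. *)
  have c1 := cosh_ge1 eta; have := cos_le1 c; have := cos_geN1 c => h1 h2.
  rewrite ler_norml; apply/andP; split; nra.
rewrite -normrN -mulrN opprB E ba normrM normrM normfV (gtr0_norm N0) (gtr0_norm (divr_gt0 pi0 N0)).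
apply: (@le_trans _ _ ((2 ^+ n)^-1 * ((a ^+ 2 / 32)^-1 * (pi / 2 ^+ n)))).
  by rewrite ler_pM2l ?invr_gt0 // ler_pM2r // divr_gt0.
have -> : (2 ^+ n)^-1 * ((a ^+ 2 / 32)^-1 * (pi / 2 ^+ n)) = 32 * pi * (node j.*2 ^+ 2)^-1.
  by rewrite /a; field; rewrite !gt_eqF.
by rewrite ler_wpM2l ?invsq_node // mulr_ge0 // ltW.
Qed.

Lemma sum_pairs (G : nat -> R) m : \sum_(0 <= j < m.*2) G j = \sum_(0 <= j < m) (G j.*2 + G j.*2.+1).
Proof.
elim: m => [|m ih]; first by rewrite !big_geq.
by rewrite doubleS !big_nat_recr //= ih addrA.
Qed.

(** [qker] at [pi / 2] is [1 / cosh]. The alternating sum of its nodes is grouped in pairs, the form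
    in which it converges absolutely. *)
Lemma series_sech y :
  tends (series (fun j => 2 * node j.*2 / (y ^+ 2 + node j.*2 ^+ 2) - 2 * node j.*2.+1 / (y ^+ 2 + node j.*2.+1 ^+ 2))) (cosh y)^-1.
Proof.
pose c j := 32 * pi * (j.+1%:R ^+ 2)^-1 : R.
have pi0 := @pi_gt0 R.
have cc : cvgn (series c).
  have : cvgn (series ((32 * pi) *: (fun j : nat => (j.+1%:R ^+ 2)^-1 : R))).
    by apply: is_cvg_seriesZ; exact: cvg_series_invsq.
  exact.
have c0 j : 32 * pi * (j.*2.+1%:R ^+ 2)^-1 <= c j.
  rewrite ler_wpM2l //; first by rewrite mulr_ge0 // ltW.
  by rewrite lef_pV2 ?posrE ?exprn_gt0 // ler_pXn2r ?nnegrE // ler_nat ltnS -addnn leq_addr.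
pose b j := 2 * node j.*2 / (y ^+ 2 + node j.*2 ^+ 2) - 2 * node j.*2.+1 / (y ^+ 2 + node j.*2.+1 ^+ 2).
(* With [2^(n+1)] nodes there are exactly [2^n] pairs, also for [n = 0]. *)
pose a n j := if (j.*2.+1 < 2 ^ n.+1)%N then (2 ^+ n.+1)^-1 * (qker (y / 2 ^+ n.+1) (node j.*2 / 2 ^+ n.+1) - qker (y / 2 ^+ n.+1) (node j.*2.+1 / 2 ^+ n.+1)) else 0.
have lim_a j : tends (a ^~ j) (b j).
  have h1 := (tends_shift _ _ 1).2 (@cvg_qker y _ (node_gt0 j.*2)).
  have h2 := (tends_shift _ _ 1).2 (@cvg_qker y _ (node_gt0 j.*2.+1)).
  apply: tends_near (tendsB h1 h2) _.
  near=> n; rewrite /a ifT; first by rewrite mulrBr !addn1.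
  have : (j.*2.+1 <= n)%N by near: n; exact: nbhs_infty_ge.
  by move=> /leq_ltn_trans; apply; apply: ltn_trans (ltn_expl _ _) => //; rewrite ltn_exp2l.
have ac n j : `|a n j| <= c j.
  rewrite /a; case: ifP => [jn|_]; first by apply: le_trans (c0 j); exact: qker_bound.
  by rewrite normr0 mulr_ge0 ?invr_ge0 ?exprn_ge0 // mulr_ge0 // ltW.
have bc j : `|b j| <= c j by apply: (tends_le (tends_norm (lim_a j))); exact: nearW.
have cb : cvgn (series b).
  apply: normed_cvg.
  apply: (@series_le_cvg _ (fun j => `|b j|) c) => // j.
  by apply: le_trans (bc j).
have H := @tannery R a b c (fun n => 2 ^ n)%N (limn (series b)) ac cc lim_a _ cb.
suff <- : limn (series b) = (cosh y)^-1 by exact: cb.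
apply: (tends_unique (H _)) => //.
  by under eq_fun do rewrite natrX; exact: cvg_pow2.
apply: tends_ext (@tends_cst R _) _ => n.
have := @ker_iter qker (-1) y n.+1 _ _.
rewrite /qker cos_pihalf sin_pihalf subr0 mul1r => ->; last 2 first.
- by rewrite mulrNN mulr1.
- by move=> z t t0 tp; rewrite mulN1r; exact: qker_double.
rewrite expnS mul2n sum_pairs mulr_sumr big_nat [RHS]big_nat; apply: eq_bigr => j /andP[_ jn].
rewrite /a ifT.
  have e1 : (-1) ^+ j.*2 = 1 :> R by rewrite -mul2n exprM sqrrN !expr1n.
  by rewrite [(-1) ^+ j.*2.+1]exprS e1 mulr1 mul1r mulN1r.
by rewrite expnS mul2n -doubleS leq_double.
Unshelve. all: by end_near. Qed.
End hyperbolic.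

(** * Fourier transforms of the hyperbolic kernels *)

Section transforms.
Context {R : realType}.
Implicit Types (a v r : R).

Lemma tends_expN a : 0 < a -> tends (fun n => expR (- (a * n%:R))) 0.
Proof.
move=> a0; apply: (@tends_ext _ (fun n => expR (- a) ^+ n)) => [|n].
  by apply: cvg_expr; rewrite ger0_norm ?expR_ge0 // expR_lt1 oppr_lt0.
by rewrite -expRM_natr mulNr.
Qed.

Lemma cos_itg_expN a v : 0 < a -> itg (fun r => expR (- (a * `|r|)) * cos (v * r)).
Proof.
move=> a0; apply: (itg_exp a0 (C := 1)).
  by apply: continuous_meas; cauto.
by move=> x; rewrite mul1r normrM ger0_norm ?expR_ge0 // ler_piMr ?expR_ge0 // cos_max.
Qed.

Lemma J_expN_cos a v : 0 < a ->
  J (fun r => expR (- (a * `|r|)) * cos (v * r)) = 2 * a / (a ^+ 2 + v ^+ 2).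
Proof.
move=> a0.
have hi := cos_itg_expN v a0.
have s0 : a ^+ 2 + v ^+ 2 != 0 by rewrite gt_eqF // ltr_wpDr ?sqr_ge0 // exprn_gt0.
rewrite J_even //; last by move=> x; rewrite normrN mulrN cosN.
pose f r := expR (- (a * r)) * cos (v * r).
pose F r := expR (- (a * r)) * (v * sin (v * r) - a * cos (v * r)) / (a ^+ 2 + v ^+ 2).
have -> : (fun x => expR (- (a * `|x|)) * cos (v * x) * ((0 <= x)%R)%:R) = (fun x => f x * ((0 <= x)%R)%:R).
  by apply/funext => x; case: (leP 0 x) => [x0|_]; rewrite ?mulr0 // /f ger0_norm.
rewrite (@J_ftc_half _ F f 0).
- rewrite /F !mulr0 oppr0 expR0 sin0 cos0; by field.
- move=> x; rewrite /F; apply: drv_eq; first by dauto.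
  by rewrite /f /=; field.
- by rewrite /f; cauto.
- have := itg_ge 0 hi; congr itg; apply/funext => x.
  by case: (leP 0 x) => [x0|_]; rewrite ?mulr0 // /f ger0_norm.
- pose C := (`|v| + `|a|) / `|a ^+ 2 + v ^+ 2|.
  apply: (@tends_norm0 _ _ (fun n => C * expR (- (a * n%:R)))).
    apply: nearW => n; rewrite /F !normrM normfV ger0_norm ?expR_ge0 //.
    rewrite -mulrA mulrC ler_wpM2r ?expR_ge0 // ler_wpM2r ?invr_ge0 //.
    apply: le_trans (ler_normB _ _) _; rewrite !normrM lerD //.
      by rewrite ler_piMr // sin_max.
    by rewrite ler_piMr // cos_max.
  by apply: tends_eq (tendsM (@tends_cst _ _) (tends_expN a0)) (mulr0 _).
Qed.

(** The scaling is the one for which the Fourier transform is exactly [pi / cosh (pi v)]. *)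
Definition sech2 r : R := (2 * cosh (r / 2))^-1.

Lemma cosh_gt0 r : 0 < cosh r.
Proof. by apply: lt_le_trans (cosh_ge1 r). Qed.

Lemma coshN r : cosh (- r) = cosh r.
Proof. by rewrite /cosh opprK addrC. Qed.

Lemma cosh_norm r : cosh `|r| = cosh r.
Proof. by case: (ger0P r) => // _; rewrite coshN. Qed.

Lemma cosh_lower r : expR `|r| <= 2 * cosh r.
Proof. by rewrite -cosh_norm /cosh mulrCA mulfV // mulr1 lerDl expR_ge0. Qed.

Lemma sech2_gt0 r : 0 < sech2 r.
Proof. by rewrite invr_gt0 mulr_gt0 // cosh_gt0. Qed.

Lemma sech2N r : sech2 (- r) = sech2 r.
Proof. by rewrite /sech2 mulNr coshN. Qed.

Lemma sech2_bound r : sech2 r <= expR (- (2^-1 * `|r|)).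
Proof.
have h := cosh_lower (r / 2).
have h0 : 0 < 2 * cosh (r / 2) by rewrite mulr_gt0 // cosh_gt0.
rewrite expRN /sech2 lef_pV2 ?posrE ?expR_gt0 //.
by apply: le_trans h; rewrite normrM mulrC (ger0_norm (x := 2^-1)) ?invr_ge0.
Qed.

Lemma cosh_cont (f : R -> R) : cont f -> cont (fun r => cosh (f r)).
Proof. by move=> cf; rewrite /cosh; cauto. Qed.

Lemma sech2_cont : cont sech2.
Proof.
rewrite /sech2; apply: contV => [x|]; first by rewrite gt_eqF // mulr_gt0 // cosh_gt0.
by apply: contM; [exact: cont_cst|apply: cosh_cont; cauto].
Qed.

Lemma half_gt0 : 0 < 2^-1 :> R. Proof. by rewrite invr_gt0. Qed.

Lemma itg_sech2 : itg sech2.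
Proof.
apply: (itg_exp half_gt0 (C := 1)); first exact: continuous_meas sech2_cont.
by move=> x; rewrite mul1r gtr0_norm ?sech2_gt0 // sech2_bound.
Qed.

Lemma sech2_partial (q : R) N : 1 + q ^+ 2 != 0 ->
  \sum_(0 <= j < N) (q ^+ (4 * j) - q ^+ (4 * j + 2)) * q = q * (1 - q ^+ (4 * N)) / (1 + q ^+ 2).
Proof.
move=> q0; elim: N => [|N ih]; first by rewrite big_geq // muln0 expr0; field.
rewrite big_nat_recr //= ih mulnS addnC !exprD; field.
exact: q0.
Qed.

Lemma expR_mulN (r : R) (k : nat) : expR (- (k%:R / 2 * `|r|)) = expR (- (2^-1 * `|r|)) ^+ k.
Proof. by rewrite -expRM_natl; congr expR; field. Qed.

Lemma sech2E r : sech2 r = expR (- (2^-1 * `|r|)) / (1 + expR (- (2^-1 * `|r|)) ^+ 2).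
Proof.
have -> : sech2 r = sech2 `|r| by case: (ger0P r) => // _; rewrite sech2N.
rewrite /sech2 /cosh [2^-1 * _]mulrC; set x := `|r| / 2.
rewrite expRN; have := expR_gt0 x; set q := expR x => q0.
have : 1 + q ^+ 2 != 0 by rewrite gt_eqF // addr_gt0 // exprn_gt0.
have : q + q^-1 != 0 by rewrite gt_eqF // addr_gt0 // invr_gt0.
have : 1 + q^-1 ^+ 2 != 0 by rewrite gt_eqF // addr_gt0 // exprn_gt0 // invr_gt0.
move=> h1 h2 h3.
have h4 : q != 0 by rewrite gt_eqF.
have h5 : q ^+ 2 + 1 != 0 by rewrite addrC.
by field; rewrite h4 h5.
Qed.

(** In powers of [q = e^(-|r|/2)], [sech2] is the alternating series [q - q^3 + q^5 - ...]. Taken in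
    pairs, its terms have as transforms precisely the paired partial fractions of [series_sech] at
    [pi v], up to the factor [pi]. *)
Lemma J_sech2_cos v : J (fun r => sech2 r * cos (v * r)) = pi / cosh (pi * v).
Proof.
have pi0 := @pi_gt0 R.
pose al (j : nat) : R := (4 * j + 1)%:R / 2.
pose be (j : nat) : R := (4 * j + 3)%:R / 2.
have al0 j : 0 < al j by rewrite divr_gt0 // ltr0n addn1.
have be0 j : 0 < be j by rewrite divr_gt0 // ltr0n addn3.
pose G j r := expR (- (al j * `|r|)) * cos (v * r) - expR (- (be j * `|r|)) * cos (v * r).
have iG j : itg (G j) by apply: itgB; exact: cos_itg_expN.
have JG j : J (G j) = 2 * al j / (al j ^+ 2 + v ^+ 2) - 2 * be j / (be j ^+ 2 + v ^+ 2).
  by rewrite JB ?J_expN_cos //; exact: cos_itg_expN.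
pose f N r := \sum_(0 <= j < N) G j r.
have fE N r : f N r = expR (- (2^-1 * `|r|)) * (1 - expR (- (2^-1 * `|r|)) ^+ (4 * N)) / (1 + expR (- (2^-1 * `|r|)) ^+ 2) * cos (v * r).
  rewrite -sech2_partial; last by rewrite gt_eqF // addr_gt0 // exprn_gt0 // expR_gt0.
  rewrite /f mulr_suml; apply: eq_bigr => j _.
  rewrite /G /al /be !expR_mulN -mulrBl; congr (_ * _).
  by rewrite mulrBl -!exprSr !addn1 addn2 addn3.
have [_ h] : itg (fun r => sech2 r * cos (v * r)) /\ tends (fun N => J (f N)) (J (fun r => sech2 r * cos (v * r))).
  apply: (@dct0 _ _ _ (fun r => expR (- (2^-1 * `|r|)))).
  - by move=> N; exact: itg_meas (J_sum N iG).1.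
  - by apply: continuous_meas; apply: contM sech2_cont _; cauto.
  - move=> r r0; apply: tends_ext (fun N => esym (fE N r)).
    rewrite sech2E.
    set q := expR _.
    have q0 : 0 < q by exact: expR_gt0.
    have q1 : q < 1 by rewrite expR_lt1 oppr_lt0 mulr_gt0 ?invr_gt0 // normr_gt0.
    apply: tendsM; last exact: tends_cst.
    apply: tendsM; last exact: tends_cst.
    rewrite -[X in tends _ X]mulr1; apply: tendsM; first exact: tends_cst.
    rewrite -[X in tends _ X]subr0; apply: tendsB; first exact: tends_cst.
    apply: tends_ext (fun N => esym (exprM _ _ _)).
    have : `|q ^+ 4| < 1 by rewrite normrX gtr0_norm // exprn_ilt1 // ltW.
    exact: cvg_expr.
  - exact: itg_expN half_gt0.
  - move=> N r; rewrite fE.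
    set q := expR _.
    have q0 : 0 < q by exact: expR_gt0.
    have q1 : q <= 1 by rewrite expR_le1 oppr_le0 mulr_ge0 ?invr_ge0.
    have q2 : 0 <= q ^+ (4 * N) <= 1 by rewrite exprn_ge0 ?exprn_ile1 // ltW.
    have q3 : 1 <= 1 + q ^+ 2 by rewrite lerDl exprn_ge0 // ltW.
    rewrite normrM; apply: le_trans (ler_piMr _ (cos_max _)) _ => //.
    rewrite normrM normfV (ger0_norm (le_trans ler01 q3)).
    rewrite ler_pdivrMr ?(lt_le_trans ltr01) // normrM gtr0_norm // ler_pM2l //.
    by rewrite (le_trans _ q3) // ler_norml; lra.
apply: (tends_unique h).
have H := tendsM (@tends_cst R pi) (@series_sech R (pi * v)).
apply: tends_ext H _ => N.
rewrite (J_sum N iG).2 /series /= mulr_sumr; apply: eq_bigr => j _.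
rewrite JG.
have -> : node j.*2 = pi * al j :> R.
  by rewrite /node /al -mul2n natrD !natrM; field.
have -> : node j.*2.+1 = pi * be j :> R.
  by rewrite /node /be -(natr1 j.*2) -mul2n natrD !natrM; field.
have s1 : al j ^+ 2 + v ^+ 2 != 0 by rewrite gt_eqF // ltr_wpDr ?sqr_ge0 // exprn_gt0.
have s2 : be j ^+ 2 + v ^+ 2 != 0 by rewrite gt_eqF // ltr_wpDr ?sqr_ge0 // exprn_gt0.
have s3 : v ^+ 2 + al j ^+ 2 != 0 by rewrite addrC.
have s4 : v ^+ 2 + be j ^+ 2 != 0 by rewrite addrC.
move: (al j) (be j) s1 s2 s3 s4 => A B s1 s2 s3 s4.
rewrite !exprMn -!mulrDr.
have pn : pi != 0 :> R by rewrite gt_eqF.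
have key (p P X : R) : p != 0 -> P != 0 -> p * (2 * (p * X) / (p ^+ 2 * P)) = 2 * X / P.
  by move=> p0 P0; field; rewrite P0 p0.
by rewrite mulrBr !key // ![v ^+ 2 + _]addrC.
Qed.

Definition dsech2 r : R := - (sech2 r * (sinh (r / 2) / (2 * cosh (r / 2)))).

Lemma drv_sech2 r : drv r sech2 (dsech2 r).
Proof.
have c0 : cosh (r / 2) != 0 by rewrite gt_eqF // cosh_gt0.
have H : drv r (fun x => cosh (x / 2)) (sinh (r / 2) * (1 / 2)).
  apply: (@drv_comp _ r (@cosh R) (fun x => x / 2) _ _ (drv_cosh _)).
  by apply: drv_eq; [dauto|rewrite /=; field].
rewrite /sech2; apply: drv_eq.
  by apply: (@drvV _ _ (fun x => 2 * cosh (x / 2))); [rewrite mulf_neq0|dauto].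
by rewrite /dsech2 /sech2 /=; field.
Qed.

Lemma sinhN r : sinh (- r) = - sinh r :> R.
Proof. by rewrite /sinh opprK; ring. Qed.

Lemma sinh_cosh_le r : `|sinh r| <= cosh r :> R.
Proof. by rewrite /sinh /cosh ler_norml; have := expR_gt0 r; have := expR_gt0 (- r); lra. Qed.

Lemma dsech2_bound r : `|dsech2 r| <= sech2 r.
Proof.
rewrite /dsech2 normrN normrM (gtr0_norm (sech2_gt0 r)); apply: ler_piMr; first exact: ltW (sech2_gt0 r).
have h := sinh_cosh_le (r / 2); have c0 := cosh_gt0 (r / 2).
have c2 : 0 < 2 * cosh (r / 2) by rewrite mulr_gt0.
rewrite normrM normfV (gtr0_norm c2) ler_pdivrMr //; lra.
Qed.

Lemma sinh_cont (f : R -> R) : cont f -> cont (fun r => sinh (f r)).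
Proof. by move=> cf; rewrite /sinh; cauto. Qed.

Lemma dsech2_cont : cont dsech2.
Proof.
rewrite /dsech2; apply: contN; apply: contM sech2_cont _; apply: contM.
  by apply: sinh_cont; cauto.
apply: contV => [x|]; first by rewrite gt_eqF // mulr_gt0 // cosh_gt0.
by apply: contM; [exact: cont_cst|apply: cosh_cont; cauto].
Qed.

Lemma itg_dsech2 : itg dsech2.
Proof. by apply: itg_le itg_sech2 dsech2_bound; exact: continuous_meas dsech2_cont. Qed.

(* [kern] is the function with Mellin-Fourier transform pi s / sin (pi s) on
   the critical line. *)
Definition kern r : R := dsech2 r + 2^-1 * sech2 r.

Lemma kernE r : kern r = expR (- (r / 2)) / (4 * cosh (r / 2) ^+ 2).
Proof.
have c0 : cosh (r / 2) != 0 by rewrite gt_eqF // cosh_gt0.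
rewrite /kern /dsech2 /sech2.
have -> : expR (- (r / 2)) = cosh (r / 2) - sinh (r / 2) by rewrite /cosh /sinh; field.
by field.
Qed.

Lemma kern_cont : cont kern.
Proof. by rewrite /kern; apply: contD dsech2_cont _; apply: contM; [exact: cont_cst|exact: sech2_cont]. Qed.

Lemma itg_kern : itg kern.
Proof. by apply: itgD itg_dsech2 _; apply: itgZ; exact: itg_sech2. Qed.

Lemma sech2_le1 r : sech2 r <= 1.
Proof. by rewrite (le_trans (sech2_bound r)) // expR_le1 oppr_le0 mulr_ge0 ?invr_ge0. Qed.

Lemma kern_le r : `|kern r| <= 2.
Proof.
have := dsech2_bound r; have := sech2_le1 r; have := sech2_gt0 r => h0 h1 h2.
apply: le_trans (ler_normD _ _) _; have h3 : 0 < 2^-1 * sech2 r := mulr_gt0 half_gt0 h0.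
rewrite (gtr0_norm h3); lra.
Qed.

Lemma tends_sech2 (c : nat -> R) (h : R -> R) : (forall n, n%:R <= `|c n|) -> (forall x, `|h x| <= 1) ->
  tends (fun n => sech2 (c n) * h (c n)) 0.
Proof.
move=> cn h1; apply: tends_norm0 (tends_expN half_gt0).
apply: nearW => n; rewrite normrM gtr0_norm ?sech2_gt0 //.
apply: le_trans (ler_piMr (ltW (sech2_gt0 _)) (h1 _)) _.
apply: le_trans (sech2_bound _) _.
by rewrite ler_expR lerN2 ler_pM2l.
Qed.

Lemma cos_cont1 v : cont (fun r => cos (v * r)). Proof. by cauto. Qed.
Lemma sin_cont1 v : cont (fun r => sin (v * r)). Proof. by cauto. Qed.

Lemma itg_bcos (f : R -> R) v : itg f -> itg (fun r => f r * cos (v * r)).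
Proof.
move=> hf; apply: (itg_bddM hf (M := 1)) => [|x]; last exact: cos_max.
exact: continuous_meas (@cos_cont1 v).
Qed.

Lemma itg_bsin (f : R -> R) v : itg f -> itg (fun r => f r * sin (v * r)).
Proof.
move=> hf; apply: (itg_bddM hf (M := 1)) => [|x]; last exact: sin_max.
exact: continuous_meas (@sin_cont1 v).
Qed.

Lemma J_sech2_sin v : J (fun r => sech2 r * sin (v * r)) = 0.
Proof.
apply: J_odd => [|x]; first exact: itg_bsin itg_sech2.
by rewrite sech2N mulrN sinN mulrN.
Qed.

(** Integration by parts: [kern] is the derivative of [sech2] plus one half of [sech2], so its
    transform is that of [sech2] times [1/2 + i v]. This is the factor [s] that cancels the [1 / s]
    of [phi]. *)
Lemma J_kern_cos v : J (fun r => kern r * cos (v * r)) = pi / cosh (pi * v) / 2.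
Proof.
have i1 := itg_bcos v itg_dsech2; have i2 := itg_bcos v itg_sech2; have i3 := itg_bsin v itg_sech2.
have H : J (fun r => dsech2 r * cos (v * r) - v * (sech2 r * sin (v * r))) = 0 - 0.
  apply: (@J_ftc _ (fun r => sech2 r * cos (v * r))).
  - move=> x; apply: drv_eq; first by apply: drvM; [exact: drv_sech2|dauto].
    by rewrite /=; ring.
  - apply: contD; first by apply: contM dsech2_cont _; cauto.
    by apply: contN; apply: contM; [exact: cont_cst|apply: contM sech2_cont _; cauto].
  - by apply: itgB => //; apply: itgZ.
  - apply: (@tends_sech2 _ (fun r => cos (v * r))) => [n|x]; last exact: cos_max.
    by rewrite ger0_norm.
  - apply: (@tends_sech2 _ (fun r => cos (v * r))) => [n|x]; last exact: cos_max.
    by rewrite normrN ger0_norm.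
have -> : (fun r => kern r * cos (v * r)) = (fun r => dsech2 r * cos (v * r) + 2^-1 * (sech2 r * cos (v * r))).
  by apply/funext => r; rewrite /kern; ring.
rewrite JD //; last exact: itgZ.
rewrite JZ // J_sech2_cos.
move: H; rewrite JB //; last exact: itgZ.
rewrite JZ // J_sech2_sin mulr0 subr0 subrr => ->.
by rewrite add0r mulrC.
Qed.

Lemma J_kern_sin v : J (fun r => kern r * sin (v * r)) = - (pi * v / cosh (pi * v)).
Proof.
have i1 := itg_bsin v itg_dsech2; have i2 := itg_bcos v itg_sech2; have i3 := itg_bsin v itg_sech2.
have H : J (fun r => dsech2 r * sin (v * r) + v * (sech2 r * cos (v * r))) = 0 - 0.
  apply: (@J_ftc _ (fun r => sech2 r * sin (v * r))).
  - move=> x; apply: drv_eq; first by apply: drvM; [exact: drv_sech2|dauto].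
    by rewrite /=; ring.
  - apply: contD; first by apply: contM dsech2_cont _; cauto.
    by apply: contM; [exact: cont_cst|apply: contM sech2_cont _; cauto].
  - by apply: itgD => //; apply: itgZ.
  - apply: (@tends_sech2 _ (fun r => sin (v * r))) => [n|x]; last exact: sin_max.
    by rewrite ger0_norm.
  - apply: (@tends_sech2 _ (fun r => sin (v * r))) => [n|x]; last exact: sin_max.
    by rewrite normrN ger0_norm.
have -> : (fun r => kern r * sin (v * r)) = (fun r => dsech2 r * sin (v * r) + 2^-1 * (sech2 r * sin (v * r))).
  by apply/funext => r; rewrite /kern; ring.
rewrite JD //; last exact: itgZ.
rewrite JZ // J_sech2_sin mulr0 addr0.
move: H; rewrite JD //; last exact: itgZ.
rewrite JZ // J_sech2_cos subrr => /eqP; rewrite addr_eq0 => /eqP ->.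
by rewrite mulrCA mulrA.
Qed.

Lemma norm_sin_le x : `|sin x| <= `|x| :> R.
Proof.
wlog x0 : x / 0 <= x.
  move=> H; case: (leP 0 x) => [/H//|/ltW x0].
  by have := H (- x); rewrite oppr_ge0 sinN !normrN; exact.
have [->|xn0] := eqVneq x 0; first by rewrite sin0.
have xp : 0 < x by rewrite lt_neqAle eq_sym xn0.
have [c _] := mvt xp (fun y _ _ => is_derive_sin y).
rewrite sin0 !subr0 => ->; rewrite normrM ler_piMl //; exact: cos_max.
Qed.

Lemma sinh_bound x : `|sinh x| <= `|x| * cosh x :> R.
Proof.
wlog x0 : x / 0 <= x.
  move=> H; case: (leP 0 x) => [/H//|/ltW x0].
  by have := H (- x); rewrite oppr_ge0 sinhN coshN !normrN; exact.
have [->|xn0] := eqVneq x 0; first by rewrite sinh0 normr0 mul0r.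
have xp : 0 < x by rewrite lt_neqAle eq_sym xn0.
have [c /andP[c0 cx]] := mvt xp (fun y _ _ => @drv_sinh R y).
rewrite sinh0 !subr0 => ->; rewrite normrM mulrC ler_wpM2l // gtr0_norm ?cosh_gt0 //.
rewrite /cosh ler_pM2r ?invr_gt0 // !expRN.
have : expR c <= expR x by rewrite ler_expR ltW.
have : 1 <= expR c by rewrite -expR0 ler_expR ltW.
set p := expR c; set q := expR x => p1 pq.
have p0 : 0 < p by apply: lt_le_trans p1.
have q0 : 0 < q by apply: lt_le_trans pq.
rewrite -subr_ge0 (_ : q + q^-1 - (p + p^-1) = (q - p) * (p * q - 1) / (p * q)); last first.
  by field; rewrite !gt_eqF.
by rewrite divr_ge0 ?mulr_ge0 ?subr_ge0 ?(ltW p0) ?(ltW q0) // mulr_ege1 // (le_trans p1).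
Qed.

Lemma sqr_le_exp x : 0 <= x -> x ^+ 2 <= 2 * expR x :> R.
Proof. by move=> x0; have := @expR_ge1Dxn R x 1 x0; rewrite (_ : 2`!%N = 2%N) // => ?; lra. Qed.

(** Starting at [1/2] keeps exponential factors such as [e^(eps |r|)] within the decay [e^(-|r|)] of
    the functions they multiply. *)
Definition eps (n : nat) : R := n.+2%:R^-1.
Lemma eps_gt0 n : 0 < eps n. Proof. by rewrite invr_gt0. Qed.
Lemma eps_le n : eps n <= 2^-1.
Proof. by rewrite lef_pV2 ?posrE // ler_nat. Qed.
Lemma tends_eps : tends eps 0.
Proof. by have := (tends_shift _ _ 1).2 (@tends_invn R); move=> /tends_ext; apply => n; rewrite addn1. Qed.

(** Half of the exponential absorbs the square, through [y^2 <= 2 e^y]. *)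
Lemma itg_sqr_exp (f : R -> R) a C : 0 < a -> cont f -> (forall x, `|f x| <= C * (x ^+ 2 * expR (- (a * `|x|)))) -> itg f.
Proof.
move=> a0 cf h.
have a2 : 0 < a / 2 by rewrite divr_gt0.
apply: (itg_exp a2 (C := `|C| * (2 * (4 / a ^+ 2)))); first exact: continuous_meas.
move=> x; apply: le_trans (h x) _.
apply: (@le_trans _ _ (`|C| * (x ^+ 2 * expR (- (a * `|x|))))).
  by rewrite ler_wpM2r ?ler_norm // mulr_ge0 ?sqr_ge0 ?expR_ge0.
rewrite -[leRHS]mulrA; apply: ler_wpM2l => //.
have h2 := @sqr_le_exp (a / 2 * `|x|) (mulr_ge0 (ltW a2) (normr_ge0 x)).
have -> : - (a * `|x|) = - (a / 2 * `|x|) + - (a / 2 * `|x|) by field.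
rewrite expRD mulrA ler_wpM2r ?expR_ge0 //.
move: h2; rewrite expRN; set E := expR _.
have E0 : 0 < E by exact: expR_gt0.
rewrite ler_pdivrMr // exprMn real_normK ?num_real // => h2.
have -> : x ^+ 2 = (4 / a ^+ 2) * ((a / 2) ^+ 2 * x ^+ 2) by field; rewrite gt_eqF.
by rewrite [2 * _]mulrC -[leRHS]mulrA ler_pM2l // divr_gt0 // exprn_gt0.
Qed.

(** The second moment is minus the second derivative of the transform at 0, obtained as the limit of
    [(hat 0 - hat eps) / eps^2]. The form [2 sin^2] of [1 - cos] serves both the limit and the
    domination by [r^2]. *)
Lemma J_sech2_sqr : J (fun r => sech2 r * r ^+ 2) = pi ^+ 3.
Proof.
have cf n : cont (fun r => sech2 r * (2 * ((eps n)^-1 * sin (r / 2 * eps n)) ^+ 2)).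
  by apply: contM sech2_cont _; cauto.
have iS : itg (fun r => sech2 r * r ^+ 2).
  apply: (@itg_sqr_exp _ 2^-1 1 half_gt0).
    by apply: contM sech2_cont _; cauto.
  move=> x; rewrite mul1r normrM gtr0_norm ?sech2_gt0 // ger0_norm ?sqr_ge0 // mulrC.
  by rewrite ler_wpM2l ?sqr_ge0 // sech2_bound.
have [_ h] : itg (fun r => sech2 r * (r ^+ 2 / 2)) /\
   tends (fun n => J (fun r => sech2 r * (2 * ((eps n)^-1 * sin (r / 2 * eps n)) ^+ 2))) (J (fun r => sech2 r * (r ^+ 2 / 2))).
  apply: (@dct _ _ _ (fun r => sech2 r * r ^+ 2)) => //.
  - by move=> n; apply: continuous_meas; exact: cf.
  - move=> r.
    have H : drv 0 (fun h => sin (r / 2 * h)) (r / 2).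
      by apply: drv_eq; [dauto|rewrite /= mulr0 cos0; ring].
    have e0 n : eps n != 0 by rewrite gt_eqF // eps_gt0.
    have := cvg_quot0 H _ e0 tends_eps; rewrite mulr0 sin0 => /(_ erefl) H'.
    have -> : r ^+ 2 / 2 = 2 * (r / 2) ^+ 2 by field.
    apply: (tendsM (@tends_cst _ _)); apply: (tendsM (@tends_cst _ _)); exact: tendsX.
  - move=> n r; rewrite normrM gtr0_norm ?sech2_gt0 // ler_pM2l ?sech2_gt0 //.
    rewrite ger0_norm; last by rewrite mulr_ge0 // sqr_ge0.
    have := norm_sin_le (r / 2 * eps n); have e0 := eps_gt0 n.
    rewrite normrM (gtr0_norm e0) => h.
    have h2 : `|(eps n)^-1 * sin (r / 2 * eps n)| <= `|r / 2|.
      by rewrite normrM normfV (gtr0_norm e0) ler_pdivrMl // [eps n * _]mulrC.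
    rewrite -[X in _ * X]real_normK ?num_real // -[leRHS]real_normK ?num_real //.
    have E2 : `|r / 2| = `|r| / 2 by rewrite normrM [X in _ * X]ger0_norm ?invr_ge0.
    move: h2; rewrite E2.
    have := normr_ge0 r; have := normr_ge0 ((eps n)^-1 * sin (r / 2 * eps n)).
    set p := `|_ * _|; set q := `|r| => p0 q0 pq; nra.
have : tends (fun n => pi * ((eps n)^-1 ^+ 2 * (1 - (cosh (pi * eps n))^-1))) (pi ^+ 3 / 2).
  have H : drv (0 : R) (fun h => sinh (pi / 2 * h)) (pi / 2).
    apply: drv_eq; first by apply: (@drv_comp _ _ sinh (fun h => pi / 2 * h) _ _ (drv_sinh _)); dauto.
    by rewrite /= mulr0 cosh0; ring.
  have e0 n : eps n != 0 by rewrite gt_eqF // eps_gt0.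
  have := cvg_quot0 H _ e0 tends_eps; rewrite mulr0 sinh0 => /(_ erefl) H'.
  have Hc : tends (fun n => cosh (pi * eps n)) 1.
    rewrite -(@cosh0 R) -(mulr0 pi); apply: (@tends_cont _ (fun x => cosh (pi * x))); last exact: tends_eps.
    by apply: (@cosh_cont (fun x => pi * x)); cauto.
  have -> : pi ^+ 3 / 2 = pi * (2 * (pi / 2) ^+ 2 / 1) :> R by field.
  apply: (tendsM (@tends_cst _ _)).
  have T := tendsM (tendsM (@tends_cst R 2) (@tendsX _ _ _ 2 H')) (tendsV (oner_neq0 R) Hc).
  apply: (tends_ext T) => n.
  have := cosh_sub1 (pi * eps n); rewrite [pi * eps n / 2]mulrAC => E.
  have c0 : cosh (pi * eps n) != 0 by rewrite gt_eqF // cosh_gt0.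
  have -> : 1 - (cosh (pi * eps n))^-1 = (cosh (pi * eps n) - 1) / cosh (pi * eps n) by field.
  by rewrite E; ring.
move=> h'.
have : J (fun r => sech2 r * (r ^+ 2 / 2)) = pi ^+ 3 / 2.
  apply: tends_unique h _; apply: tends_ext h' _ => n.
  have i1 := itg_bcos (eps n) itg_sech2.
  have -> : (fun r => sech2 r * (2 * ((eps n)^-1 * sin (r / 2 * eps n)) ^+ 2)) =
     (fun r => (eps n)^-1 ^+ 2 * (sech2 r - sech2 r * cos (eps n * r))).
    apply/funext => r; have := cos_sub1 (eps n * r).
    rewrite [eps n * r / 2](_ : _ = r / 2 * eps n); last by ring.
    by move=> E; rewrite (_ : sech2 r - _ = sech2 r * (1 - cos (eps n * r))); [rewrite E; ring|ring].
  rewrite JZ; last by apply: itgB => //; exact: itg_sech2.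
  rewrite JB //; last exact: itg_sech2.
  rewrite J_sech2_cos.
  have -> : J sech2 = pi.
    have := J_sech2_cos 0; rewrite mulr0 cosh0 divr1 => <-.
    by apply: eq_J => r; rewrite mul0r cos0 mulr1.
  by ring.
have -> : (fun r => sech2 r * (r ^+ 2 / 2)) = (fun r => 2^-1 * (sech2 r * r ^+ 2)).
  by apply/funext => r; ring.
by rewrite JZ // => ?; lra.
Qed.
End transforms.

(** * The digamma function *)

Section digamma_series.
Context {R : realType}.
Implicit Types (x y h t : R).

Lemma ln_le_sub1 t : 0 < t -> ln t <= t - 1.
Proof. by move=> t0; have := @le_ln1Dx R (t - 1); rewrite [1 + _]addrC subrK; apply; lra. Qed.

Lemma ln_ge_1subV t : 0 < t -> 1 - t^-1 <= ln t.
Proof.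
move=> t0; have := @ln_le_sub1 t^-1; rewrite invr_gt0 lnV ?posrE // => /(_ t0); lra.
Qed.

Lemma lnB_le (a b : R) : 0 < a -> 0 < b -> ln b - ln a <= (b - a) / a.
Proof.
move=> a0 b0; rewrite -ln_div ?posrE //.
apply: le_trans (ln_le_sub1 (divr_gt0 b0 a0)) _.
by rewrite mulrBl mulfV // gt_eqF.
Qed.

Lemma lnB_ge (a b : R) : 0 < a -> 0 < b -> (b - a) / b <= ln b - ln a.
Proof.
move=> a0 b0; rewrite -ln_div ?posrE //.
apply: le_trans (ln_ge_1subV (divr_gt0 b0 a0)).
by rewrite mulrBl mulfV ?gt_eqF // invf_div.
Qed.

Lemma nondecr_diff (f f' : R -> R) (b : R) : 0 <= b ->
  (forall x, 0 <= x -> x <= b -> drv x f (f' x)) -> (forall x, 0 <= x -> 0 <= f' x) -> f 0 <= f b.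
Proof.
rewrite le_eqVlt => /predU1P[<-//|b0] df f0.
have [c /andP[c0 _] E] := mvt b0 df.
by rewrite -subr_ge0 E mulr_ge0 ?subr_ge0 ?f0 // ltW.
Qed.

Lemma ln1D_lower t : 0 <= t -> t - t ^+ 2 / 2 <= ln (1 + t).
Proof.
move=> t0; rewrite -subr_ge0.
pose f t : R := ln (1 + t) - (t - t ^+ 2 / 2).
have -> : 0 = f 0 by rewrite /f addr0 ln1; ring.
apply: (@nondecr_diff f (fun t => t ^+ 2 / (1 + t)) _ t0) => [x x0 _|x x0]; last first.
  by rewrite divr_ge0 ?sqr_ge0 // addr_ge0.
have x1 : 1 + x != 0 by rewrite gt_eqF // ltr_wpDr.
rewrite /f; apply: drv_eq; first by dauto; rewrite /= ltr_wpDr.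
by rewrite /=; field.
Qed.

Lemma ln1D_upper t : 0 <= t -> ln (1 + t) <= t - t ^+ 2 / 2 + t ^+ 3 / 3.
Proof.
move=> t0; rewrite -subr_ge0.
pose f t : R := (t - t ^+ 2 / 2 + t ^+ 3 / 3) - ln (1 + t).
have -> : 0 = f 0 by rewrite /f addr0 ln1; ring.
apply: (@nondecr_diff f (fun t => t ^+ 3 / (1 + t)) _ t0) => [x x0 _|x x0]; last first.
  by rewrite divr_ge0 ?exprn_ge0 // addr_ge0.
have x1 : 1 + x != 0 by rewrite gt_eqF // ltr_wpDr.
rewrite /f; apply: drv_eq; first by dauto; rewrite /= ltr_wpDr.
by rewrite /=; field.
Qed.

(** Pairing each [1 / (x + k)] with an increment of the logarithm makes the series absolutely
    convergent. Its sum is the digamma function, by [digamma_psi]. *)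
Definition psi_term x (k : nat) : R := (ln k.+2%:R - ln k.+1%:R) - (x + k%:R)^-1.
Definition psi x : R := limn (series (psi_term x)).

Lemma series_psi x n : series (psi_term x) n = ln n.+1%:R - \sum_(0 <= k < n) (x + k%:R)^-1.
Proof.
elim: n => [|n ih]; first by rewrite /series /= !big_geq // ln1 subrr.
by rewrite seriesSr ih big_nat_recr //= /psi_term; ring.
Qed.

(** Chosen so that [x + k >= low x (k + 1)] for all [k], which compares sums over [x + k] with sums
    over positive integers. *)
Definition low x : R := Num.min x 1.
Lemma low_gt0 x : 0 < x -> 0 < low x.
Proof. by move=> x0; rewrite lt_min x0 ltr01. Qed.

Lemma addn_lower x k : low x * k.+1%:R <= x + k%:R.
Proof.
have h1 : low x <= x by rewrite ge_min lexx.
have h2 : low x <= 1 by rewrite ge_min lexx orbT.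
by rewrite -(natr1 k) mulrDr mulr1 addrC lerD // ler_piMl.
Qed.

Lemma addnat_gt0 x k : 0 < x -> 0 < x + k%:R.
Proof. by move=> x0; rewrite ltr_wpDr. Qed.

Lemma inv_addn_le x k : 0 < x -> (x + k%:R)^-1 <= (low x)^-1 * k.+1%:R^-1.
Proof.
move=> x0; rewrite -invfM lef_pV2 ?posrE ?mulr_gt0 ?low_gt0 ?addnat_gt0 //; exact: addn_lower.
Qed.

Lemma sum_invsq_le n : \sum_(0 <= k < n) (k.+1%:R ^+ 2)^-1 <= 2 :> R.
Proof.
case: n => [|n]; first by rewrite big_geq.
suff : \sum_(0 <= k < n.+1) (k.+1%:R ^+ 2)^-1 <= 2 - n.+1%:R^-1 :> R.
  by move=> /le_trans; apply; rewrite gerBl invr_ge0.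
elim: n => [|n ih]; first by rewrite big_nat1 expr1n invr1; lra.
rewrite big_nat_recr //=; apply: le_trans (lerD ih (lexx _)) _.
have n0 : 0 < n.+1%:R :> R by [].
rewrite -[n.+2]addn1 natrD.
set x : R := n.+1%:R in n0 *.
rewrite -subr_ge0.
have -> : 2 - (x + 1)^-1 - (2 - x^-1 + ((x + 1) ^+ 2)^-1) = (x * (x + 1) ^+ 2)^-1.
  by field; rewrite !gt_eqF //; lra.
by rewrite invr_ge0 mulr_ge0 ?exprn_ge0 ?ltW // addr_gt0.
Qed.

Lemma cvgn_invsq : cvgn (series (fun k : nat => (k.+1%:R ^+ 2)^-1 : R)).
Proof.
apply: nondecreasing_is_cvgn.
  by apply/nondecreasing_seqP => k; rewrite seriesSr lerDl invr_ge0 exprn_ge0.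
by exists 2 => _ [n _ <-]; exact: sum_invsq_le.
Qed.

Lemma psi_term_bound x k : 0 < x -> `|psi_term x k| <= (`|x - 1| / low x + 1) * (k.+1%:R ^+ 2)^-1.
Proof.
move=> x0.
have k0 : 0 < k.+1%:R :> R by [].
have k1 : 0 < k.+2%:R :> R by [].
have xk := addnat_gt0 k x0.
have l0 := low_gt0 x0.
have h1 := lnB_le k0 k1; have h2 := lnB_ge k0 k1.
have kE : k.+2%:R = k.+1%:R + 1 :> R by rewrite natr1.
have D : k.+2%:R - k.+1%:R = 1 :> R by rewrite kE; ring.
rewrite D !mul1r in h1 h2.
have E : psi_term x k = ((ln k.+2%:R - ln k.+1%:R) - k.+1%:R^-1) + (k.+1%:R^-1 - (x + k%:R)^-1) by rewrite /psi_term; ring.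
rewrite E mulrDl addrC; apply: le_trans (ler_normD _ _) (lerD _ _).
  have -> : k.+1%:R^-1 - (x + k%:R)^-1 = (x - 1) * (k.+1%:R^-1 * (x + k%:R)^-1).
    by rewrite -(natr1 k); field; rewrite natr1 !gt_eqF.
  rewrite normrM -mulrA ler_wpM2l // ger0_norm; last by rewrite mulr_ge0 // invr_ge0 // ltW.
  rewrite expr2 invfM mulrCA ler_wpM2l ?invr_ge0 //; exact: inv_addn_le.
rewrite mul1r ler_norml; apply/andP; split; last first.
  apply: (@le_trans _ _ 0); last by rewrite invr_ge0 exprn_ge0.
  by rewrite subr_le0.
move: h2; set L := ln _ - _; rewrite kE; set q : R := k.+1%:R in k0 *; clearbody q L.
have : (q + 1)^-1 - q^-1 + (q ^+ 2)^-1 = (q ^+ 2 * (q + 1))^-1 by field; rewrite !gt_eqF //; lra.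
have : 0 <= (q ^+ 2 * (q + 1))^-1 by rewrite invr_ge0 mulr_ge0 ?exprn_ge0 ?ltW // addr_gt0.
move=> h3 h4 h5; lra.
Qed.

Lemma tends_psi_series x : 0 < x -> tends (series (psi_term x)) (psi x).
Proof.
move=> x0; suff : cvgn (series (psi_term x)) by [].
apply: normed_cvg.
pose C := `|x - 1| / low x + 1.
have C0 : 0 <= C by rewrite addr_ge0 // divr_ge0 // ltW // low_gt0.
apply: (@series_le_cvg _ (fun j => `|psi_term x j|) (fun k => C * (k.+1%:R ^+ 2)^-1)) => //.
- by move=> k; rewrite mulr_ge0 // invr_ge0 exprn_ge0.
- by move=> k; exact: psi_term_bound.
have : cvgn (series (C *: (fun j : nat => (j.+1%:R ^+ 2)^-1 : R))).
  by apply: is_cvg_seriesZ; exact: cvgn_invsq.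
exact.
Qed.

Lemma tends_psi x : 0 < x -> tends (fun n => ln n.+1%:R - \sum_(0 <= k < n) (x + k%:R)^-1) (psi x).
Proof. by move=> x0; apply: tends_ext (tends_psi_series x0) _ => n; exact: series_psi. Qed.

Lemma tends_inv_addn x : 0 < x -> tends (fun n => (x + n%:R)^-1) 0.
Proof.
move=> x0; apply: (@tends_norm0 _ _ (fun n => (low x)^-1 * n.+1%:R^-1)).
  by apply: nearW => n; rewrite gtr0_norm ?invr_gt0 ?addnat_gt0 // inv_addn_le.
by rewrite -(mulr0 (low x)^-1); exact: (tendsM (@tends_cst R _) (@tends_invn R)).
Qed.

Lemma tends_lnD x y : 0 < x -> 0 < y -> tends (fun n => ln (x + n%:R) - ln (y + n%:R)) 0.
Proof.
move=> x0 y0.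
apply: (@tends_squeeze _ (fun n => (x - y) * (x + n%:R)^-1) _ (fun n => (x - y) * (y + n%:R)^-1)).
- apply: nearW => n; have xn := addnat_gt0 n x0; have yn := addnat_gt0 n y0.
  have := lnB_le yn xn; have := lnB_ge yn xn.
  by rewrite opprD addrACA subrr addr0 => -> ->.
- by rewrite -(mulr0 (x - y)); exact: (tendsM (@tends_cst R _) (tends_inv_addn x0)).
- by rewrite -(mulr0 (x - y)); exact: (tendsM (@tends_cst R _) (tends_inv_addn y0)).
Qed.

Lemma tends_psiD x y : 0 < x -> 0 < y ->
  tends (fun n => ln (y + n%:R) - \sum_(0 <= k < n) (x + k%:R)^-1) (psi x).
Proof.
move=> x0 y0.
have H := tendsD (tends_psi x0) (tends_lnD y0 (ltr01)).
rewrite -[X in tends _ X]addr0; apply: (tends_ext H) => n.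
by rewrite nat1r; ring.
Qed.

Lemma psi1 : psi 1 = - euler_mascheroni.
Proof.
have h := tends_psi (@ltr01 R).
have h0 := (tends_shift _ _ 1).2 (tendsN h).
have h1 := (tends_shift _ _ 1).2 (tendsN (tends_lnD (@ltr01 R) (@ltr01 R))).
have H : tends (fun n : nat => \sum_(1 <= k < n.+1) k%:R^-1 - ln n%:R : R) (- psi 1).
  have h2 : tends (fun n : nat => ln (1 + n.+1%:R) - ln (1 + n%:R) : R) 0.
    have h3 := tendsB (tends_lnD (@ltr0Sn R 1) (@ltr01 R)) (@tends_cst R 0).
    rewrite -[X in tends _ X](subr0 0); apply: (tends_ext h3) => n.
    by rewrite subr0 !nat1r -natrD.
  apply/(tends_shift _ _ 1).
  have h4 := tendsD h0 h2; rewrite addr0 in h4; apply: (tends_ext h4) => n.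
  rewrite addn1 big_add1 /= !nat1r opprB.
  under [in LHS]eq_bigr do rewrite nat1r.
  by ring.
by rewrite /euler_mascheroni (cvg_lim _ H) // opprK.
Qed.

(** The partial sum of length [2 n] at [2 x + 1] splits by parity of the index into halves of the
    partial sums of length [n] at [x + 1/2] and [x + 1]; [2 ln 2] is left over from the
    logarithm. *)
Lemma psi_double x : 0 < x -> 2 * psi (2 * x + 1) = 2 * ln 2 + psi (x + 2^-1) + psi (x + 1).
Proof.
move=> x0.
have xa : 0 < x + 2^-1 by rewrite addr_gt0 ?invr_gt0.
have xb : 0 < x + 1 by rewrite addr_gt0.
have xc : 0 < 2 * x + 1 by rewrite addr_gt0 // mulr_gt0.
have d n : (n <= n.*2)%N by rewrite -addnn leq_addr.
have hc := tends_sub (tends_psiD xc (@ltr0Sn R 1)) d.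
have H2 := tendsM (@tends_cst R 2) hc.
apply: (tends_unique H2).
have H := tendsD (tendsD (@tends_cst R (2 * ln 2)) (tends_psi xa)) (tends_psi xb).
apply: (tends_ext H) => n.
have -> : 2 + n.*2%:R = 2 * n.+1%:R :> R by rewrite -mul2n natrM -(natr1 n); ring.
rewrite lnM ?posrE // mulrBr mulrDr mulr_sumr.
have -> : \sum_(0 <= i < n.*2) 2 * (2 * x + 1 + i%:R)^-1 = \sum_(0 <= k < n) (x + 2^-1 + k%:R)^-1 + \sum_(0 <= k < n) (x + 1 + k%:R)^-1.
  rewrite -big_split /=; elim: n => [|n ih]; first by rewrite !big_geq.
  rewrite doubleS !big_nat_recr //= ih addrA; congr (_ + _ + _).
    rewrite -mul2n natrM; have := addnat_gt0 n xa; have := @addnat_gt0 _ (2 * n) xc.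
    by rewrite natrM => h1 h2; field; rewrite !gt_eqF //; lra.
  rewrite -(natr1 n.*2) -mul2n natrM; have := addnat_gt0 n xb.
  by move=> h1; field; rewrite !gt_eqF //; lra.
by ring.
Qed.

(** This bound and [psi_ge] compare [1 / (x + k)] with the neighbouring increments of [ln], whose
    sum telescopes. *)
Lemma psi_le x : 0 < x -> psi x <= ln x.
Proof.
move=> x0.
have H := tendsD (tends_lnD (@ltr01 R) x0) (@tends_cst R (ln x)); rewrite add0r in H.
have := tendsB H (tends_psi x0) => H2.
rewrite -subr_ge0; apply: (tends_ge H2); apply: nearW => n.
rewrite nat1r.
suff : ln (x + n%:R) - ln x <= \sum_(0 <= k < n) (x + k%:R)^-1 by move=> ?; lra.
elim: n => [|n ih]; first by rewrite big_geq // addr0 subrr.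
rewrite big_nat_recr //=.
have := lnB_le (addnat_gt0 n x0) (addnat_gt0 n.+1 x0).
by rewrite -(natr1 n) addrA [_ + 1 - _]addrAC subrr add0r mul1r => ?; lra.
Qed.

Lemma psi_ge x : 0 < x -> ln x - x^-1 <= psi x.
Proof.
move=> x0.
have H := tendsD (tends_lnD (@ltr01 R) x0) (@tends_cst R (ln x - x^-1)); rewrite add0r in H.
have := tendsB (tends_psi x0) H => H2.
rewrite -subr_ge0; apply: (tends_ge H2); apply: nearW => n.
rewrite nat1r.
suff : \sum_(0 <= k < n) (x + k%:R)^-1 <= ln (x + n%:R) - ln x + x^-1 by move=> ?; lra.
case: n => [|n]; first by rewrite big_geq // addr0 subrr add0r invr_ge0 ltW.
apply: (@le_trans _ _ (ln (x + n%:R) - ln x + x^-1)); last first.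
  by rewrite lerD2r lerD2r ler_ln ?posrE ?addnat_gt0 // lerD2l ler_nat.
elim: n => [|n ih]; first by rewrite big_nat1 addr0 subrr add0r.
rewrite big_nat_recr //=.
have := lnB_ge (addnat_gt0 n x0) (addnat_gt0 n.+1 x0).
by rewrite -(natr1 n) addrA [_ + 1 - _]addrAC subrr add0r mul1r => ?; lra.
Qed.

(** Termwise, [1 / (x + k) - 1 / (y + k)] is [y - x] times a product between 0 and [1 / (x + k)^2];
    the 2 bounds the sum of inverse squares. *)
Lemma psi_incr x y : 0 < x -> x <= y ->
  (psi x <= psi y) && (psi y - psi x <= (y - x) * (2 / low x ^+ 2)).
Proof.
move=> x0 xy; have y0 : 0 < y by apply: lt_le_trans xy.
have l0 := low_gt0 x0.
have H := tendsB (tends_psi y0) (tends_psi x0).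
have E n : \sum_(0 <= k < n) (x + k%:R)^-1 - \sum_(0 <= k < n) (y + k%:R)^-1 = (y - x) * \sum_(0 <= k < n) ((x + k%:R)^-1 * (y + k%:R)^-1).
  rewrite -sumrB mulr_sumr; apply: eq_bigr => k _; field.
  by rewrite !gt_eqF // addnat_gt0.
apply/andP; split.
  rewrite -subr_ge0; apply: (tends_ge H); apply: nearW => n.
  have := E n; set s := _ * _ => E'.
  have : 0 <= s.
    rewrite /s mulr_ge0 ?subr_ge0 // sumr_ge0 // => k _.
    by rewrite mulr_ge0 // invr_ge0 ltW // addnat_gt0.
  lra.
apply: (tends_le H); apply: nearW => n.
have -> : ln n.+1%:R - \sum_(0 <= k < n) (y + k%:R)^-1 - (ln n.+1%:R - \sum_(0 <= k < n) (x + k%:R)^-1) = (y - x) * \sum_(0 <= k < n) ((x + k%:R)^-1 * (y + k%:R)^-1).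
  by rewrite -E; ring.
rewrite ler_wpM2l ?subr_ge0 //.
rewrite mulrC; apply: (@le_trans _ _ (\sum_(0 <= k < n) (low x ^+ 2)^-1 * (k.+1%:R ^+ 2)^-1)).
  apply: ler_sum => k _.
  rewrite -!exprVn -exprMn expr2.
  have h := inv_addn_le k x0.
  have hx := addnat_gt0 k x0; have hy := addnat_gt0 k y0.
  apply: ler_pM => //; try by rewrite invr_ge0 ltW.
  by apply: le_trans h; rewrite lef_pV2 ?posrE // lerD2r.
rewrite -mulr_sumr ler_pM2l ?invr_gt0 ?exprn_gt0 //; exact: sum_invsq_le.
Qed.

Lemma psi_cont_at x : 0 < x -> {for x, continuous psi}.
Proof.
move=> x0.
have x2 : 0 < x / 2 by rewrite divr_gt0.
pose K := 2 / low (x / 2) ^+ 2.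
have K0 : 0 < K by rewrite divr_gt0 // exprn_gt0 // low_gt0.
have lip y z : x / 2 <= y -> x / 2 <= z -> `|psi y - psi z| <= K * `|y - z|.
  wlog yz : y z / y <= z.
    move=> W h1 h2; case: (leP y z) => [yz|/ltW zy]; first exact: W.
    by rewrite distrC [`|y - z|]distrC; exact: W.
  move=> h1 h2; have y0 : 0 < y by apply: lt_le_trans h1.
  have /andP[p1 p2] := psi_incr y0 yz.
  rewrite distrC ger0_norm ?subr_ge0 // distrC ger0_norm ?subr_ge0 // mulrC.
  apply: le_trans p2 _; rewrite ler_wpM2l ?subr_ge0 // /K.
  rewrite ler_pM2l // lef_pV2 ?posrE ?exprn_gt0 ?low_gt0 //.
  have l1 := low_gt0 x2; have l2 := low_gt0 y0.
  by apply: lerXn2r; rewrite ?nnegrE ?(ltW l1) ?(ltW l2) // /low le_min !ge_min h1 lexx orbT.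
apply/cvgrPdist_le => e e0.
near=> y.
have hy : `|x - y| < Num.min (x / 2) (e / K).
  by near: y; apply: cvgr_dist_lt => //; rewrite lt_min x2 divr_gt0.
move: hy; rewrite lt_min => /andP[h1 h2].
apply: le_trans (lip x y _ _) _; first lra.
  by move: h1; rewrite ltr_norml => /andP[]; lra.
by rewrite mulrC -ler_pdivlMr // ltW.
Unshelve. all: by end_near. Qed.

Lemma psi_cont (f : R -> R) : cont f -> (forall u, 0 < f u) -> cont (fun u => psi (f u)).
Proof. by move=> cf f0 u; apply: continuous_comp; [exact: cf|exact: psi_cont_at]. Qed.
End digamma_series.

(** * The Gamma function *)

Section gamma.
Context {R : realType}.
Implicit Types (x y h u : R).

(** Euler's integrand after [t = e^u], with the Jacobian included. *)
Definition gam_int x u : R := expR (x * u - expR u).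
Definition gam x : R := J (gam_int x).

Lemma gam_int_cont x : cont (gam_int x).
Proof. by rewrite /gam_int; cauto. Qed.

(** For [u >= 0], [e^u >= 1 + u^2 / 2] reduces the claim to [(u - 2 x)^2 >= 0]; for [u < 0] the
    factor [e^(x u)] already decays. *)
Lemma gam_int_bound x u : 0 < x -> gam_int x u <= expR (2 * x ^+ 2) * expR (- (x * `|u|)).
Proof.
move=> x0; rewrite /gam_int -expRD ler_expR.
have [u0|u0] := leP 0 u.
  have := @expR_ge1Dxn R u 1 u0; rewrite (_ : 2`!%N = 2%N) // => h.
  have h2 : 0 <= u ^+ 2 - 4 * x * u + 4 * x ^+ 2.
    by rewrite (_ : _ + _ = (u - 2 * x) ^+ 2); [exact: sqr_ge0|ring].
  rewrite (ger0_norm u0); lra.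
have := expR_gt0 u => h; have := sqr_ge0 x => h2; rewrite (ltr0_norm u0); lra.
Qed.

Lemma itg_gam x : 0 < x -> itg (gam_int x).
Proof.
move=> x0; apply: (itg_exp x0 (C := expR (2 * x ^+ 2))).
  exact: continuous_meas (@gam_int_cont x).
by move=> u; rewrite ger0_norm ?expR_ge0 // gam_int_bound.
Qed.

Lemma gam_gt0 x : 0 < x -> 0 < gam x.
Proof.
move=> x0; have ig := itg_gam x0.
pose m : R := expR (- x - expR 1).
have m0 : 0 < m by exact: expR_gt0.
have iI : itg ((fun=> 1 : R) \_ `[-1, 1]).
  have := @integrable_indic_itv R (-1) 1 true false.
  by congr itg; apply/funext => u; rewrite patchE indicE /=; case: (u \in _).
apply: (@lt_le_trans _ _ (J (fun u => m * ((fun=> 1 : R) \_ `[-1, 1]) u))).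
  rewrite JZ // (@J_ftc_cut _ (fun u => u) (fun=> 1)).
  - by rewrite opprK mulr_gt0.
  - lra.
  - by move=> u; exact: drv_id.
  - exact: cont_cst.
apply: le_J => //; first exact: itgZ.
move=> u; rewrite patchE mem_setE in_itv /=.
case: ifP => [/andP[u1 u2]|_]; last by rewrite mulr0 expR_ge0.
rewrite mulr1 ler_expR lerB //; last by rewrite ler_expR.
by rewrite -mulrN1 ler_pM2l.
Qed.

Lemma tends_gam_int (a : nat -> R) x : 0 < x -> (forall n, a n <= - n%:R \/ n%:R <= a n) ->
  tends (fun n => gam_int x (a n)) 0.
Proof.
move=> x0 ha; apply: (@tends_norm0 _ _ (fun n => expR (2 * x ^+ 2) * expR (- (x * n%:R)))).
  apply: nearW => n; rewrite ger0_norm ?expR_ge0 //.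
  apply: le_trans (gam_int_bound _ x0) _.
  rewrite ler_pM2l ?expR_gt0 // ler_expR lerN2 ler_pM2l //.
  by case: (ha n) => h; [rewrite -normrN|]; apply: le_trans (ler_norm _); lra.
rewrite -(mulr0 (expR (2 * x ^+ 2))); apply: (tendsM (@tends_cst R _)).
apply: (@tends_ext _ (fun n => expR (- x) ^+ n)) => [|n].
  by apply: cvg_expr; rewrite ger0_norm ?expR_ge0 // expR_lt1 oppr_lt0.
by rewrite -expRM_natr mulNr.
Qed.

Lemma gamD1 x : 0 < x -> gam (x + 1) = x * gam x.
Proof.
move=> x0; have x1 : 0 < x + 1 by rewrite addr_gt0.
have H : J (fun u => x * gam_int x u - gam_int (x + 1) u) = 0 - 0.
  apply: (@J_ftc _ (gam_int x)).
  - move=> u; rewrite /gam_int; apply: drv_eq; first by dauto.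
    rewrite /= (_ : expR ((x + 1) * u - expR u) = expR u * expR (x * u - expR u)); first by ring.
    by rewrite -expRD; congr expR; ring.
  - by rewrite /gam_int; cauto.
  - by apply: itgB; [apply: itgZ|]; exact: itg_gam.
  - by apply: tends_gam_int => // n; right.
  - by apply: tends_gam_int => // n; left.
move: H; rewrite JB; [|by apply: itgZ; exact: itg_gam|exact: itg_gam].
rewrite JZ; last exact: itg_gam.
by rewrite subrr => /eqP; rewrite subr_eq0 => /eqP E; rewrite /gam -E.
Qed.

Lemma gam1 : gam 1 = 1.
Proof.
have -> : gam 1 = 0 - (- 1); last by rewrite opprK add0r.
apply: (@J_ftc _ (fun u => - expR (- expR u))).
- move=> u; apply: drv_eq; first by dauto.
  by rewrite /gam_int /= mul1r expRD; ring.
- exact: gam_int_cont.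
- exact: itg_gam.
- rewrite -oppr0; apply: tendsN.
  apply: (@tends_norm0 _ _ (fun n => expR (- 1) ^+ n)).
    apply: nearW => n; rewrite ger0_norm ?expR_ge0 // -expRM_natr mulN1r ler_expR lerN2.
    by rewrite (le_trans _ (expR_ge1Dx _)) // lerDr.
  by apply: cvg_expr; rewrite ger0_norm ?expR_ge0 // expR_lt1 oppr_lt0.
- apply: tendsN; apply: (@tends_eq _ _ (expR (- 0))); last by rewrite oppr0 expR0.
  apply: tends_exp; apply: tendsN.
  apply: (@tends_ext _ (fun n => expR (- 1) ^+ n)) => [|n].
    by apply: cvg_expr; rewrite ger0_norm ?expR_ge0 // expR_lt1 oppr_lt0.
  by rewrite -expRM_natr mulN1r.
Qed.

Lemma gamE x : gam x = J (gam_int x). Proof. by []. Qed.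
Definition lgam x : R := ln (gam x).
Lemma lgamE x : lgam x = ln (gam x). Proof. by []. Qed.
Opaque gam lgam.

Lemma expR_convex (t p q : R) : 0 <= t -> t <= 1 -> expR (t * p + (1 - t) * q) <= t * expR p + (1 - t) * expR q.
Proof.
move=> t0 t1.
set m := t * p + (1 - t) * q.
have hp := expR_ge1Dx (p - m); have hq := expR_ge1Dx (q - m).
have Ep : expR p = expR m * expR (p - m) by rewrite -expRD; congr expR; ring.
have Eq : expR q = expR m * expR (q - m) by rewrite -expRD; congr expR; ring.
rewrite Ep Eq mulrCA [(1 - t) * (_ * _)]mulrCA -mulrDr ler_peMr ?expR_ge0 //.
have E : 1 = t * (1 + (p - m)) + (1 - t) * (1 + (q - m)) by rewrite /m; ring.
by rewrite {1}E; apply: lerD; apply: ler_wpM2l => //; lra.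
Qed.

(** This is the inequality of Hölder: after both integrands are normalised to integral 1, convexity
    of the exponential is applied pointwise and integrated. *)
Lemma lgam_convex (t a b : R) : 0 < a -> 0 < b -> 0 <= t -> t <= 1 ->
  lgam (t * a + (1 - t) * b) <= t * lgam a + (1 - t) * lgam b.
Proof.
move=> a0 b0 t0 t1.
have ga := gam_gt0 a0; have gb := gam_gt0 b0.
set c := t * a + (1 - t) * b.
have c0 : 0 < c.
  rewrite /c; have [->|tn] := eqVneq t 1; first by rewrite subrr mul0r addr0 mul1r.
  have t1' : 0 < 1 - t by rewrite subr_gt0 lt_neqAle tn.
  by rewrite ltr_wpDl ?mulr_gt0 // mulr_ge0 // ltW.
have gc := gam_gt0 c0.
have ea : expR (lgam a) = gam a by rewrite lgamE lnK.
have eb : expR (lgam b) = gam b by rewrite lgamE lnK.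
have ec : expR (lgam c) = gam c by rewrite lgamE lnK.
rewrite -ler_expR ec.
have ia := itg_gam a0; have ib := itg_gam b0; have ic := itg_gam c0.
move: ga gb ea eb; rewrite !gamE; move: (lgam a) (lgam b) => A B ga gb ea eb.
set E := t * A + (1 - t) * B.
have H : J (gam_int c) <= J (fun u => expR E * (t / J (gam_int a)) * gam_int a u + expR E * ((1 - t) / J (gam_int b)) * gam_int b u).
  apply: le_J => //; first by apply: itgD; exact: itgZ.
  move=> u.
  have h := @expR_convex t (a * u - expR u - A) (b * u - expR u - B) t0 t1.
  rewrite [expR (_ - A)]expRB [expR (_ - B)]expRB ea eb in h.
  have -> : gam_int c u = expR E * expR (t * (a * u - expR u - A) + (1 - t) * (b * u - expR u - B)).
    by rewrite -expRD /gam_int /E /c; congr expR; ring.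
  rewrite -!mulrA -mulrDr ler_pM2l ?expR_gt0 //.
  by rewrite ![_^-1 * _]mulrC; exact: h.
apply: le_trans H _; rewrite JD ?JZ //; try exact: itgZ.
move: ga gb; clear; move: (J (gam_int a)) (J (gam_int b)) => p q p0 q0.
rewrite (_ : _ + _ = expR E) //; field.
by rewrite !gt_eqF.
Qed.

Lemma lgamD1 x : 0 < x -> lgam (x + 1) = ln x + lgam x.
Proof. by move=> x0; rewrite !lgamE gamD1 // lnM ?posrE // gam_gt0. Qed.

(** As in the Bohr-Mollerup theorem, convexity on [[x, x + 1]] is combined with the functional
    equation. *)
Lemma lgam_slope_up x h : 0 < x -> 0 < h -> h <= 1 -> lgam (x + h) - lgam x <= h * ln x.
Proof.
move=> x0 h0 h1.
have x1 : 0 < x + 1 by rewrite addr_gt0.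
have := lgam_convex x1 x0 (ltW h0) h1.
rewrite (_ : h * (x + 1) + (1 - h) * x = x + h); last by ring.
rewrite lgamD1 //; move: (lgam (x + h)) (lgam x) (ln x) => A B C; lra.
Qed.

(** Here [x + 1] is the convex combination of [x] and [x + 1 + h] with weight [h / (1 + h)] on
    [x]. *)
Lemma lgam_slope_low x h : 0 < x -> 0 < h -> h * ln x <= lgam (x + 1 + h) - lgam (x + 1).
Proof.
move=> x0 h0.
have xh : 0 < x + 1 + h by rewrite !addr_gt0.
have h1 : 0 < 1 + h by rewrite addr_gt0.
have t0 : 0 <= h / (1 + h) by rewrite divr_ge0 // ltW.
have t1 : h / (1 + h) <= 1 by rewrite ler_pdivrMr // mul1r lerDr.
have := lgam_convex x0 xh t0 t1.
have -> : h / (1 + h) * x + (1 - h / (1 + h)) * (x + 1 + h) = x + 1 by field; rewrite gt_eqF.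
have -> : 1 - h / (1 + h) = 1 / (1 + h) by field; rewrite gt_eqF.
rewrite lgamD1 //; move: (lgam x) (lgam (x + 1 + h)) (ln x) => A B C.
have -> : h / (1 + h) * A + 1 / (1 + h) * B = (h * A + B) / (1 + h) by field; rewrite gt_eqF.
rewrite ler_pdivlMr //; lra.
Qed.

Lemma lgamDn x n : 0 < x -> lgam (x + n%:R) = lgam x + \sum_(0 <= k < n) ln (x + k%:R).
Proof.
move=> x0; elim: n => [|n ih]; first by rewrite big_geq // !addr0.
by rewrite big_nat_recr //= -[n.+1]addn1 natrD [in LHS]addrA lgamD1 ?addnat_gt0 // ih addrCA; congr (_ + _); exact: addrC.
Qed.

(** The functional equation moves the increment from [x] to [x + n + 1], where the two slope bounds
    pin it between [h ln (x + n)] and [h ln (x + n + 1)]. *)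
Lemma lgam_diff x h n : 0 < x -> 0 < h -> h <= 1 ->
  (h * ln (x + n%:R) - \sum_(0 <= k < n.+1) ln (1 + h / (x + k%:R)) <= lgam (x + h) - lgam x) &&
  (lgam (x + h) - lgam x <= h * ln (x + n.+1%:R) - \sum_(0 <= k < n.+1) ln (1 + h / (x + k%:R))).
Proof.
move=> x0 h0 h1.
have xn := addnat_gt0 n x0; have xn1 := addnat_gt0 n.+1 x0.
have xh : 0 < x + h by rewrite addr_gt0.
have E1 := lgamDn n.+1 x0; have E2 := lgamDn n.+1 xh.
have h2 := lgam_slope_up xn1 h0 h1; have h3 := lgam_slope_low xn h0.
have -> : \sum_(0 <= k < n.+1) ln (1 + h / (x + k%:R)) = \sum_(0 <= k < n.+1) ln (x + h + k%:R) - \sum_(0 <= k < n.+1) ln (x + k%:R).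
  rewrite -sumrB; apply: eq_bigr => k _.
  have xk := addnat_gt0 k x0; have xhk := addnat_gt0 k xh.
  by rewrite -ln_div ?posrE //; congr ln; field; rewrite gt_eqF.
have e : x + n%:R + 1 = x + n.+1%:R by rewrite -addrA natr1.
rewrite e in h3.
rewrite (_ : x + n.+1%:R + h = x + h + n.+1%:R) in h2 h3; last by ring.
move: h2 h3; rewrite E1 E2.
move: (lgam x) (lgam (x + h)) (ln (x + n%:R)) (ln (x + n.+1%:R)) (\sum_(0 <= k < n.+1) ln (x + k%:R)) (\sum_(0 <= k < n.+1) ln (x + h + k%:R)) => A B C D E F; clear.
move: (h * C) (h * D) => c d h2 h3; by apply/andP; split; lra.
Qed.

Lemma tends_harm_ln x (c : nat) : 0 < x ->
  tends (fun n => ln (x + (n + c)%:R) - \sum_(0 <= k < n.+1) (x + k%:R)^-1) (psi x).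
Proof.
move=> x0.
have xc : 0 < x + c%:R by exact: addnat_gt0.
have H := tendsB (tends_psiD x0 xc) (tends_inv_addn x0); rewrite subr0 in H.
apply: (tends_ext H) => n.
by rewrite big_nat_recr //= [(n + c)%N]addnC natrD opprD !addrA.
Qed.

(** Bounds for [ln (1 + t)] inserted in [lgam_diff] produce, as [n] grows, the limit defining [psi].
    The derivative of [lgam] is thus found without differentiating under the integral. *)
Lemma lgam_taylor1 x h : 0 < x -> 0 < h -> h <= 1 ->
  (h * psi x <= lgam (x + h) - lgam x) &&
  (lgam (x + h) - lgam x <= h * psi x + h ^+ 2 * (2 / low x ^+ 2)).
Proof.
move=> x0 h0 h1.
have t0 k : 0 < h / (x + k%:R) by rewrite divr_gt0 // addnat_gt0.
have l0 := low_gt0 x0.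
apply/andP; split.
  have H := tendsM (@tends_cst R h) (tends_harm_ln 0 x0).
  apply: (tends_le H); apply: nearW => n; rewrite addn0.
  have /andP[h2 _] := lgam_diff n x0 h0 h1.
  apply: le_trans h2; rewrite mulrBr lerD2l lerN2 mulr_sumr.
  apply: ler_sum => k _.
  by apply: le_ln1Dx; rewrite (lt_trans _ (t0 k)) // oppr_lt0.
have H := tendsD (tendsM (@tends_cst R h) (tends_harm_ln 1 x0)) (@tends_cst R (h ^+ 2 * (2 / low x ^+ 2))).
apply: (tends_ge H); apply: nearW => n; rewrite addn1.
have /andP[_ h2] := lgam_diff n x0 h0 h1.
apply: le_trans h2 _; rewrite mulrBr -addrA lerD2l mulr_sumr lerNl opprD opprK.
rewrite lerBlDr.
have S : \sum_(0 <= k < n.+1) h ^+ 2 * ((low x ^+ 2)^-1 * (k.+1%:R ^+ 2)^-1) <= h ^+ 2 * (2 / low x ^+ 2).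
  rewrite -mulr_sumr ler_pM2l ?exprn_gt0 // -mulr_sumr mulrC ler_pM2r ?invr_gt0 ?exprn_gt0 //.
  exact: sum_invsq_le.
apply: le_trans (lerD (lexx _) S).
rewrite -big_split /=; apply: ler_sum => k _.
have h3 := ln1D_lower (ltW (t0 k)); have h4 := inv_addn_le k x0.
have h5 : (h / (x + k%:R)) ^+ 2 <= h ^+ 2 * ((low x ^+ 2)^-1 * (k.+1%:R ^+ 2)^-1).
  rewrite exprMn ler_pM2l ?exprn_gt0 // -!exprVn -exprMn.
  apply: lerXn2r h4; rewrite nnegrE; first by rewrite invr_ge0 ltW // addnat_gt0.
  by rewrite mulr_ge0 // invr_ge0 // ltW.
have h6 := sqr_ge0 (h / (x + k%:R)).
move: h3 h5 h6; move: (h ^+ 2 * _) => C; move: (ln (1 + _)) => A; move: (h / _) => B; clear; lra.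
Qed.

(** For [h < 0] the one-sided estimate is applied at [x + h] with step [- h], and [psi_incr] brings
    [psi (x + h)] back to [psi x]; this costs the factor 2. All points stay above [x / 2], so [K] is
    uniform. *)
Lemma lgam_quot x h (K : R) : 0 < x -> h != 0 -> `|h| < Num.min (x / 2) 1 ->
  K = 2 / low (x / 2) ^+ 2 ->
  `|h^-1 * (lgam (h + x) - lgam x) - psi x| <= `|h| * (2 * K).
Proof.
move=> x0 hn + EK; rewrite lt_min => /andP[h1 h2].
have x2 : 0 < x / 2 by rewrite divr_gt0.
have l2 := low_gt0 x2.
have K0 : 0 <= K by rewrite EK divr_ge0 // exprn_ge0 // ltW.
have Kle y : x / 2 <= y -> 2 / low y ^+ 2 <= K.
  move=> hy; have y0 : 0 < y by apply: lt_le_trans hy.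
  have l1 := low_gt0 y0.
  rewrite EK ler_pM2l // lef_pV2 ?posrE ?exprn_gt0 //.
  by apply: lerXn2r; rewrite ?nnegrE ?(ltW l1) ?(ltW l2) // /low le_min !ge_min hy lexx orbT.
case: (ltgtP h 0) hn => // [hneg|hpos] _.
  have hp : 0 < - h by rewrite oppr_gt0.
  have xh : x / 2 <= x + h by move: h1; rewrite ltr0_norm //; lra.
  have xh0 : 0 < x + h by apply: lt_le_trans xh.
  rewrite ltr0_norm // in h2.
  have := lgam_taylor1 xh0 hp (ltW h2); rewrite addrK => /andP[a1 a2].
  have xhx : x + h <= x by rewrite gerDl ltW.
  have /andP[b1 b2] := psi_incr xh0 xhx.
  have k1 := Kle _ xh.
  rewrite (ltr0_norm hneg) [h + x]addrC.
  rewrite opprD addrA subrr add0r in b2.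
  move: a1 a2 b1 b2 k1; rewrite sqrrN.
  move: (lgam (x + h)) (lgam x) (psi x) (psi (x + h)) (2 / _) => A B C D E a1 a2 b1 b2 k1.
  have hE : h ^+ 2 * E <= h ^+ 2 * K by rewrite ler_pM2l // exprn_even_gt0 //= lt_eqF.
  have hE2 : - h * E <= - h * K by rewrite ler_pM2l.
  have hK : 0 <= - h * K by rewrite mulr_ge0 // ltW.
  have -> : h^-1 * (A - B) = (B - A) / (- h) by field; rewrite lt_eqF.
  have q1 : D <= (B - A) / - h by rewrite ler_pdivlMr // mulrC.
  have q2 : (B - A) / - h <= D + - h * K.
    rewrite ler_pdivrMr // (_ : (D + _) * _ = - h * D + h ^+ 2 * K); [lra|ring].
  move: q1 q2; move: (_ / - h) => Q q1 q2.
  rewrite ler_norml; apply/andP; split; lra.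
rewrite gtr0_norm // in h2.
have /andP[a1 a2] := lgam_taylor1 x0 hpos (ltW h2).
have k1 : 2 / low x ^+ 2 <= K by apply: Kle; rewrite ler_pdivrMr // ler_peMr ?ler1n // ltW.
rewrite (gtr0_norm hpos) [h + x]addrC [h^-1 * _]mulrC.
move: a1 a2 k1; move: (lgam (x + h)) (lgam x) (psi x) (2 / _) => A B C E a1 a2 k1.
have hE : h ^+ 2 * E <= h ^+ 2 * K by rewrite ler_pM2l // exprn_gt0.
have hK : 0 <= h ^+ 2 * K by rewrite mulr_ge0 // exprn_ge0 // ltW.
rewrite ger0_norm; last by rewrite subr_ge0 ler_pdivlMr // mulrC.
rewrite lerBlDl ler_pdivrMr // (_ : (C + _) * h = h * C + 2 * (h ^+ 2 * K)); [lra|ring].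
Qed.

Lemma drv_lgam x : 0 < x -> drv x lgam (psi x).
Proof.
move=> x0.
have x2 : 0 < x / 2 by rewrite divr_gt0.
pose K := 2 / low (x / 2) ^+ 2.
have K0 : 0 <= K by rewrite divr_ge0 // exprn_ge0 // ltW // low_gt0.
have C : (fun h => h^-1 *: ((lgam \o shift x) (h *: (1 : R)) - lgam x)) @ (0 : R)^' --> psi x.
  apply/cvgrPdist_le => e e0.
  have d0 : 0 < Num.min (Num.min (x / 2) 1) (e / (2 * K + 1)).
    by rewrite !lt_min x2 ltr01 /= divr_gt0 // ltr_wpDl // mulr_ge0.
  near=> h.
  have hn : h != 0 by near: h; exact: nbhs_dnbhs_neq.
  have hd : `|h| < Num.min (Num.min (x / 2) 1) (e / (2 * K + 1)).
    near: h; apply: dnbhs0_lt; exact: d0.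
  move: hd; rewrite lt_min => /andP[hd1 hd2].
  rewrite distrC; have := lgam_quot x0 hn hd1 erefl.
  rewrite /= /GRing.scale /= mulr1 => /le_trans; apply.
  move: hd2; rewrite ltr_pdivlMr; last by rewrite ltr_wpDl // mulr_ge0.
  rewrite -/K mulrDr mulr1; have := normr_ge0 h; move: (`|h|) => H *; lra.
split; first by apply/cvg_ex; exists (psi x); exact: C.
exact: (cvg_lim _ C).
Unshelve. all: by end_near. Qed.

Lemma drv_gam x : 0 < x -> drv x gam (gam x * psi x).
Proof.
move=> x0.
have H : drv x (fun y => expR (lgam y)) (expR (lgam x) * psi x) by apply: drv_exp; exact: drv_lgam.
have eg : expR (lgam x) = gam x by rewrite lgamE lnK // posrE gam_gt0.
move: H; rewrite eg => H; apply: near_eq_is_derive H.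
near=> y; rewrite lgamE lnK // posrE gam_gt0 //.
by near: y; exact: lt_nbhsr.
Unshelve. all: by end_near. Qed.

(** One more term of [ln (1 + t)] gives half of the sum of inverse squares as coefficient of [h^2].
    The cubic error uses that inverse cubes are at most inverse squares, whose sums are at most
    2. *)
Lemma lgam_taylor2 h : 0 < h -> h <= 1 ->
  (h * psi 1 + h ^+ 2 / 2 * (limn (series (fun k : nat => (k.+1%:R ^+ 2)^-1 : R))) - 2 / 3 * h ^+ 3 <= lgam (1 + h)) &&
  (lgam (1 + h) <= h * psi 1 + h ^+ 2 / 2 * (limn (series (fun k : nat => (k.+1%:R ^+ 2)^-1 : R)))).
Proof.
move=> h0 h1.
set Z := limn _.
have x0 := @ltr01 R.
have tZ : tends (series (fun k : nat => (k.+1%:R ^+ 2)^-1 : R)) Z by exact: cvgn_invsq.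
have tZ1 := (tends_shift _ _ 1).2 tZ.
have L1 : lgam 1 = 0 by rewrite lgamE gam1 ln1.
have e k : h / (1 + k%:R) = h * k.+1%:R^-1 by rewrite nat1r.
have ge k : 0 <= h / (1 + k%:R) by rewrite divr_ge0 ?(ltW h0) // ltW // addnat_gt0.
apply/andP; split.
  have H := tendsB (tendsD (tendsM (@tends_cst R h) (tends_harm_ln 0 x0)) (tendsM (@tends_cst R (h ^+ 2 / 2)) tZ1)) (@tends_cst R (2 / 3 * h ^+ 3)).
  apply: (tends_le H); apply: nearW => n; rewrite addn0 addn1.
  have /andP[h2 _] := lgam_diff n x0 h0 h1; rewrite L1 subr0 in h2.
  apply: le_trans h2.
  rewrite mulrBr mulr_sumr.
  suff : \sum_(0 <= k < n.+1) ln (1 + h / (1 + k%:R)) <= \sum_(0 <= i < n.+1) h * (1 + i%:R)^-1 - h ^+ 2 / 2 * series (fun k : nat => (k.+1%:R ^+ 2)^-1) n.+1 + 2 / 3 * h ^+ 3.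
    move: (\sum_(_ <= _ < _) _) (\sum_(_ <= _ < _) _) (series _ _) (ln _) => *; lra.
  have S : \sum_(0 <= k < n.+1) (h ^+ 3 / 3) * (k.+1%:R ^+ 2)^-1 <= 2 / 3 * h ^+ 3.
    rewrite -mulr_sumr (_ : 2 / 3 * h ^+ 3 = h ^+ 3 / 3 * 2); last by ring.
    by rewrite ler_pM2l ?sum_invsq_le // divr_gt0 // exprn_gt0.
  apply: le_trans (lerD (lexx _) S).
  rewrite /series /= mulr_sumr -sumrB -big_split /=; apply: ler_sum => k _.
  apply: le_trans (ln1D_upper (ge k)) _.
  rewrite !e; have k1 : 0 < k.+1%:R^-1 :> R by rewrite invr_gt0.
  have k2 : k.+1%:R^-1 <= 1 :> R by rewrite invf_le1 // ler1n.
  rewrite -!exprVn; move: (k.+1%:R^-1) k1 k2 => q k1 k2.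
  have : q ^+ 3 <= q ^+ 2 by rewrite exprS ler_piMl // exprn_ge0 // ltW.
  have : 0 < h ^+ 3 by rewrite exprn_gt0.
  move=> a b; have : h ^+ 3 * q ^+ 3 <= h ^+ 3 * q ^+ 2 by rewrite ler_pM2l.
  by rewrite !exprMn => ?; lra.
have H := tendsD (tendsM (@tends_cst R h) (tends_harm_ln 1 x0)) (tendsM (@tends_cst R (h ^+ 2 / 2)) tZ1).
apply: (tends_ge H); apply: nearW => n; rewrite addn1.
have /andP[_ h2] := lgam_diff n x0 h0 h1; rewrite L1 subr0 in h2.
apply: le_trans h2 _.
rewrite mulrBr mulr_sumr.
suff : \sum_(0 <= i < n.+1) h * (1 + i%:R)^-1 - h ^+ 2 / 2 * series (fun k : nat => (k.+1%:R ^+ 2)^-1) n.+1 <= \sum_(0 <= k < n.+1) ln (1 + h / (1 + k%:R)).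
  move: (\sum_(_ <= _ < _) _) (\sum_(_ <= _ < _) _) (series _ _) (ln _) => *; lra.
rewrite /series /= mulr_sumr -sumrB; apply: ler_sum => k _.
apply: le_trans (ln1D_lower (ge k)).
by rewrite !e -!exprVn exprMn le_eqVlt; apply/orP; left; apply/eqP; ring.
Qed.

(** For [t > 0] this is the integrand of [Gamma], with the power written as an exponential. *)
Definition gam_den x t : R := expR ((x - 1) * ln t) * expR (- t).

Lemma gam_den_cont x t : 0 < t -> {for t, continuous (gam_den x)}.
Proof.
move=> t0; apply: differentiable_continuous; apply/derivable1_diffP.
have H : drv t (gam_den x) (expR ((x - 1) * ln t) * (0 * ln t + (x - 1) * (t^-1 * 1)) * expR (- t) + expR ((x - 1) * ln t) * (expR (- t) * - 1)).
  apply: (@drvM R t (fun y => expR ((x - 1) * ln y)) (fun y => expR (- y))); apply: drv_exp.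
    by apply: drvM; [exact: drv_cst|apply: (@drv_ln _ _ (fun y => y)) => //; exact: drv_id].
  by apply: drvN; exact: drv_id.
by case: H.
Qed.

Lemma gam_den_subst x n : (\int[lebesgue_measure]_(t in `[expR (- n%:R), expR n%:R]) (gam_den x t)%:E =
  (J (gam_int x \_ `[- n%:R, n%:R]))%:E)%E.
Proof.
have de : derive1 (@expR R) = @expR R.
  by apply/funext => u; rewrite derive1E derive_val.
have ce : cont (@expR R) by exact: continuous_expR.
have nn : - n%:R <= n%:R :> R by rewrite (@le_trans _ _ 0) ?oppr_le0.
rewrite (@integration_by_substitution_increasing _ expR) //.
- rewrite de /J -Rintegral_mkcond /Rintegral fineK; last first.
    apply: integrable_fin_num => //; apply: continuous_compact_integrable; first exact: segment_compact.
    by apply: continuous_subspaceT; exact: gam_int_cont.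
  apply: eq_integral => u _; congr EFin.
  change (gam_den x (expR u) * expR u = gam_int x u).
  by rewrite /gam_den /gam_int expRK -!expRD; congr expR; ring.
- by move=> u v _ _; rewrite ltr_expR.
- by rewrite de => u _; exact: ce.
- by rewrite de; apply/cvg_ex; exists (expR (- n%:R)); apply: cvg_at_right_filter; exact: ce.
- by rewrite de; apply/cvg_ex; exists (expR n%:R); apply: cvg_at_left_filter; exact: ce.
- split=> //; first by apply: cvg_at_right_filter; exact: ce.
  by apply: cvg_at_left_filter; exact: ce.
- apply: continuous_in_subspaceT => t; rewrite inE /= in_itv /= => /andP[h _].
  by apply: gam_den_cont; apply: lt_le_trans h; exact: expR_gt0.
Qed.

(** The substitution is made on [[e^-n, e^n]]; the left side then passes to the limit by monotone
    convergence, the right side by integrability of [gam_int]. *)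
Lemma Gamma_gam x : 0 < x -> Gamma x = gam x.
Proof.
move=> x0; rewrite /Gamma /Rintegral.
have -> : (\int[lebesgue_measure]_(t in `]0%R, +oo[) (t `^ (x - 1) * expR (- t))%:E = \int[lebesgue_measure]_(t in `]0%R, +oo[) (gam_den x t)%:E)%E.
  apply: eq_integral => t; rewrite inE /= in_itv /= andbT => t0.
  by rewrite /gam_den /powR gt_eqF.
pose A (n : nat) : set R := `[expR (- n%:R), expR n%:R]%classic.
have UA : \bigcup_n A n = `]0, +oo[%classic.
  apply/seteqP; split => t /=.
    by case=> n _; rewrite /A /= !in_itv /= andbT => /andP[h _]; apply: lt_le_trans h; exact: expR_gt0.
  rewrite in_itv /= andbT => t0.
  have [n hn] : exists n : nat, `|ln t| <= n%:R.
    exists (Num.truncn `|ln t|).+1; rewrite ltW //.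
    by have /andP[] := Num.Theory.truncn_itv (normr_ge0 (ln t)).
  exists n => //; rewrite /A /= in_itv /=.
  by rewrite -[t]lnK ?posrE // !ler_expR -ler_norml.
have hc : (\int[lebesgue_measure]_(x0 in A n) (gam_den x x0)%:E @[n --> \oo] --> \int[lebesgue_measure]_(t in `]0%R, +oo[) (gam_den x t)%:E)%E.
  rewrite -UA; apply: ge0_nondecreasing_set_cvg_integral.
  - move=> n m nm; apply/subsetPset => t; rewrite /A /= !in_itv /= => /andP[h1 h2].
    by rewrite (le_trans h2) ?ler_expR ?ler_nat // andbT (le_trans _ h1) // ler_expR lerN2 ler_nat.
  - by move=> n; exact: measurable_itv.
  - move=> n; apply/measurable_EFinP; apply: (@measurable_funS _ _ _ _ setT) => //.
    rewrite /gam_den; apply: measurable_funM; apply: measurableT_comp => //.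
      by apply: measurable_funM => //; exact: measurable_ln.
  - by move=> n t _; rewrite lee_fin mulr_ge0 ?expR_ge0.
rewrite -(cvg_lim _ hc) //.
suff : (\int[lebesgue_measure]_(t in A n) (gam_den x t)%:E @[n --> \oo] --> (gam x)%:E)%E.
  by move=> /cvg_lim ->.
apply: (@cvg_trans _ (((J (gam_int x \_ `[- n%:R, n%:R]))%:E) @[n --> \oo])%E).
  by under eq_fun do rewrite gam_den_subst.
apply: cvg_EFin; first by apply: nearW.
rewrite gamE; apply: J_lim; first exact: itg_gam.
move=> u; near=> n.
have : `|u| <= n%:R by near: n; exact: nbhs_infty_ger.
by rewrite ler_norml in_itv.
Unshelve. all: by end_near. Qed.

Lemma digamma_psi x : 0 < x -> digamma x = psi x.
Proof.
move=> x0; rewrite /digamma Gamma_gam //.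
have -> : derive1 Gamma x = gam x * psi x.
  have [_ <-] := drv_gam x0.
  rewrite derive1E; apply: near_eq_derive; near=> y; apply: Gamma_gam.
  by near: y; exact: lt_nbhsr.
by rewrite mulrAC divff ?mul1r // gt_eqF // gam_gt0.
Unshelve. all: by end_near. Qed.
End gamma.

(** * Zeta on the critical line *)

Section fractional_part.
Context {R : realType}.
Implicit Types (w a L : R).

Definition fr w : R := expR w - (Num.truncn (expR w))%:R.

(** The integer part of [e^w] counts the [j] with [ln (j + 1) <= w]. As a finite sum of indicators
    of half-lines it can be integrated exactly. *)
Lemma truncn_sum w N : w <= ln N.+1%:R ->
  (Num.truncn (expR w))%:R = \sum_(0 <= j < N.+1) ((ln j.+1%:R <= w)%R)%:R :> R.
Proof.
move=> hw.
have e j : (ln j.+1%:R <= w) = (j < Num.truncn (expR w))%N.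
  by rewrite truncn_gt_nat -[in RHS](@lnK _ j.+1%:R) ?posrE // ler_expR.
under eq_bigr do rewrite e.
have hm : (Num.truncn (expR w) <= N.+1)%N.
  rewrite -(@ler_nat R) (@le_trans _ _ (expR w)) ?truncn_le ?expR_ge0 //.
  by rewrite -[leRHS]lnK ?posrE // ler_expR.
move: (Num.truncn _) hm => m hm.
rewrite (@big_cat_nat _ _ _ m) //= [X in _ + X]big_nat_cond [X in _ + X]big1 ?addr0; last first.
  by move=> j; rewrite andbT => /andP[h _]; rewrite ltnNge h.
rewrite (eq_big_nat _ _ (F2 := fun=> 1)); last by move=> j /andP[_ ->].
by rewrite sumr_const_nat subn0.
Qed.

Lemma fr_ge0 w : 0 <= fr w.
Proof. by rewrite subr_ge0 truncn_le expR_ge0. Qed.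

Lemma fr_le1 w : fr w <= 1.
Proof.
have /andP[_ h] := Num.Theory.truncn_itv (expR_ge0 w).
by rewrite /fr lerBlDl natr1 ltW.
Qed.

Lemma fr_lt0 w : w < 0 -> fr w = expR w.
Proof.
move=> w0; rewrite /fr (_ : Num.truncn _ = 0%N) ?subr0 //.
by apply: truncn_def; rewrite expR_ge0 expR_lt1.
Qed.

Lemma fr_meas : measurable_fun setT fr.
Proof.
apply: measurable_funB; first exact: measurable_expR.
apply: (@measurable_fun_cvg _ _ _ _ (fun N w => \sum_(0 <= j < N.+1) ((ln j.+1%:R <= w)%R)%:R : R)).
  by move=> N; apply: measurable_sum => j; exact: measurable_ge.
move=> w _; apply: cvg_near_cst; near=> N.
rewrite -truncn_sum // -[w]expRK ler_ln ?posrE ?expR_gt0 //.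
apply: (@le_trans _ _ N%:R); last by rewrite ler_nat.
by near: N; exact: nbhs_infty_ger.
Unshelve. all: by end_near. Qed.

Lemma J_cut (F f : R -> R) a b : a <= b -> (forall x, drv x F (f x)) -> cont f ->
  J (f \_ `[a, b]) = F b - F a.
Proof.
rewrite le_eqVlt => /predU1P[<- dF cf|ab]; last exact: J_ftc_cut.
by rewrite /J -Rintegral_mkcond /Rintegral set_itv1 integral_set1 subrr.
Qed.

Lemma itg_cut (f : R -> R) a b : cont f -> itg (f \_ `[a, b]).
Proof.
move=> cf; rewrite /itg -restrict_EFin; have [h _] := @integrable_mkcond _ _ R (@lebesgue_measure R) `[a, b]%classic (EFin \o f) (measurable_itv _); apply: h.
apply: continuous_compact_integrable; first exact: segment_compact.
exact: continuous_subspaceT.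
Qed.

(** A form of Abel summation: each indicator of the integer part contributes an increment of [F0],
    and the term [e^w] an increment of [F1]. The first jump is at [ln 1 = 0], whence the condition
    on [a]. *)
Lemma J_fr (B F0 F1 : R -> R) a N : a <= 0 -> cont B ->
  (forall w, drv w F0 (B w)) -> (forall w, drv w F1 (expR w * B w)) ->
  J ((fun w => fr w * B w) \_ `[a, ln N.+1%:R]) =
  F1 (ln N.+1%:R) - F1 a - \sum_(0 <= j < N.+1) (F0 (ln N.+1%:R) - F0 (ln j.+1%:R)).
Proof.
move=> a0 cB d0 d1.
have cE : cont (fun w => expR w * B w) by cauto.
have L0 : 0 <= ln N.+1%:R :> R by rewrite ln_ge0 // ler1n.
have -> : (fun w => fr w * B w) \_ `[a, ln N.+1%:R] =
    (fun w => ((fun w => expR w * B w) \_ `[a, ln N.+1%:R]) w -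
     \sum_(0 <= j < N.+1) (B \_ `[ln j.+1%:R, ln N.+1%:R]) w).
  apply/funext => w; rewrite patchE mem_setE in_itv /= [in RHS]patchE mem_setE in_itv /=.
  under eq_bigr do rewrite patchE mem_setE in_itv /=.
  have [wL|wL] := leP w (ln N.+1%:R); last first.
    by rewrite andbF big1 ?subr0 // => j _; rewrite andbF.
  under eq_bigr do rewrite andbT; rewrite andbT.
  have [aw|wa] := leP a w; last first.
    rewrite big1 ?subr0 // => j _; case: ifP => // h.
    have : w < ln j.+1%:R by rewrite (lt_le_trans wa) // (le_trans a0) // ln_ge0 // ler1n.
    by rewrite ltNge h.
  rewrite /fr (truncn_sum wL) mulrBl mulr_suml; congr (_ - _); apply: eq_bigr => j _.
  by case: ifP; rewrite ?mul1r ?mul0r.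
have [h1 h2] := @J_sum R N.+1 (fun j => B \_ `[ln j.+1%:R, ln N.+1%:R]) (fun j => @itg_cut _ _ _ cB).
rewrite JB //; last exact: itg_cut.
rewrite h2 (@J_cut F1) //; last exact: le_trans L0.
congr (_ - _); apply: eq_big_nat => j /andP[_ jN].
by rewrite (@J_cut F0) // ler_ln ?posrE // ler_nat.
Qed.

Definition phi w : R := fr w * expR (- (w / 2)).

Lemma phi_meas : measurable_fun setT phi.
Proof.
apply: measurable_funM; first exact: fr_meas.
by apply: continuous_meas; cauto.
Qed.

Lemma phi_bound w : `|phi w| <= expR (- (2^-1 * `|w|)).
Proof.
rewrite /phi ger0_norm ?mulr_ge0 ?fr_ge0 ?expR_ge0 //.
have [w0|w0] := leP 0 w.
  by rewrite ger0_norm // [2^-1 * w]mulrC ler_piMl ?expR_ge0 // fr_le1.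
rewrite fr_lt0 // ltr0_norm // -expRD ler_expR; lra.
Qed.

Lemma itg_phi : itg phi.
Proof. by apply: (@itg_exp R phi 1 2^-1) => //; [exact: phi_meas|move=> x; rewrite mul1r; exact: phi_bound]. Qed.

Lemma tends_ln_nat : forall M : R, \forall N \near \oo, M <= ln N.+1%:R.
Proof.
move=> M; near=> N; rewrite -[M]expRK ler_ln ?posrE ?expR_gt0 //.
apply: (@le_trans _ _ N%:R); last by rewrite ler_nat.
by near: N; exact: nbhs_infty_ger.
Unshelve. all: by end_near. Qed.
End fractional_part.

(** * Real analytic functions and the identity theorem *)

Section real_analytic.
Context {R : realType}.
Implicit Types (f g : R -> R) (x c h : R).

Definition powser (a : nat -> R) h := series (fun k => a k * h ^+ k).

(* The identity theorem is only needed along one line Im s = v with v <> 0,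
   where Re zeta and Im zeta are real analytic in Re s > 0. *)
Definition ra f := forall x, 0 < x -> exists a : nat -> R, exists2 d : R, 0 < d &
  forall h, `|h| < d -> tends (powser a h) (f (x + h)).

Lemma ra_eq f g : ra f -> (forall x, f x = g x) -> ra g.
Proof.
move=> hf e x x0; have [a [d d0 h]] := hf x x0; exists a, d => // t td.
by rewrite -e; exact: h.
Qed.

Lemma raD f g : ra f -> ra g -> ra (fun x => f x + g x).
Proof.
move=> hf hg x x0; have [a [d d0 h]] := hf x x0; have [b [e e0 k]] := hg x x0.
exists (fun k => a k + b k), (Num.min d e); first by rewrite lt_min d0.
move=> t; rewrite lt_min => /andP[t1 t2].
apply: (tends_ext (tendsD (h t t1) (k t t2))) => n.
by rewrite /powser /series /= -big_split /=; apply: eq_bigr => j _; rewrite mulrDl.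
Qed.

Lemma raZ c f : ra f -> ra (fun x => c * f x).
Proof.
move=> hf x x0; have [a [d d0 h]] := hf x x0.
exists (fun k => c * a k), d => // t t1.
apply: (tends_ext (tendsM (@tends_cst R c) (h t t1))) => n.
by rewrite /powser /series /= mulr_sumr; apply: eq_bigr => j _; rewrite mulrA.
Qed.

Lemma raX f : ra f -> ra (fun x => x * f x).
Proof.
move=> hf x x0; have [a [d d0 h]] := hf x x0.
exists (fun k => x * a k + (if k is j.+1 then a j else 0)), d => // t t1.
have H := h t t1.
apply/(tends_shift _ _ 1); rewrite mulrDl.
apply: (tends_ext (tendsD (tendsM (@tends_cst R x) ((tends_shift _ _ 1).2 H)) (tendsM (@tends_cst R t) H))) => n.
rewrite addn1 /powser /series /=.
under [in RHS]eq_bigr do rewrite mulrDl.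
rewrite big_split /=; congr (_ + _).
  by rewrite mulr_sumr; apply: eq_bigr => j _; rewrite mulrA.
rewrite big_nat_recl //= mul0r add0r mulr_sumr.
by apply: eq_bigr => j _; rewrite exprS mulrCA.
Qed.

Lemma ra_cst c : ra (fun=> c).
Proof.
move=> x x0; exists (fun k => if k is 0 then c else 0), 1 => // t _.
apply/(tends_shift _ _ 1); apply: (tends_ext (@tends_cst R c)) => n.
rewrite addn1 /powser /series /= big_nat_recl //= big1 ?addr0 ?mulr1 // => j _.
by rewrite mul0r.
Qed.

Lemma raQ (b c : R) f : ra f -> ra (fun x => (x ^+ 2 + b * x + c) * f x).
Proof.
move=> hf; apply: (ra_eq (raD (raX (raX hf)) (raD (raZ b (raX hf)) (raZ c hf)))) => x.
ring.
Qed.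

(** The terms at [d] are bounded, so for [|h| <= d / 2] the tail is dominated by a geometric series
    of ratio at most [1/2], with sum at most twice its first term. *)
Lemma powser_bound (a : nat -> R) (d : R) (m : nat) : 0 < d -> (forall k, (k < m)%N -> a k = 0) ->
  (exists l, tends (powser a d) l) ->
  exists B : R, forall h s, `|h| <= d / 2 -> tends (powser a h) s -> `|s - a m * h ^+ m| <= B * `|h| ^+ m.+1.
Proof.
move=> d0 a0 [l hl].
have [B hB] : exists B : R, forall k, `|a k * d ^+ k| <= B.
  have hz : (fun k => a k * d ^+ k) @ \oo --> 0 by apply: (@cvg_series_cvg_0 R R); apply/cvg_ex; exists l; exact: hl.
  have [B [_ hB]] := cvg_seq_bounded (cvgP _ hz).
  by exists (B + 1) => k; apply: (hB (B + 1)); rewrite ?ltrDl.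
have B0 : 0 <= B by apply: le_trans (hB 0%N).
exists (B / d ^+ m.+1 * 2) => h s hd hs.
have E n : (m < n)%N -> powser a h n - a m * h ^+ m = \sum_(m.+1 <= k < n) a k * h ^+ k.
  move=> mn; rewrite /powser /series /= (@big_cat_nat _ _ _ m) //=; last exact: ltnW.
  rewrite [X in X + _ - _]big_nat_cond [X in X + _ - _]big1 ?add0r; last first.
    by move=> j; rewrite andbT => /andP[_ hj]; rewrite a0 // mul0r.
  by rewrite [X in X - _]big_ltn // addrAC subrr add0r.
have H := tends_norm (tendsB hs (@tends_cst R (a m * h ^+ m))).
apply: (tends_le H); near=> n.
rewrite E; last by near: n; exact: nbhs_infty_gt.
pose q := `|h| / d.
have q0 : 0 <= q by rewrite divr_ge0 // ltW.
have q1 : q <= 2^-1 by rewrite ler_pdivrMr // mulrC.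
apply: (@le_trans _ _ (\sum_(m.+1 <= k < n) B * q ^+ m.+1 * 2^-1 ^+ (k - m.+1))).
  apply: le_trans (ler_norm_sum _ _ _) _; rewrite !big_nat; apply: ler_sum => k /andP[mk _].
  apply: (@le_trans _ _ (B * q ^+ k)).
    have -> : `|a k * h ^+ k| = `|a k * d ^+ k| * q ^+ k.
      rewrite !normrM !normrX [`|d|]gtr0_norm // -mulrA -exprMn /q mulrC [d * _]mulrC divfK ?gt_eqF //.
      by rewrite mulrC.
    by rewrite ler_wpM2r ?exprn_ge0.
  rewrite -mulrA ler_wpM2l // -{1}(subnKC mk) exprD ler_wpM2l ?exprn_ge0 //.
  by apply: lerXn2r; rewrite ?nnegrE.
rewrite -mulr_sumr.
have -> : B / d ^+ m.+1 * 2 * `|h| ^+ m.+1 = B * q ^+ m.+1 * 2.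
  by rewrite /q expr_div_n; ring.
rewrite ler_wpM2l ?mulr_ge0 ?exprn_ge0 //.
rewrite -{1}[m.+1]add0n big_addn.
under eq_bigr do rewrite addnK.
have G N : \sum_(0 <= j < N) (2^-1 : R) ^+ j <= 2 - 2 * 2^-1 ^+ N.
  elim: N => [|N ih]; first by rewrite big_geq // expr0 mulr1 subrr.
  rewrite big_nat_recr //= exprS; apply: le_trans (lerD ih (lexx _)) _.
  have : 0 < (2^-1 : R) ^+ N by rewrite exprn_gt0.
  move: (2^-1 ^+ N) => t t0; lra.
by apply: le_trans (G _) _; rewrite gerBl mulr_ge0 // exprn_ge0.
Unshelve. all: by end_near. Qed.

(** Only [h > 0] is tested. The first nonzero coefficient would satisfy [|a m| <= B h] for all small
    [h]. *)
Lemma powser_zero (a : nat -> R) (d : R) : 0 < d ->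
  (forall h, 0 < h -> h < d -> tends (powser a h) 0) -> forall k, a k = 0.
Proof.
move=> d0 H.
have d2 : 0 < d / 2 by rewrite divr_gt0.
have dd : d / 2 < d by rewrite ltr_pdivrMr // ltr_pMr // ltr1n.
suff h m : forall k, (k < m)%N -> a k = 0 by move=> k; apply: (h k.+1).
elim: m => // m ih k; rewrite ltnS leq_eqVlt => /predU1P[->|]; last exact: ih.
have [B hB] := powser_bound d2 ih (ex_intro _ 0 (H _ d2 dd)).
apply/eqP/negPn/negP => am.
have n0 : 0 < `|a m| by rewrite normr_gt0.
(* The series is known to converge at [d / 2], so [powser_bound] allows [|h| <= d / 4]; the second
   entry forces [B h < |a m|]. *)
pose h := Num.min (d / 4) (`|a m| / (2 * (`|B| + 1))).
have B1 : 0 < 2 * (`|B| + 1) by rewrite mulr_gt0 // ltr_wpDl.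
have h0 : 0 < h by rewrite lt_min !divr_gt0.
have hd : h <= d / 4 by rewrite ge_min lexx.
have hB2 : h <= `|a m| / (2 * (`|B| + 1)) by rewrite ge_min lexx orbT.
have h4 : `|h| <= d / 2 / 2 by rewrite (gtr0_norm h0); lra.
have h5 : h < d by apply: le_lt_trans hd _; lra.
have := hB h 0 h4 (H h h0 h5).
rewrite sub0r normrN normrM normrX (gtr0_norm h0) exprS mulrA ler_pM2r ?exprn_gt0 // => hh.
move: hB2; rewrite ler_pdivlMr // => hB2.
have : B * h <= `|B| * h by rewrite ler_pM2r // ler_norm.
have P0 : 0 <= `|B| * h by rewrite mulr_ge0 // ltW.
rewrite (_ : h * (2 * (`|B| + 1)) = 2 * (`|B| * h) + 2 * h) in hB2; last by ring.
move: h0 n0 hh hB2 P0; rewrite -/h; clearbody h; move: (`|B| * h) (B * h) (`|a m|); clear; move=> *; lra.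
Qed.

(** Let [c] be the infimum of the points beyond which [f] vanishes. If [c > 0], the expansion at [c]
    sums to 0 on the right, so its coefficients vanish and [f] is 0 also slightly to the left,
    against minimality. *)
Lemma ra_identity f : ra f -> (forall x, 1 < x -> f x = 0) -> forall x, 0 < x -> f x = 0.
Proof.
move=> hf f1 y y0; apply/eqP/negPn/negP => fy.
pose S := [set x : R | 0 < x /\ forall t, x < t -> f t = 0].
have S1 : S 1 by split.
have Sy x : S x -> y <= x.
  by move=> [_ h]; rewrite leNgt; apply/negP => xy; move: fy; rewrite h // eqxx.
have hS : has_inf S by split; [exists 1|exists y => x; exact: Sy].
pose c := inf S.
have yc : y <= c by apply: lb_le_inf; [exists 1|move=> x; exact: Sy].
have c0 : 0 < c by apply: lt_le_trans yc.
have fc t : c < t -> f t = 0.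
  by move=> ct; have [x [_ hx] xt] := inf_lt hS.1 ct; exact: hx.
have [a [d d0 H]] := hf c c0.
have az : forall k, a k = 0.
  apply: (powser_zero d0) => h h0 hd.
  by have := H h; rewrite gtr0_norm // fc ?ltrDl //; apply.
have fz h : `|h| < d -> f (c + h) = 0.
  move=> hd; apply: (tends_unique (H h hd)); apply: (tends_ext (@tends_cst R 0)) => n.
  by rewrite /powser /series /= big1 // => j _; rewrite az mul0r.
pose e := Num.min (d / 2) (c / 2).
have e0 : 0 < e by rewrite lt_min !divr_gt0.
have ed : e < d by rewrite gt_min; apply/orP; left; rewrite ltr_pdivrMr // ltr_pMr // ltr1n.
have ec : e < c by rewrite gt_min; apply/orP; right; rewrite ltr_pdivrMr // ltr_pMr // ltr1n.
have : S (c - e).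
  split; first by rewrite subr_gt0.
  move=> t ct; have [tc|ct'] := leP t c; last exact: fc.
  have -> : t = c + (t - c) by ring.
  apply: fz; rewrite ler0_norm ?subr_le0 //.
  by rewrite opprB; apply: lt_trans ed; move: ct; move: (e) => e'; lra.
move=> /(inf_lbound hS.2); rewrite -/c; move: e0; move: (e) (c) => e' c'; lra.
Qed.
End real_analytic.

(** * Analyticity of Laplace transforms *)

Section laplace.
Context {R : realType}.
Implicit Types (x w h p : R).

Lemma exp_series_le x n : 0 <= x -> \sum_(0 <= k < n) x ^+ k / k`!%:R <= expR x.
Proof.
move=> x0.
have H : tends (series (exp_coeff x)) (expR x) by exact: is_cvg_series_exp_coeff.
apply: (tends_ge H); near=> m; rewrite /series /= [leRHS](@big_cat_nat _ _ _ n) //=; last first.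
  by near: m; exact: nbhs_infty_ge.
by rewrite lerDl sumr_ge0 // => j _; rewrite /exp_coeff /= divr_ge0 // exprn_ge0.
Unshelve. all: by end_near. Qed.

Lemma exp_term_le x k : 0 <= x -> x ^+ k / k`!%:R <= expR x.
Proof.
move=> x0; apply: le_trans (exp_series_le k.+1 x0).
by rewrite big_nat_recr //= lerDr sumr_ge0 // => j _; rewrite divr_ge0 // exprn_ge0.
Qed.

Variable b : R -> R.
Hypothesis mb : measurable_fun setT b.
Hypothesis b0 : forall w, w < 0 -> b w = 0.
Hypothesis b1 : forall w, `|b w| <= 1.

Lemma lap_bound p w : `|b w * expR (- (p * w))| <= expR (- (p * `|w|)).
Proof.
have [w0|w0] := leP 0 w; last by rewrite b0 // mul0r normr0 expR_ge0.
by rewrite normrM [`|expR _|]ger0_norm ?expR_ge0 // (ger0_norm w0) ler_piMl ?expR_ge0.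
Qed.

Lemma lap_meas p : measurable_fun setT (fun w => b w * expR (- (p * w))).
Proof. by apply: measurable_funM mb _; apply: continuous_meas; cauto. Qed.

(** The factor [e^(-h w)] is expanded under the integral; for [|h| < x / 2] half of the decay of
    [e^(-x w)] absorbs it, so the radius [x / 2] works. *)
Lemma ra_lap : ra (fun p => J (fun w => b w * expR (- (p * w)))).
Proof.
move=> x x0.
have x2 : 0 < x / 2 by rewrite divr_gt0.
pose T k w := b w * expR (- (x * w)) * ((- w) ^+ k / k`!%:R).
have iT k : itg (T k).
  apply: (@itg_exp R _ ((x / 2) ^- k) (x / 2)) => //.
    apply: measurable_funM; first exact: lap_meas.
    by apply: continuous_meas; cauto.
  move=> w; rewrite /T normrM.
  have h1 := lap_bound x w.
  have h2 : `|(- w) ^+ k / k`!%:R| = (x / 2) ^- k * ((x / 2 * `|w|) ^+ k / k`!%:R).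
    move: x2; move: (x / 2) => y y0.
    rewrite normrM normfV normr_nat normrX normrN exprMn -[y ^+ k * _ / _]mulrA mulKf //.
    by rewrite expf_neq0 // gt_eqF.
  rewrite h2 mulrCA ler_pM2l ?invr_gt0 ?exprn_gt0 //.
  have h3 : (x / 2 * `|w|) ^+ k / k`!%:R <= expR (x / 2 * `|w|).
    by apply: exp_term_le; rewrite mulr_ge0 // ltW.
  apply: le_trans (ler_pM _ _ h1 h3) _ => //.
    by rewrite divr_ge0 // exprn_ge0 // mulr_ge0 // ltW.
  by rewrite -expRD ler_expR; move: (`|w|) => W; rewrite le_eqVlt; apply/orP; left; apply/eqP; field.
exists (fun k => J (T k)), (x / 2) => // h hx.
have [] // := @dct R (fun n w => \sum_(0 <= k < n) h ^+ k * T k w) (fun w => b w * expR (- ((x + h) * w))) (fun w => expR (- ((x / 2) * `|w|))).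
- by move=> n; apply: measurable_sum => k; apply: measurable_funM => //; exact: itg_meas.
- move=> w.
  have -> : b w * expR (- ((x + h) * w)) = b w * expR (- (x * w)) * expR (- (h * w)).
    by rewrite -mulrA -expRD; congr (_ * expR _); ring.
  have H : tends (series (exp_coeff (- (h * w)))) (expR (- (h * w))) by exact: is_cvg_series_exp_coeff.
  apply: (tends_ext (tendsM (@tends_cst R _) H)) => n.
  rewrite /series /= mulr_sumr; apply: eq_bigr => k _.
  by rewrite /T /exp_coeff /= -[- (h * w)]mulrN exprMn; ring.
- exact: itg_expN.
- move=> n w.
  have -> : \sum_(0 <= k < n) h ^+ k * T k w = b w * expR (- (x * w)) * \sum_(0 <= k < n) (- (h * w)) ^+ k / k`!%:R.
    by rewrite mulr_sumr; apply: eq_bigr => k _; rewrite /T -[- (h * w)]mulrN exprMn; ring.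
  rewrite normrM.
  have h1 := lap_bound x w.
  have h2 : `|\sum_(0 <= k < n) (- (h * w)) ^+ k / k`!%:R| <= expR (x / 2 * `|w|).
    apply: le_trans (ler_norm_sum _ _ _) _.
    apply: (@le_trans _ _ (expR (`|h| * `|w|))); last by rewrite ler_expR ler_wpM2r // ltW.
    have hw0 : 0 <= `|h| * `|w| by rewrite mulr_ge0.
    apply: le_trans (exp_series_le n hw0).
    by apply: ler_sum => k _; rewrite normrM normfV normr_nat normrX normrN normrM.
  apply: le_trans (ler_pM _ _ h1 h2) _ => //.
  by rewrite -expRD ler_expR; move: (`|w|) => W; rewrite le_eqVlt; apply/orP; left; apply/eqP; field.
move=> _ H; apply: (tends_ext H) => n.
have [_ ->] := @J_sum R n (fun k w => h ^+ k * T k w) (fun k => itgZ _ (iT k)).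
by rewrite /powser /series /=; apply: eq_bigr => k _; rewrite JZ // mulrC.
Qed.
End laplace.

(** * Dirichlet series and the fractional part *)

Section dirichlet.
Context {R : realType}.
Implicit Types (w p sg : R).

Lemma tends_powN p : 0 < p -> tends (fun n => expR (- (p * ln n.+1%:R))) 0.
Proof.
move=> p0; apply/cvgrPdist_le => e e0; near=> n.
rewrite sub0r normrN ger0_norm ?expR_ge0 // -[leRHS]lnK ?posrE // ler_expR.
have : - ln e / p <= ln n.+1%:R by near: n; exact: tends_ln_nat.
by rewrite ler_pdivrMr // lerNl mulrC.
Unshelve. all: by end_near. Qed.

(** For [T] the cosine or sine of [v w] and [A p] a component of [- e^(-s w) / s], this is a
    component of the formula that the integral of [frac(e^w) e^(-s w)] over [w > 0] is
    [1 / (s - 1) - zeta(s) / s]. It follows from [J_fr] on [[0, ln (N + 1)]], the boundary terms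
    being [O(N^(1 - sg))]. *)
Lemma tends_dirichlet (T : R -> R) (A : R -> R -> R) (K : R -> R) sg : 1 < sg -> cont T -> (forall w, `|T w| <= 1) ->
  (forall p w, 0 < p -> drv w (A p) (expR (- (p * w)) * T w)) ->
  (forall p w, 0 < p -> `|A p w| <= K p * expR (- (p * w))) ->
  tends (fun N => \sum_(0 <= j < N) A sg (ln j.+1%:R))
    (J (fun w => (fr w * T w * ((0 <= w)%R)%:R) * expR (- (sg * w))) + A (sg - 1) 0).
Proof.
move=> s1 cT T1 dA bA.
have s0 : 0 < sg by rewrite (lt_trans _ s1).
have p0 : 0 < sg - 1 by rewrite subr_gt0.
pose B w := expR (- (sg * w)) * T w.
have cB : cont B by rewrite /B; cauto.
have H N : J ((fun w => fr w * B w) \_ `[0, ln N.+1%:R]) =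
  A (sg - 1) (ln N.+1%:R) - A (sg - 1) 0 - \sum_(0 <= j < N.+1) (A sg (ln N.+1%:R) - A sg (ln j.+1%:R)).
  apply: J_fr => // w; first exact: dA.
  apply: drv_eq; first exact: dA.
  by rewrite /B mulrA -expRD; congr (expR _ * _); ring.
have mT : measurable_fun setT (fun w => fr w * T w * ((0 <= w)%R)%:R).
  apply: measurable_funM; last exact: measurable_ge.
  by apply: measurable_funM; [exact: fr_meas|exact: continuous_meas].
have L : tends (fun N => J ((fun w => fr w * B w) \_ `[0, ln N.+1%:R])) (J (fun w => (fr w * T w * ((0 <= w)%R)%:R) * expR (- (sg * w)))).
  have [] // := @dct R (fun N => (fun w => fr w * B w) \_ `[0, ln N.+1%:R]) (fun w => (fr w * T w * ((0 <= w)%R)%:R) * expR (- (sg * w))) (fun w => expR (- (sg * `|w|))).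
  - move=> N; apply/measurable_restrict => //; apply: measurable_funS (_ : measurable_fun setT _) => //.
    by apply: measurable_funM; [exact: fr_meas|exact: continuous_meas].
  - move=> w; apply: cvg_near_cst; near=> N.
    rewrite patchE mem_setE in_itv /= /B.
    have -> : w <= ln N.+1%:R by near: N; exact: tends_ln_nat.
    by rewrite andbT; case: (0 <= w); rewrite ?mulr1 ?mulr0 ?mul0r //; ring.
  - exact: itg_expN.
  - move=> N w; rewrite patchE mem_setE in_itv /=; case: ifP => [/andP[w0 _]|_]; last by rewrite normr0 expR_ge0.
    rewrite /B !normrM !(ger0_norm (fr_ge0 _), ger0_norm (expR_ge0 _), ger0_norm w0).
    rewrite mulrCA ler_piMr ?expR_ge0 // mulr_ile1 ?fr_ge0 ?fr_le1 //.
have Z1 : tends (fun N => A (sg - 1) (ln N.+1%:R)) 0.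
  apply: (@tends_norm0 _ _ (fun N => K (sg - 1) * expR (- ((sg - 1) * ln N.+1%:R)))).
    by apply: nearW => N; exact: bA.
  by apply: tends_eq (tendsM (@tends_cst R _) (tends_powN p0)) _; rewrite mulr0.
have Z2 : tends (fun N => N.+1%:R * A sg (ln N.+1%:R)) 0.
  apply: (@tends_norm0 _ _ (fun N => K sg * expR (- ((sg - 1) * ln N.+1%:R)))).
    apply: nearW => N; rewrite normrM normr_nat.
    have -> : expR (- ((sg - 1) * ln N.+1%:R)) = N.+1%:R * expR (- (sg * ln N.+1%:R)).
      by rewrite -{2}(@lnK _ N.+1%:R) ?posrE // -expRD; congr expR; ring.
    by rewrite mulrCA ler_wpM2l //; exact: bA.
  by apply: tends_eq (tendsM (@tends_cst R _) (tends_powN p0)) _; rewrite mulr0.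
apply/(tends_shift _ _ 1).
apply: (tends_eq (tends_ext (tendsD (tendsB L Z1) (tendsD (@tends_cst R (A (sg - 1) 0)) Z2)) _)) => [N|].
  rewrite addn1 H sumrB sumr_const_nat subn0 -[A _ _ *+ N.+1]mulr_natl.
  move: (\sum_(_ <= _ < _) _) (N.+1%:R * _) (A _ (ln _)) (A _ 0) => a b c d; ring.
by rewrite subr0 addr0.
Unshelve. all: by end_near. Qed.
End dirichlet.

(** * Real and imaginary parts along a horizontal line *)

Section complex_line.
Context {R : realType}.
Local Notation C := R[i]^o.
Implicit Types z s : C.
Lemma ReD z s : complex.Re (z + s) = complex.Re z + complex.Re s.
Proof. by case: z; case: s. Qed.
Lemma ImD z s : complex.Im (z + s) = complex.Im z + complex.Im s.
Proof. by case: z; case: s. Qed.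
Lemma normCE z : `|z| = (Normc.normc z)%:C%C.
Proof. by []. Qed.
Lemma Re_le_normc z : `|complex.Re z| <= Normc.normc z.
Proof.
case: z => a b /=; rewrite -[`|a|]ger0_norm // -sqrtr_sqr ler_sqrt ?addr_ge0 ?sqr_ge0 //.
by rewrite -normrX ger0_norm ?sqr_ge0 // lerDl sqr_ge0.
Qed.
Lemma Im_le_normc z : `|complex.Im z| <= Normc.normc z.
Proof.
case: z => a b /=; rewrite -[`|b|]ger0_norm // -sqrtr_sqr ler_sqrt ?addr_ge0 ?sqr_ge0 //.
by rewrite -normrX ger0_norm ?sqr_ge0 // lerDr sqr_ge0.
Qed.
Lemma cvg_Re (u : nat -> C) (l : C) : u @ \oo --> l -> tends (fun n => complex.Re (u n)) (complex.Re l).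
Proof.
move=> /cvgrPdist_lt h; apply/cvgrPdist_lt => e e0.
have e0' : (0 : C) < e%:C%C by rewrite ltcR.
have := h _ e0'; apply: filterS => n; rewrite normCE ltcR; apply: le_lt_trans.
by apply: le_trans (Re_le_normc _); case: (l) => a b; case: (u n).
Qed.
Lemma cvg_Im (u : nat -> C) (l : C) : u @ \oo --> l -> tends (fun n => complex.Im (u n)) (complex.Im l).
Proof.
move=> /cvgrPdist_lt h; apply/cvgrPdist_lt => e e0.
have e0' : (0 : C) < e%:C%C by rewrite ltcR.
have := h _ e0'; apply: filterS => n; rewrite normCE ltcR; apply: le_lt_trans.
by apply: le_trans (Im_le_normc _); case: (l) => a b; case: (u n).
Qed.
Lemma near_line (P : C -> Prop) (x v : R) : (\forall z \near (x +i* v)%C : C, P z) ->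
  exists2 d : R, 0 < d & forall h, `|h| < d -> P ((x + h) +i* v)%C.
Proof.
move=> /nbhs_ballP[e /= e0 he].
(* Radii of balls in [R[i]] are themselves complex; positivity makes them real. *)
have [e1 e2] : complex.Im e = 0 /\ 0 < complex.Re e.
  by move: e0; rewrite ltcE => /andP[/eqP -> ->].
exists (complex.Re e) => // h hd; apply: he; rewrite -ball_normE /=.
have -> : e = (complex.Re e)%:C%C by case: (e) e1 => a b /= ->.
have -> : ((x +i* v)%C : C) - (((x + h) +i* v)%C : C) = (- h)%:C%C.
  by apply/eqP; rewrite eq_complex /=; apply/andP; split; apply/eqP; ring.
rewrite normCE ltcR /= expr0n /= addr0 sqrtr_sqr normrN //.
Qed.
Lemma Re_sum (u : nat -> C) n : complex.Re (\sum_(0 <= k < n) u k) = \sum_(0 <= k < n) complex.Re (u k).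
Proof. by elim: n => [|n ih]; [rewrite !big_geq|rewrite !big_nat_recr //= ReD ih]. Qed.
Lemma Im_sum (u : nat -> C) n : complex.Im (\sum_(0 <= k < n) u k) = \sum_(0 <= k < n) complex.Im (u k).
Proof. by elim: n => [|n ih]; [rewrite !big_geq|rewrite !big_nat_recr //= ImD ih]. Qed.
Lemma scale_Re (a : C) (h : R) k : complex.Re (a * (h%:C%C : C) ^+ k) = complex.Re a * h ^+ k.
Proof. by rewrite -rmorphXn; case: a => a b /=; rewrite mulr0 subr0. Qed.
Lemma scale_Im (a : C) (h : R) k : complex.Im (a * (h%:C%C : C) ^+ k) = complex.Im a * h ^+ k.
Proof. by rewrite -rmorphXn; case: a => a b /=; rewrite mulr0 add0r. Qed.
End complex_line.

(** * Analyticity of zeta on a horizontal line off the pole *)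

Section zeta_line.
Context {R : realType}.
Local Notation C := R[i]^o.
Variable zeta : C -> C.
Hypothesis zetaP : is_riemann_zeta zeta.
Variable v : R.
Hypothesis v0 : v != 0.

Definition zr (p : R) : R := complex.Re (zeta (p +i* v)%C).
Definition zi (p : R) : R := complex.Im (zeta (p +i* v)%C).

Let off1 (p : R) : ((p +i* v)%C : C) != 1.
Proof. by rewrite eq_complex /= (negbTE v0) andbF. Qed.

Let expand (p : R) : exists a : nat -> C, exists2 d : R, 0 < d & forall h, `|h| < d ->
  series (fun k => a k * ((h%:C)%C : C) ^+ k) @ \oo --> zeta (((p + h) +i* v)%C : C).
Proof.
have [a ha] := zetaP.2 _ (off1 p); have [d d0 hd] := near_line ha.
exists a, d; first exact: d0.
move=> h hh; have := hd h hh.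
have -> : (((p + h) +i* v)%C : C) - ((p +i* v)%C : C) = (h%:C)%C.
  by apply/eqP; rewrite eq_complex /=; apply/andP; split; apply/eqP; ring.
by [].
Qed.

Lemma ra_zr : ra zr.
Proof.
move=> p p0; have [a [d d0 hd]] := expand p.
exists (fun k => complex.Re (a k)), d => // h hh.
apply: (tends_ext (cvg_Re (hd h hh))) => n.
by rewrite /powser /series /= Re_sum; apply: eq_bigr => k _; rewrite scale_Re.
Qed.

Lemma ra_zi : ra zi.
Proof.
move=> p p0; have [a [d d0 hd]] := expand p.
exists (fun k => complex.Im (a k)), d => // h hh.
apply: (tends_ext (cvg_Im (hd h hh))) => n.
by rewrite /powser /series /= Im_sum; apply: eq_bigr => k _; rewrite scale_Im.
Qed.
End zeta_line.

(** * The transform of the fractional part on the critical line *)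

Section zeta_series.
Context {R : realType}.
Local Notation C := R[i]^o.
Variable zeta : C -> C.
Hypothesis zetaP : is_riemann_zeta zeta.

Lemma cexp_term (p v l : R) : cexp (- ((p +i* v)%C : C) * (l%:C)%C) =
  ((expR (- (p * l)) * cos (v * l)) +i* (- (expR (- (p * l)) * sin (v * l))))%C.
Proof.
rewrite /cexp /= !mulr0 subr0 add0r !mulNr cosN sinN mulrN.
by [].
Qed.

Lemma tends_zr (p v : R) : 1 < p ->
  tends (fun N => \sum_(0 <= j < N) expR (- (p * ln j.+1%:R)) * cos (v * ln j.+1%:R)) (zr zeta v p).
Proof.
move=> p1; have := zetaP.1 (p +i* v)%C p1 => /cvg_Re H.
apply: (tends_ext H) => n; rewrite /series /= Re_sum; apply: eq_bigr => j _.
by rewrite cexp_term.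
Qed.

Lemma tends_zi (p v : R) : 1 < p ->
  tends (fun N => \sum_(0 <= j < N) expR (- (p * ln j.+1%:R)) * sin (v * ln j.+1%:R)) (- zi zeta v p).
Proof.
move=> p1; have := zetaP.1 (p +i* v)%C p1 => /cvg_Im H.
apply: (tends_ext (tendsN H)) => n; rewrite /series /= Im_sum -sumrN; apply: eq_bigr => j _.
by rewrite cexp_term /= opprK.
Qed.

(** [G1] is the real part and [G2] minus the imaginary part of the integral of [frac(e^w) e^(-s w)]
    over [w >= 0], with [s = p + i v]. *)
Definition G1 (v p : R) := J (fun w => (fr w * cos (v * w) * ((0 <= w)%R)%:R) * expR (- (p * w))).
Definition G2 (v p : R) := J (fun w => (fr w * sin (v * w) * ((0 <= w)%R)%:R) * expR (- (p * w))).

Let sq_gt0 (v p : R) : 0 < p -> 0 < p ^+ 2 + v ^+ 2.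
Proof. by move=> p0; rewrite ltr_wpDr ?sqr_ge0 // exprn_gt0. Qed.

Let trig_bound (v p a b : R) w : 0 < p -> `|a| <= 1 -> `|b| <= 1 -> forall x y : R,
  `|expR (- (p * w)) * (x * a + y * b) / (p ^+ 2 + v ^+ 2)| <= (`|x| + `|y|) / (p ^+ 2 + v ^+ 2) * expR (- (p * w)).
Proof.
move=> p0 a1 b1 x y; have s0 := sq_gt0 v p0.
rewrite 2!normrM normfV [`|expR _|]ger0_norm ?expR_ge0 // (gtr0_norm s0).
rewrite [leRHS]mulrC -mulrA ler_pM2l ?expR_gt0 // ler_pM2r ?invr_gt0 //.
apply: le_trans (ler_normD _ _) _; rewrite !normrM lerD // ler_piMr //.
Qed.

(** [AC] and [AS] are the real part and minus the imaginary part of [- e^(-s w) / s] with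
    [s = p + i v], the primitive of [e^(-s w)] that vanishes at infinity. *)
Definition AC (v p w : R) := expR (- (p * w)) * (v * sin (v * w) + (- p) * cos (v * w)) / (p ^+ 2 + v ^+ 2).
Definition AS (v p w : R) := expR (- (p * w)) * ((- p) * sin (v * w) + (- v) * cos (v * w)) / (p ^+ 2 + v ^+ 2).

Lemma drv_AC v p w : 0 < p -> drv w (AC v p) (expR (- (p * w)) * cos (v * w)).
Proof.
move=> p0; have s0 := sq_gt0 v p0; rewrite /AC; apply: drv_eq; first by dauto.
by rewrite /=; field; rewrite gt_eqF.
Qed.

Lemma drv_AS v p w : 0 < p -> drv w (AS v p) (expR (- (p * w)) * sin (v * w)).
Proof.
move=> p0; have s0 := sq_gt0 v p0; rewrite /AS; apply: drv_eq; first by dauto.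
by rewrite /=; field; rewrite gt_eqF.
Qed.

Lemma G1E v p : 1 < p -> G1 v p - (p - 1) / ((p - 1) ^+ 2 + v ^+ 2) =
  - (p * zr zeta v p + v * zi zeta v p) / (p ^+ 2 + v ^+ 2).
Proof.
move=> p1; have p0 : 0 < p by apply: lt_trans p1.
have q0 : 0 < p - 1 by rewrite subr_gt0.
have [s0 s1] := (sq_gt0 v p0, sq_gt0 v q0).
have H := @tends_dirichlet R (fun w => cos (v * w)) (AC v) (fun p => (`|v| + `|- p|) / (p ^+ 2 + v ^+ 2)) p p1 (@cos_cont1 R v) (fun w => cos_max _) (fun p w h => drv_AC v w h) (fun p w h => trig_bound v w h (sin_max _) (cos_max _) v (- p)).
have E : G1 v p - (p - 1) / ((p - 1) ^+ 2 + v ^+ 2) = G1 v p + AC v (p - 1) 0.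
  by rewrite /AC !mulr0 oppr0 expR0 sin0 cos0; field; rewrite gt_eqF.
rewrite E; apply: (tends_unique H).
have H2 := tendsM (tendsD (tendsM (@tends_cst R v) (@tends_zi p v p1)) (tendsM (@tends_cst R (- p)) (@tends_zr p v p1))) (@tends_cst R (p ^+ 2 + v ^+ 2)^-1).
apply: (tends_eq (tends_ext H2 _)) => [N|].
  rewrite !mulr_sumr -big_split mulr_suml; apply: eq_bigr => j _.
  by rewrite /AC /=; ring.
by field; rewrite gt_eqF.
Qed.

Lemma G2E v p : 1 < p -> G2 v p - v / ((p - 1) ^+ 2 + v ^+ 2) =
  (p * zi zeta v p - v * zr zeta v p) / (p ^+ 2 + v ^+ 2).
Proof.
move=> p1; have p0 : 0 < p by apply: lt_trans p1.
have q0 : 0 < p - 1 by rewrite subr_gt0.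
have [s0 s1] := (sq_gt0 v p0, sq_gt0 v q0).
have H := @tends_dirichlet R (fun w => sin (v * w)) (AS v) (fun p => (`|- p| + `|- v|) / (p ^+ 2 + v ^+ 2)) p p1 (@sin_cont1 R v) (fun w => sin_max _) (fun p w h => drv_AS v w h) (fun p w h => trig_bound v w h (sin_max _) (cos_max _) (- p) (- v)).
have E : G2 v p - v / ((p - 1) ^+ 2 + v ^+ 2) = G2 v p + AS v (p - 1) 0.
  by rewrite /AS !mulr0 oppr0 expR0 sin0 cos0; field; rewrite gt_eqF.
rewrite E; apply: (tends_unique H).
have H2 := tendsM (tendsD (tendsM (@tends_cst R (- p)) (@tends_zi p v p1)) (tendsM (@tends_cst R (- v)) (@tends_zr p v p1))) (@tends_cst R (p ^+ 2 + v ^+ 2)^-1).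
apply: (tends_eq (tends_ext H2 _)) => [N|].
  rewrite !mulr_sumr -big_split mulr_suml; apply: eq_bigr => j _.
  by rewrite /AS /=; ring.
by field; rewrite gt_eqF.
Qed.

Lemma ra_half (T : R -> R) : cont T -> (forall w, `|T w| <= 1) ->
  ra (fun p => J (fun w => (fr w * T w * ((0 <= w)%R)%:R) * expR (- (p * w)))).
Proof.
move=> cT T1; apply: ra_lap.
- apply: measurable_funM; last exact: measurable_ge.
  by apply: measurable_funM; [exact: fr_meas|exact: continuous_meas].
- by move=> w w0; rewrite leNgt w0 mulr0.
- move=> w; rewrite !normrM (ger0_norm (fr_ge0 _)) mulr_ile1 ?mulr_ge0 ?fr_ge0 //.
    by rewrite mulr_ile1 ?fr_ge0 ?fr_le1.
  by case: (0 <= w); rewrite ?normr1 ?normr0.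
Qed.

(** The formula [G1E], known for [p > 1], is carried to [p = 1/2] by the identity theorem along the
    line [Im s = v]. *)
Lemma G1_half v : v != 0 -> G1 v 2^-1 = - (2^-1 + 2^-1 * zr zeta v 2^-1 + v * zi zeta v 2^-1) / (4^-1 + v ^+ 2).
Proof.
move=> vn.
(* The difference of both sides multiplied by [|s|^2 |s - 1|^2]: without denominators, closure of
   [ra] under sums and polynomial factors suffices. The quadratics are written in the shape of
   [raQ]. *)
pose f p := (p ^+ 2 + 0 * p + v ^+ 2) * ((p ^+ 2 + (- 2) * p + (1 + v ^+ 2)) * G1 v p) +
  ((p ^+ 2 + 0 * p + v ^+ 2) * (-1 * (p * 1) + 1) +
   (p ^+ 2 + (- 2) * p + (1 + v ^+ 2)) * (p * zr zeta v p + v * zi zeta v p)).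
have rf : ra f.
  apply: raD; first by apply: raQ; apply: raQ; apply: ra_half; [exact: cos_cont1|move=> w; exact: cos_max].
  apply: raD; apply: raQ; last by apply: raD; [apply: raX; exact: ra_zr|apply: raZ; exact: ra_zi].
  by apply: raD; [apply: raZ; apply: raX; exact: ra_cst|exact: ra_cst].
have f1 p : 1 < p -> f p = 0.
  move=> p1; have p0 : 0 < p by apply: lt_trans p1.
  have q0 : 0 < p - 1 by rewrite subr_gt0.
  have [s0 s1] := (sq_gt0 v p0, sq_gt0 v q0).
  have := G1E v p1; rewrite /f; move: (G1 v p) (zr zeta v p) (zi zeta v p) => g a b E.
  have -> : g = (p - 1) / ((p - 1) ^+ 2 + v ^+ 2) + - (p * a + v * b) / (p ^+ 2 + v ^+ 2) by rewrite -E; ring.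
  by field; rewrite !gt_eqF.
have h0 : 0 < 2^-1 :> R by rewrite invr_gt0.
have := ra_identity rf f1 h0; rewrite /f.
move: (G1 v 2^-1) (zr zeta v 2^-1) (zi zeta v 2^-1) => g a b.
have s0 := sq_gt0 v h0.
have q0 : 4^-1 + v ^+ 2 != 0 by rewrite gt_eqF //; move: s0; rewrite (_ : 2^-1 ^+ 2 = 4^-1 :> R) //; field.
move=> H; have : (4^-1 + v ^+ 2) * ((4^-1 + v ^+ 2) * g + (2^-1 + 2^-1 * a + v * b)) = 0 by rewrite -H; field.
move=> /eqP; rewrite mulf_eq0 (negbTE q0) /= addr_eq0 => /eqP E.
by apply: (mulIf q0); rewrite divfK // mulrC.
Qed.

Lemma G2_half v : v != 0 -> G2 v 2^-1 = (v + 2^-1 * zi zeta v 2^-1 - v * zr zeta v 2^-1) / (4^-1 + v ^+ 2).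
Proof.
move=> vn.
pose f p := (p ^+ 2 + 0 * p + v ^+ 2) * ((p ^+ 2 + (- 2) * p + (1 + v ^+ 2)) * G2 v p) +
  ((p ^+ 2 + 0 * p + v ^+ 2) * (- v) +
   (p ^+ 2 + (- 2) * p + (1 + v ^+ 2)) * (-1 * (p * zi zeta v p) + v * zr zeta v p)).
have rf : ra f.
  apply: raD; first by apply: raQ; apply: raQ; apply: ra_half; [exact: sin_cont1|move=> w; exact: sin_max].
  apply: raD; apply: raQ; last by apply: raD; [apply: raZ; apply: raX; exact: ra_zi|apply: raZ; exact: ra_zr].
  exact: ra_cst.
have f1 p : 1 < p -> f p = 0.
  move=> p1; have p0 : 0 < p by apply: lt_trans p1.
  have q0 : 0 < p - 1 by rewrite subr_gt0.
  have [s0 s1] := (sq_gt0 v p0, sq_gt0 v q0).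
  have := G2E v p1; rewrite /f; move: (G2 v p) (zr zeta v p) (zi zeta v p) => g a b E.
  have -> : g = v / ((p - 1) ^+ 2 + v ^+ 2) + (p * b - v * a) / (p ^+ 2 + v ^+ 2) by rewrite -E; ring.
  by field; rewrite !gt_eqF.
have h0 : 0 < 2^-1 :> R by rewrite invr_gt0.
have := ra_identity rf f1 h0; rewrite /f.
move: (G2 v 2^-1) (zr zeta v 2^-1) (zi zeta v 2^-1) => g a b.
have s0 := sq_gt0 v h0.
have q0 : 4^-1 + v ^+ 2 != 0 by rewrite gt_eqF //; move: s0; rewrite (_ : 2^-1 ^+ 2 = 4^-1 :> R) //; field.
move=> H; have : (4^-1 + v ^+ 2) * ((4^-1 + v ^+ 2) * g - (v + 2^-1 * b - v * a)) = 0 by rewrite -H; field.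
move=> /eqP; rewrite mulf_eq0 (negbTE q0) /= subr_eq0 => /eqP E.
by apply: (mulIf q0); rewrite divfK // mulrC.
Qed.

Lemma J_neg (F f : R -> R) (a : R) : 0 < a -> (forall w, drv w F (f w)) -> cont f -> (forall w, `|f w * ((w <= 0)%R)%:R| <= expR (- (a * `|w|))) ->
  tends (fun n => F (- n%:R)) 0 ->
  itg (fun w => f w * ((w < 0)%R)%:R) /\ J (fun w => f w * ((w < 0)%R)%:R) = F 0.
Proof.
move=> a0 dF cf bf hF.
have mlt : measurable_fun setT (fun w : R => ((w < 0)%R)%:R : R).
  rewrite (_ : (fun w : R => _) = (fun w : R => 1 - ((0 <= w)%R)%:R)); last first.
    by apply/funext => w; rewrite ltNge; case: (0 <= w); rewrite /= ?subrr ?subr0.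
  by apply: measurable_funB => //; exact: measurable_ge.
have [] // := @dct0 R (fun n => f \_ `[- n%:R, 0]) (fun w => f w * ((w < 0)%R)%:R) (fun w => expR (- (a * `|w|))).
- move=> n; apply/measurable_restrict => //; apply: measurable_funS (_ : measurable_fun setT f) => //.
  exact: continuous_meas.
- by apply: measurable_funM mlt; exact: continuous_meas.
- move=> w wn; apply: cvg_near_cst; near=> n.
  rewrite patchE mem_setE in_itv /= lt_neqAle wn /=.
  have -> : - n%:R <= w.
    by rewrite lerNl; near: n; exact: nbhs_infty_ger.
  by case: (w <= 0); rewrite ?mulr1 ?mulr0.
- exact: itg_expN.
- move=> n w; rewrite patchE mem_setE in_itv /=; case: ifP => [/andP[_ h]|_]; last by rewrite normr0 expR_ge0.
  by have := bf w; rewrite h mulr1.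
move=> h1 h2; split=> //; apply: (tends_unique h2).
apply: (tends_eq (tends_ext (tendsB (@tends_cst R (F 0)) hF) _)) => [n|]; last by rewrite subr0.
by rewrite (@J_cut _ F) // oppr_le0.
Unshelve. all: by end_near. Qed.

(** For [w < 0] the fractional part of [e^w] is [e^w] itself, so [phi] is [e^(w/2)] there and the
    integral is elementary; the half-line [w >= 0] gives [G1] or [G2] at [1/2]. *)
Let J_split (T : R -> R) (F : R -> R) : cont T -> (forall w, `|T w| <= 1) -> (forall w, drv w F (expR (w / 2) * T w)) ->
  tends (fun n => F (- n%:R)) 0 ->
  J (fun w => phi w * T w) = J (fun w => (fr w * T w * ((0 <= w)%R)%:R) * expR (- (2^-1 * w))) + F 0.
Proof.
move=> cT T1 dF hF.
have cc : cont (fun w => expR (w / 2) * T w) by cauto.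
have h2 : 0 < 2^-1 :> R by rewrite invr_gt0.
have [|h1 h3] := @J_neg F (fun w => expR (w / 2) * T w) 2^-1 h2 dF cc _ hF.
  move=> w; case: (leP w 0) => w0; last by rewrite mulr0 normr0 expR_ge0.
  rewrite mulr1 normrM ger0_norm ?expR_ge0 // (ler0_norm w0) mulrN opprK [2^-1 * w]mulrC.
  by rewrite ler_piMr ?expR_ge0.
rewrite -h3 -JD //.
- apply: eq_J => w; rewrite /phi; case: (ltP w 0) => w0.
    rewrite mulr0 mul0r add0r mulr1 fr_lt0 // -expRD; congr (expR _ * _); lra.
  by rewrite mulr0 addr0 mulr1 [2^-1 * w]mulrC; ring.
- have half : 0 < 2^-1 :> R by rewrite invr_gt0.
  have iP := itg_ge 0 (itg_bddM (@itg_phi R) (continuous_meas cT) T1).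
  move: iP; congr itg; apply/funext => w; rewrite /phi [2^-1 * w]mulrC; ring.
Qed.

(** The negative half-line contributes [1 / (1 - s)], which cancels the pole term [1 / (s - 1)].
    What is left of the transform is [- zeta(s) / s], and [|s|^2 = 1/4 + v^2]. *)
Lemma zeta_sq v : v != 0 ->
  Normc.normc (zeta (2^-1 +i* v)%C) ^+ 2 =
  (4^-1 + v ^+ 2) * (J (fun w => phi w * cos (v * w)) ^+ 2 + J (fun w => phi w * sin (v * w)) ^+ 2).
Proof.
move=> vn.
have s0 : 0 < 4^-1 + v ^+ 2 by rewrite ltr_wpDr ?sqr_ge0.
have s4 : 1 + v ^+ 2 * 4 != 0 by rewrite gt_eqF // ltr_wpDr // mulr_ge0 // sqr_ge0.
have tb (a b x y : R) w : `|a| <= 1 -> `|b| <= 1 -> `|expR (w / 2) * (x * a + y * b) / (4^-1 + v ^+ 2)| <= (`|x| + `|y|) / (4^-1 + v ^+ 2) * expR (w / 2).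
  move=> a1 b1.
  rewrite 2!normrM normfV [`|expR _|]ger0_norm ?expR_ge0 // (gtr0_norm s0).
  rewrite [leRHS]mulrC -mulrA ler_pM2l ?expR_gt0 // ler_pM2r ?invr_gt0 //.
  by apply: le_trans (ler_normD _ _) _; rewrite !normrM lerD // ler_piMr.
have tz (K : R) : tends (fun n => K * expR ((- n%:R) / 2)) 0.
  have half : 0 < 2^-1 :> R by rewrite invr_gt0.
  apply: (tends_eq (tends_ext (tendsM (@tends_cst R K) (tends_expN half)) _)) => [n|]; last by rewrite mulr0.
  by congr (_ * expR _); ring.
pose FC w := expR (w / 2) * (v * sin (v * w) + 2^-1 * cos (v * w)) / (4^-1 + v ^+ 2).
pose FS w := expR (w / 2) * (2^-1 * sin (v * w) + (- v) * cos (v * w)) / (4^-1 + v ^+ 2).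
have HC : J (fun w => phi w * cos (v * w)) = G1 v 2^-1 + FC 0.
  apply: (@J_split (fun w => cos (v * w)) FC) => [|w|w|]; first exact: cos_cont1.
  - exact: cos_max.
  - rewrite /FC; apply: drv_eq; first by dauto.
    by rewrite /=; field; exact: s4.
  - apply: (tends_norm0 (v := fun n => _) _ (tz ((`|v| + `|2^-1|) / (4^-1 + v ^+ 2)))); apply: nearW => n.
    by apply: tb; [exact: sin_max|exact: cos_max].
have HS : J (fun w => phi w * sin (v * w)) = G2 v 2^-1 + FS 0.
  apply: (@J_split (fun w => sin (v * w)) FS) => [|w|w|]; first exact: sin_cont1.
  - exact: sin_max.
  - rewrite /FS; apply: drv_eq; first by dauto.
    by rewrite /=; field; exact: s4.
  - apply: (tends_norm0 (v := fun n => _) _ (tz ((`|2^-1| + `|- v|) / (4^-1 + v ^+ 2)))); apply: nearW => n.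
    by apply: tb; [exact: sin_max|exact: cos_max].
rewrite HC HS G1_half // G2_half // /FC /FS !mulr0 !mul0r expR0 sin0 cos0.
have -> : Normc.normc (zeta (2^-1 +i* v)%C) ^+ 2 = zr zeta v 2^-1 ^+ 2 + zi zeta v 2^-1 ^+ 2.
  rewrite /zr /zi; case: (zeta _) => a b /=.
  by rewrite sqr_sqrtr // addr_ge0 ?sqr_ge0.
by field; exact: s4.
Qed.
End zeta_series.

(** * Fourier inversion *)

Section convolution_transform.
Context {R : realType}.
Variables (a b : R -> R) (B : R).
Hypothesis ia : itg a.
Hypothesis ib : itg b.
Hypothesis bB : forall x, `|b x| <= B.
Variable v : R.

Let bC x : `|b x * cos (v * x)| <= B.
Proof. by rewrite normrM (le_trans _ (bB x)) // ler_piMr // cos_max. Qed.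

Let bS x : `|b x * sin (v * x)| <= B.
Proof. by rewrite normrM (le_trans _ (bB x)) // ler_piMr // sin_max. Qed.

Let iaC := itg_bcos v ia.
Let iaS := itg_bsin v ia.
Let ibC := itg_bcos v ib.
Let ibS := itg_bsin v ib.

Lemma J_conv_cos : J (fun u => J (fun w => a w * b (u - w)) * cos (v * u)) =
  J (fun w => a w * cos (v * w)) * J (fun w => b w * cos (v * w)) -
  J (fun w => a w * sin (v * w)) * J (fun w => b w * sin (v * w)).
Proof.
rewrite -(J_conv iaC ibC bC) -(J_conv iaS ibS bS) -JB; [|exact: itg_conv iaC ibC bC|exact: itg_conv iaS ibS bS].
apply: eq_J => u; rewrite mulrC -JZ; last exact: itg_conv_in ia ib bB u.
rewrite -JB; [|exact: itg_conv_in iaC ibC bC u|exact: itg_conv_in iaS ibS bS u].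
apply: eq_J => w.
have -> : v * u = v * w + v * (u - w) by ring.
by rewrite cosD; ring.
Qed.

Lemma J_conv_sin : J (fun u => J (fun w => a w * b (u - w)) * sin (v * u)) =
  J (fun w => a w * sin (v * w)) * J (fun w => b w * cos (v * w)) +
  J (fun w => a w * cos (v * w)) * J (fun w => b w * sin (v * w)).
Proof.
rewrite -(J_conv iaS ibC bC) -(J_conv iaC ibS bS) -JD; [|exact: itg_conv iaS ibC bC|exact: itg_conv iaC ibS bS].
apply: eq_J => u; rewrite mulrC -JZ; last exact: itg_conv_in ia ib bB u.
rewrite -JD; [|exact: itg_conv_in iaS ibC bC u|exact: itg_conv_in iaC ibS bS u].
apply: eq_J => w.
have -> : v * u = v * w + v * (u - w) by ring.
by rewrite sinD; ring.
Qed.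
End convolution_transform.

(** * Inversion by Abel summation *)

Section inversion.
Context {R : realType}.

Lemma cauchy_itg : itg (fun y : R => 2 / (1 + y ^+ 2)) /\ J (fun y : R => 2 / (1 + y ^+ 2)) = 2 * pi.
Proof.
have s0 (y : R) : 0 < 1 + y ^+ 2 by rewrite ltr_wpDr ?sqr_ge0.
pose F (y : R) := 2 * atan y.
have dF y : drv y F (2 / (1 + y ^+ 2)).
  have H : drv y atan (1 + y ^+ 2)^-1 by exact: is_derive1_atan.
  by apply: drv_eq (drvM (drv_cst y 2) H) _; rewrite mul0r add0r.
have cf : cont (fun y : R => 2 / (1 + y ^+ 2)).
  by apply: contM; [exact: cont_cst|apply: contV; [move=> y; rewrite gt_eqF|cauto]].
have iF : itg (fun y : R => 2 / (1 + y ^+ 2)).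
  apply: (itg_ftc (M := pi) dF cf) => y.
    by rewrite divr_ge0 // ltW.
  rewrite /F normrM ger0_norm // -ler_pdivlMl // mulrC ltW // ltr_norml.
  by rewrite atan_gtNpi2 atan_ltpi2.
split=> //.
have H : tends (fun n => atan n%:R) (pi / 2 : R) by exact: (cvg_comp _ _ (@cvgr_idn R) (@cvgy_atan R)).
have -> : 2 * pi = pi - (- pi) :> R by ring.
apply: (J_ftc dF cf iF).
  by apply: tends_eq (tendsM (@tends_cst R 2) H) _; field.
apply: (tends_eq (tends_ext (tendsN (tendsM (@tends_cst R 2) H)) _)) => [n|]; last by field.
by rewrite /F atanN mulrN.
Qed.

Variables (A : R -> R) (B : R).
Hypothesis cA : cont A.
Hypothesis AB : forall x, `|A x| <= B.
Hypothesis iA : itg A.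

Definition hat v := J (fun r => A r * cos (v * r)).

Let a0 n := @eps_gt0 R n.

(** The substitution [r = c + eps y] turns the kernel into the fixed density [2 / (1 + y^2)] of mass
    [2 pi], which also dominates. *)
Lemma tends_cauchy c : tends (fun n => J (fun r => A r * (2 * eps n / (eps n ^+ 2 + (r - c) ^+ 2)))) (2 * pi * A c).
Proof.
have [iC JC] := cauchy_itg.
have s0 (y : R) : 0 < 1 + y ^+ 2 by rewrite ltr_wpDr ?sqr_ge0.
have cf : cont (fun y : R => 2 / (1 + y ^+ 2)).
  by apply: contM; [exact: cont_cst|apply: contV; [move=> y; rewrite gt_eqF|cauto]].
have iE n : itg (fun r => A r * (2 * eps n / (eps n ^+ 2 + (r - c) ^+ 2))).
  have e0 := a0 n.
  apply: (itg_bddM (M := 2 / eps n) iA).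
    apply: continuous_meas; apply: contM; first exact: cont_cst.
    by apply: contV; [move=> y; rewrite gt_eqF // ltr_wpDr ?sqr_ge0 // exprn_gt0|cauto].
  move=> r; have p0 : 0 < eps n ^+ 2 + (r - c) ^+ 2 by rewrite ltr_wpDr ?sqr_ge0 // exprn_gt0.
  rewrite ger0_norm; last by rewrite divr_ge0 ?(ltW p0) // mulr_ge0 // ltW.
  by rewrite ler_pdivrMr // mulrAC ler_pdivlMr // -mulrA -expr2 ler_pM2l // lerDl sqr_ge0.
have E n : J (fun r => A r * (2 * eps n / (eps n ^+ 2 + (r - c) ^+ 2))) = J (fun y => A (eps n * y + c) * (2 / (1 + y ^+ 2))).
  have e0 := a0 n.
  rewrite -(J_shift c (iE n)).
  have := J_scale e0 (itg_shift c (iE n)) => /(congr1 (fun z => eps n * z)).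
  rewrite mulrA mulfV ?gt_eqF // mul1r => <-.
  rewrite -JZ; last exact: (itg_scale e0 (itg_shift c (iE n))).
  apply: eq_J => y; rewrite addrK mulrCA; congr (_ * _).
  have := s0 y; have := e0; move: (eps n) => e h1 h2; field.
  have -> : e ^+ 2 + (e * y) ^+ 2 = e ^+ 2 * (1 + y ^+ 2) by ring.
  by rewrite !gt_eqF // mulr_gt0 // exprn_gt0.
have [] // := @dct R (fun n y => A (eps n * y + c) * (2 / (1 + y ^+ 2))) (fun y => A c * (2 / (1 + y ^+ 2))) (fun y => B * (2 / (1 + y ^+ 2))).
- by move=> n; apply: continuous_meas; apply: contM cf; apply: cont_comp cA _; cauto.
- move=> y; apply: tendsM (@tends_cst R _); apply: (tends_cont cA).
  apply: tends_eq (tendsD (tendsM (@tends_eps R) (@tends_cst R y)) (@tends_cst R c)) _.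
  by rewrite mul0r add0r.
- exact: itgZ.
- move=> n y; rewrite normrM [X in _ * X]ger0_norm ?ler_wpM2r //; by rewrite divr_ge0 // ltW.
move=> _ H; apply: (tends_eq (tends_ext H _)) => [n|]; first by rewrite E.
by rewrite JZ // JC mulrC.
Qed.

Lemma hat_meas : measurable_fun setT hat.
Proof.
apply: continuous_meas => x.
apply: (@continuity_under_integral R _ _ (@lebesgue_measure R) (fun v r => A r * cos (v * r)) setT measurableT (x - 1) (x + 1) _ _ (fun r => `|A r|)).
- by move=> v _; exact: itg_bcos.
- apply: aeW => r _ v _.
  have : cont (fun v => A r * cos (v * r)) by cauto.
  exact.
- exact: itg_norm.
- by move=> v _; apply: aeW => r _; rewrite normrM ler_piMr // cos_max.
- rewrite inE /= in_itv /=; lra.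
Qed.

(** The transform of [e^(-eps |v|)] is the kernel of [tends_cauchy]. The product of the two cosines
    splits into a sum and a difference, hence the mean over [c] and [- c]. *)
Lemma abel n c : J (fun v => expR (- (eps n * `|v|)) * cos (c * v) * hat v) =
  2^-1 * (J (fun r => A r * (2 * eps n / (eps n ^+ 2 + (r - c) ^+ 2))) +
          J (fun r => A r * (2 * eps n / (eps n ^+ 2 + (r - - c) ^+ 2)))).
Proof.
have e0 := a0 n.
have mK : measurable_fun setT (fun p : R * R => cos (p.1 * p.2)).
  apply: measurableT_comp (continuous_meas (cont_cos (@cont_id R))) _.
  exact: measurable_funM.
have KC (p : R * R) : `|cos (p.1 * p.2)| <= 1 by exact: cos_max.
rewrite (J_swap (cos_itg_expN c e0) iA mK KC) /=.
have iE d : itg (fun r => A r * (2 * eps n / (eps n ^+ 2 + (r - d) ^+ 2))).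
  apply: (itg_bddM (M := 2 / eps n) iA).
    apply: continuous_meas; apply: contM; first exact: cont_cst.
    by apply: contV; [move=> y; rewrite gt_eqF // ltr_wpDr ?sqr_ge0 // exprn_gt0|cauto].
  move=> r; have p0 : 0 < eps n ^+ 2 + (r - d) ^+ 2 by rewrite ltr_wpDr ?sqr_ge0 // exprn_gt0.
  rewrite ger0_norm; last by rewrite divr_ge0 ?(ltW p0) // mulr_ge0 // ltW.
  by rewrite ler_pdivrMr // mulrAC ler_pdivlMr // -mulrA -expr2 ler_pM2l // lerDl sqr_ge0.
rewrite -JD // -JZ; last exact: itgD.
apply: eq_J => r.
rewrite -mulrDr mulrCA; congr (_ * _).
rewrite -(J_expN_cos (r - c) e0) -(J_expN_cos (r - - c) e0) -JD; try exact: cos_itg_expN.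
rewrite -JZ; last by apply: itgD; exact: cos_itg_expN.
apply: eq_J => v.
have -> : (r - c) * v = v * r - c * v by ring.
have -> : (r - - c) * v = v * r + c * v by ring.
by rewrite cosB cosD; field.
Qed.

Hypothesis Aeven : forall r, A (- r) = A r.
Hypothesis hat_ge0 : forall v, 0 <= hat v.

Lemma tends_abel c : tends (fun n => J (fun v => expR (- (eps n * `|v|)) * cos (c * v) * hat v)) (2 * pi * A c).
Proof.
apply: (tends_eq (tends_ext (tendsM (@tends_cst R 2^-1) (tendsD (@tends_cauchy c) (@tends_cauchy (- c)))) _)) => [n|].
  by rewrite abel.
by rewrite Aeven; field.
Qed.

Let hat_bound v : `|hat v| <= J (fun r => `|A r|).
Proof.
apply: le_trans (norm_J (itg_bcos v iA)) _; apply: le_J.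
- by apply: itg_norm; exact: itg_bcos.
- exact: itg_norm.
- by move=> r; rewrite normrM ler_piMr // cos_max.
Qed.

Let iabel n : itg (fun v => expR (- (eps n * `|v|)) * hat v).
Proof.
by apply: (itg_bddM (itg_expN (a0 n)) hat_meas); exact: hat_bound.
Qed.

(** Nonnegativity upgrades Abel summability at [c = 0] to integrability: the damped integrals
    increase to the integral of [hat] by monotone convergence and tend to the finite value
    [2 pi A(0)]. *)
Lemma itg_hat : itg hat.
Proof.
apply/integrableP; split; first by apply/measurable_EFinP; exact: hat_meas.
have -> : (\int[lebesgue_measure]_v `|(EFin \o hat) v| = \int[lebesgue_measure]_v (hat v)%:E)%E.
  by apply: eq_integral => v _; rewrite /= ger0_norm.
pose f n v := (expR (- (eps n * `|v|)) * hat v)%:E : \bar R.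
have mf n : measurable_fun setT (f n) by apply/measurable_EFinP; exact: itg_meas (iabel n).
have f0 n v : setT v -> (0 <= f n v)%E by move=> _; rewrite lee_fin mulr_ge0 ?expR_ge0.
have ndf v : setT v -> {homo f^~ v : n m / (n <= m)%N >-> (n <= m)%E}.
  move=> _ n m nm; rewrite lee_fin ler_wpM2r // ler_expR lerN2 ler_wpM2r //.
  by rewrite lef_pV2 ?posrE // ler_nat !ltnS.
have H := @cvg_monotone_convergence _ _ R (@lebesgue_measure R) setT measurableT f mf f0 ndf.
have limf v : limn (f^~ v) = (hat v)%:E.
  apply/cvg_lim => //; apply: cvg_EFin; first exact: nearW.
  rewrite -[X in _ --> X]mul1r; apply: (@tendsM R _ _ 1) (@tends_cst R _).
  apply: (tends_eq (tends_exp (tendsN (tendsM (@tends_eps R) (@tends_cst R `|v|)))) _).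
  by rewrite mul0r oppr0 expR0.
have -> : (\int[lebesgue_measure]_v (hat v)%:E = \int[lebesgue_measure]_v limn (f^~ v))%E by apply: eq_integral => v _; rewrite limf.
rewrite -(cvg_lim _ H) //.
have H0 := @tends_abel 0.
have E n : (\int[lebesgue_measure]_v f n v = (J (fun v => expR (- (eps n * `|v|)) * cos (0 * v) * hat v))%:E)%E.
  rewrite -J_EFin; last by have := iabel n; congr itg; apply/funext => v; rewrite mul0r cos0 mulr1.
  by apply: eq_integral => v _; rewrite mul0r cos0 mulr1.
have -> : limn (fun n => \int[lebesgue_measure]_v f n v)%E = (2 * pi * A 0)%:E.
  apply/cvg_lim => //; under eq_fun do rewrite E.
  by apply: cvg_EFin; [exact: nearW|exact: H0].
exact: ltry.
Qed.

Lemma fourier_inversion c : J (fun v => cos (c * v) * hat v) = 2 * pi * A c.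
Proof.
have [] // := @dct R (fun n v => expR (- (eps n * `|v|)) * cos (c * v) * hat v) (fun v => cos (c * v) * hat v) hat.
- move=> n; apply: measurable_funM hat_meas; apply: continuous_meas; cauto.
- move=> v; apply: (@tendsM R _ _ _ _ _ (@tends_cst R _)).
  rewrite -[X in tends _ X]mul1r; apply: tendsM (@tends_cst R _).
  apply: (tends_eq (tends_exp (tendsN (tendsM (@tends_eps R) (@tends_cst R `|v|)))) _).
  by rewrite mul0r oppr0 expR0.
- exact: itg_hat.
- move=> n v; rewrite !normrM (ger0_norm (hat_ge0 v)) ler_piMl // mulr_ile1 ?cos_max //.
  rewrite ger0_norm ?expR_ge0 // -[leRHS]expR0 ler_expR oppr_le0 mulr_ge0 // ltW //.
by move=> _ H; exact: (tends_unique H (@tends_abel c)).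
Qed.
End inversion.

(** * The mean square of zeta as an integral of digamma functions *)

Section autocorrelation.
Context {R : realType}.
Implicit Types (u v w : R).

Definition g u : R := expR (u / 2) * (psi (1 + expR u) - u).

(** In the variables [x = e^u], [y = e^w] the product is [frac(y) sqrt x y / (x + y)^2], a rational
    kernel with elementary primitives against both [dw] and [y dw]. *)
Lemma phi_kern u w : phi w * kern (u - w) = fr w * (expR (u / 2) * (expR w / (expR u + expR w) ^+ 2)).
Proof.
rewrite /phi kernE /cosh.
have -> : expR (- ((u - w) / 2)) = expR (w / 2) / expR (u / 2) by rewrite -expRB; congr expR; ring.
have -> : expR ((u - w) / 2) = expR (u / 2) / expR (w / 2) by rewrite -expRB; congr expR; ring.
have -> : expR (- (w / 2)) = (expR (w / 2))^-1 by rewrite expRN.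
have -> : expR w = expR (w / 2) ^+ 2 by rewrite -expRM_natr; congr expR; field.
have -> : expR u = expR (u / 2) ^+ 2 by rewrite -expRM_natr; congr expR; field.
have := expR_gt0 (w / 2); have := expR_gt0 (u / 2).
move: (expR (w / 2)) (expR (u / 2)) => b a a0 b0; field.
have h : 0 < a ^+ 2 + b ^+ 2 by rewrite addr_gt0 ?exprn_gt0.
by rewrite !gt_eqF.
Qed.

(** On [[-n, ln (n + 1)]] the rule [J_fr] evaluates the convolution exactly; the sum over jumps is
    the partial sum of [psi (1 + x)], and the boundary terms leave [- ln x]. *)
Lemma gE u : J (fun w => phi w * kern (u - w)) = g u.
Proof.
have [x Ex] : exists x, x = expR u by exists (expR u).
have x0 : 0 < x by rewrite Ex expR_gt0.
have s0 w : 0 < x + expR w by rewrite addr_gt0 ?expR_gt0.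
pose a := expR (u / 2).
pose B w := a * (expR w / (x + expR w) ^+ 2).
pose F0 w := - a / (x + expR w).
pose F1 w := a * (ln (x + expR w) + x / (x + expR w)).
have cB : cont B.
  by rewrite /B; apply: contM; [exact: cont_cst|apply: contM; [exact: continuous_expR|apply: contV; [move=> w; rewrite gt_eqF // exprn_gt0 ?s0|cauto]]].
have d0 w : drv w F0 (B w).
  rewrite /F0 /B; apply: drv_eq.
    by apply: drvM; [exact: drv_cst|apply: drvV; [rewrite gt_eqF|dauto]].
  by have := s0 w; move: (expR w) => y y0; rewrite /=; field; rewrite gt_eqF.
have d1 w : drv w F1 (expR w * B w).
  rewrite /F1 /B; apply: drv_eq.
    apply: drvM; [exact: drv_cst|apply: drvD; [apply: drv_ln; [exact: s0|dauto]|]].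
    by apply: drvM; [exact: drv_cst|apply: drvV; [rewrite gt_eqF|dauto]].
  by have := s0 w; move: (expR w) => y y0; rewrite /=; field; rewrite gt_eqF.
have iphi : itg (fun w => phi w * kern (u - w)).
  exact: (itg_conv_in (@itg_phi R) (@itg_kern R) (@kern_le R)).
have e w : phi w * kern (u - w) = fr w * B w by rewrite phi_kern /B Ex.
have L := @J_lim R _ (fun n => - n%:R) (fun n => ln n.+1%:R) iphi.
have V n : J ((fun w => phi w * kern (u - w)) \_ `[- n%:R, ln n.+1%:R]) =
  a * (ln (1 + x + (n + 0)%:R) - \sum_(0 <= k < n.+1) (1 + x + k%:R)^-1 + 1 - (ln (x + expR (- n%:R)) + x / (x + expR (- n%:R)))).
  rewrite (_ : (fun w => phi w * kern (u - w)) = (fun w => fr w * B w)); last by apply/funext.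
  rewrite (J_fr n _ cB d0 d1) ?oppr_le0 // sumrB sumr_const_nat subn0.
  rewrite /F1 lnK ?posrE // addn0.
  have -> : \sum_(0 <= j < n.+1) F0 (ln j.+1%:R) = - a * \sum_(0 <= k < n.+1) (1 + x + k%:R)^-1.
    rewrite mulr_sumr; apply: eq_bigr => j _; rewrite /F0 lnK ?posrE //.
    by congr (_ / _); rewrite -natr1; ring.
  have -> : x + n.+1%:R = 1 + x + n%:R by rewrite -natr1; ring.
  have -> : F0 (ln n.+1%:R) *+ n.+1 = - a * (1 + n%:R) / (1 + x + n%:R).
    rewrite /F0 lnK ?posrE // -[_ *+ n.+1]mulr_natr -[n.+1%:R]natr1.
    have -> : x + (n%:R + 1) = 1 + x + n%:R by ring.
    by ring.
  have p0 : 0 < 1 + x + n%:R by apply: addnat_gt0; rewrite addr_gt0.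
  have y0 := s0 (- n%:R); move: y0 p0.
  move: (ln (1 + x + n%:R)) => l; move: (ln (x + expR (- n%:R))) => l'; move: (\sum_(_ <= _ < _) _) => S.
  move: (expR (- n%:R)) => y; move: (n%:R : R) => N y0 p0.
  by field; rewrite !gt_eqF.
have x1 : 0 < 1 + x by rewrite addr_gt0.
have E0 : tends (fun n => expR (- n%:R)) (0 : R).
  by apply: (tends_ext (@tends_expN R 1 ltr01)) => n; rewrite mul1r.
have E1 : tends (fun n => x + expR (- n%:R)) x by apply: tends_eq (tendsD (@tends_cst R x) E0) (addr0 _).
have xn : x != 0 by rewrite gt_eqF.
have E2 := tendsD (tends_at (continuous_ln x0) E1) (tendsM (@tends_cst R x) (tendsV xn E1)).
have E3 := tendsM (@tends_cst R a) (tendsB (tendsD (@tends_harm_ln R (1 + x) 0 x1) (@tends_cst R 1)) E2).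
have L' : (fun n => J ((fun w => phi w * kern (u - w)) \_ `[- n%:R, ln n.+1%:R])) @ \oo --> J (fun w => phi w * kern (u - w)).
  apply: L => w; near=> n; rewrite in_itv /=; apply/andP; split.
    by rewrite lerNl; near: n; exact: nbhs_infty_ger.
  by near: n; exact: tends_ln_nat.
rewrite (tends_unique (tends_ext L' V) E3) divff // /g -Ex {2}Ex expRK /a; ring.
Unshelve. all: by end_near. Qed.

Lemma itg_g : itg g.
Proof.
have -> : g = (fun u => J (fun w => phi w * kern (u - w))) by apply/funext => u; rewrite gE.
exact: itg_conv (@itg_phi R) (@itg_kern R) (@kern_le R).
Qed.

Lemma g_cont : cont g.
Proof.
have -> : g = (fun u => J (fun w => phi w * kern (u - w))) by apply/funext => u; rewrite gE.
exact: conv_cont (@itg_phi R) (@kern_cont R) (@kern_le R).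
Qed.

Lemma g_bound u : `|g u| <= 2 * J (fun w => `|phi w|).
Proof.
rewrite -gE.
have i := itg_conv_in (@itg_phi R) (@itg_kern R) (@kern_le R) u.
apply: le_trans (norm_J i) _.
rewrite -JZ; last by apply: itg_norm; exact: itg_phi.
apply: le_J; [exact: itg_norm|by apply: itgZ; apply: itg_norm; exact: itg_phi|move=> w].
by rewrite normrM mulrC ler_wpM2r // kern_le.
Qed.

Lemma g_transform v : J (fun u => g u * cos (v * u)) ^+ 2 + J (fun u => g u * sin (v * u)) ^+ 2 =
  (J (fun w => phi w * cos (v * w)) ^+ 2 + J (fun w => phi w * sin (v * w)) ^+ 2) *
  (pi ^+ 2 * (4^-1 + v ^+ 2) / cosh (pi * v) ^+ 2).
Proof.
have hc := J_conv_cos (@itg_phi R) (@itg_kern R) (@kern_le R) v.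
have hs := J_conv_sin (@itg_phi R) (@itg_kern R) (@kern_le R) v.
have -> : J (fun u => g u * cos (v * u)) = J (fun u => J (fun w => phi w * kern (u - w)) * cos (v * u)) by apply: eq_J => u; rewrite gE.
have -> : J (fun u => g u * sin (v * u)) = J (fun u => J (fun w => phi w * kern (u - w)) * sin (v * u)) by apply: eq_J => u; rewrite gE.
rewrite hc hs J_kern_cos J_kern_sin.
have := cosh_gt0 (pi * v).
by move: (cosh _) (J _) (J _) => c P Q c0; field; rewrite gt_eqF.
Qed.

Definition acor u : R := J (fun w => g w * g (w - u)).

Let gm_bound r : `|g (- r)| <= 2 * J (fun w => `|phi w|).
Proof. exact: g_bound. Qed.

Let igm : itg (fun r => g (- r)).
Proof. exact: itg_opp itg_g. Qed.

Let acorE : acor = (fun u => J (fun w => g w * g (- (u - w)))).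
Proof. by apply/funext => u; apply: eq_J => w; rewrite opprB. Qed.

Lemma itg_acor : itg acor.
Proof. by rewrite acorE; exact: (itg_conv itg_g igm gm_bound). Qed.

Lemma acor_cont : cont acor.
Proof.
rewrite acorE; apply: (conv_cont itg_g (b := fun r => g (- r)) _ gm_bound).
by apply: (@cont_comp _ g (fun r => - r) g_cont); exact: contN (@cont_id R).
Qed.

Let igg u : itg (fun w => g w * g (w - u)).
Proof.
apply: (itg_bddM itg_g); last by move=> w; exact: g_bound.
by apply: continuous_meas; apply: cont_comp g_cont _; cauto.
Qed.

Lemma acor_bound u : `|acor u| <= 2 * J (fun w => `|phi w|) * J (fun w => `|g w|).
Proof.
apply: le_trans (norm_J (igg u)) _.
rewrite -JZ; last by apply: itg_norm; exact: itg_g.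
apply: le_J; [exact: itg_norm|by apply: itgZ; apply: itg_norm; exact: itg_g|move=> w].
by rewrite normrM mulrC ler_wpM2r // g_bound.
Qed.

Lemma acorN u : acor (- u) = acor u.
Proof.
rewrite /acor -(J_shift u (igg u)); apply: eq_J => w.
by rewrite addrK mulrC opprK.
Qed.

(** The autocorrelation is the convolution of [g] with its reflection, whose transform is the
    complex conjugate. *)
Lemma hat_acor v : hat acor v = J (fun u => g u * cos (v * u)) ^+ 2 + J (fun u => g u * sin (v * u)) ^+ 2.
Proof.
rewrite /hat acorE (J_conv_cos itg_g igm gm_bound v).
have -> : J (fun w => g (- w) * cos (v * w)) = J (fun w => g w * cos (v * w)).
  rewrite -(J_opp (itg_bcos v itg_g)); apply: eq_J => w; by rewrite mulrN cosN.
have -> : J (fun w => g (- w) * sin (v * w)) = - J (fun w => g w * sin (v * w)).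
  rewrite -(J_opp (itg_bsin v itg_g)) -mulN1r -JZ; last exact: (itg_opp (itg_bsin v itg_g)).
  by apply: eq_J => w; rewrite mulrN sinN; ring.
ring.
Qed.

Lemma hat_acor_ge0 v : 0 <= hat acor v.
Proof. by rewrite hat_acor addr_ge0 ?sqr_ge0. Qed.

Definition energy u : R := expR u * ((psi (1 + expR u) - u) ^+ 2 - (psi (2^-1 + expR u) - u) ^+ 2).

Lemma exp_half_ln2 : expR (ln 2 / 2) = Num.sqrt 2 :> R.
Proof.
have E : expR (ln 2 / 2) ^+ 2 = 2 :> R.
  by rewrite -expRM_natr (_ : ln 2 / 2 * 2%:R = ln 2) ?lnK ?posrE //; field.
by rewrite -[in RHS]E sqrtr_sqr ger0_norm ?expR_ge0.
Qed.

(** The identity [a^2 - b^2 = 4 a c - 4 c^2] given by duplication; the factors [sqrt 2] come from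
    [e^((u + ln 2) / 2)] in [g (u + ln 2)]. *)
Lemma energyE u : energy u = 2 * Num.sqrt 2 * (g u * g (u + ln 2)) - 2 * g (u + ln 2) ^+ 2.
Proof.
have x0 := expR_gt0 u.
have H := psi_double x0.
have e2 : expR (u + ln 2) = 2 * expR u by rewrite expRD lnK ?posrE // mulrC.
have e3 : expR ((u + ln 2) / 2) = expR (u / 2) * Num.sqrt 2 by rewrite -exp_half_ln2 -expRD; congr expR; ring.
have e4 : expR u = expR (u / 2) ^+ 2 by rewrite -expRM_natr; congr expR; field.
have s2 : Num.sqrt 2 ^+ 2 = 2 :> R by rewrite sqr_sqrtr.
rewrite /energy /g e3 e2 [1 + 2 * _]addrC [1 + _]addrC [2^-1 + _]addrC.
have -> : psi (2 * expR u + 1) = (2 * ln 2 + psi (expR u + 2^-1) + psi (expR u + 1)) / 2 by rewrite -H; field.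
rewrite e4; move: (psi (_ + 2^-1)) => q; move: (psi (_ + 1)) => p.
move: (expR (u / 2)) (ln 2) (Num.sqrt 2) s2 => a l s s2.
transitivity (2 * s ^+ 2 * (a ^+ 2 * (p - u) * ((2 * l + q + p) / 2 - (u + l))) - 2 * s ^+ 2 * (a * ((2 * l + q + p) / 2 - (u + l))) ^+ 2); last by ring.
by rewrite s2; field.
Qed.

Lemma itg_energy : itg energy /\ J energy = 2 * (Num.sqrt 2 * acor (ln 2) - acor 0).
Proof.
have i1 : itg (fun u => g u * g (u + ln 2)).
  by have := igg (- ln 2); under eq_fun do rewrite opprK.
have i2 : itg (fun u => g (u + ln 2) ^+ 2).
  have := itg_shift (ln 2) (igg 0); congr itg; apply/funext => u.
  by rewrite subr0 expr2.
have -> : energy = (fun u => 2 * Num.sqrt 2 * (g u * g (u + ln 2)) - 2 * g (u + ln 2) ^+ 2) by apply/funext => u; exact: energyE.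
split; first by apply: itgB; exact: itgZ.
rewrite JB ?JZ //; try exact: itgZ.
have -> : J (fun u => g u * g (u + ln 2)) = acor (ln 2).
  by rewrite -acorN; apply: eq_J => u; rewrite opprK.
have -> : J (fun u => g (u + ln 2) ^+ 2) = acor 0.
  rewrite /acor -(J_shift (ln 2) (igg 0)); apply: eq_J => u; by rewrite subr0 expr2.
ring.
Qed.

(** The two shifts of [fourier_inversion] produce [sqrt 2 acor(ln 2) - acor(0)]. The formula for
    [|zeta|^2] is available for [v != 0] only, since the line [Im s = 0] meets the pole; that point
    is removed as a null set. *)
Lemma parseval (zeta : R[i]^o -> R[i]^o) : is_riemann_zeta zeta ->
  (\int[lebesgue_measure]_v
     (Normc.normc (zeta (2^-1 +i* v)%C) ^+ 2
        * (Num.sqrt 2 * cos (v * ln 2) - 1) / cosh (pi * v) ^+ 2)%:E = (pi^-1 * J energy)%:E)%E.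
Proof.
move=> zP.
pose k v := pi ^- 2 * (Num.sqrt 2 * (cos (ln 2 * v) * hat acor v) - cos (0 * v) * hat acor v).
have ih : itg (hat acor) := itg_hat acor_cont acor_bound itg_acor acorN hat_acor_ge0.
have ic c : itg (fun v => cos (c * v) * hat acor v).
  by have := itg_bcos c ih; congr itg; apply/funext => v; rewrite mulrC.
have ik : itg k by apply: itgZ; apply: itgB; [exact: itgZ|exact: ic].
have p0 : 0 < pi :> R by exact: pi_gt0.
have cs v : 0 < cosh (pi * v) by exact: cosh_gt0.
have E v : v != 0 -> Normc.normc (zeta (2^-1 +i* v)%C) ^+ 2 * (Num.sqrt 2 * cos (v * ln 2) - 1) / cosh (pi * v) ^+ 2 = k v.
  move=> vn; rewrite (zeta_sq zP vn) /k hat_acor g_transform mul0r cos0 [ln 2 * v]mulrC.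
  have := cs v; move: (cosh _) (J _ ^+ 2 + _) (Num.sqrt 2) (cos _) => c S s q c0.
  move: (4^-1 + v ^+ 2) => A; move: (pi) p0 => p p0; field.
  by rewrite (gt_eqF p0) (gt_eqF c0).
have mk : measurable_fun setT (EFin \o k) by apply/measurable_EFinP; exact: itg_meas ik.
have -> : (\int[lebesgue_measure]_v
     (Normc.normc (zeta (2^-1 +i* v)%C) ^+ 2
        * (Num.sqrt 2 * cos (v * ln 2) - 1) / cosh (pi * v) ^+ 2)%:E = \int[lebesgue_measure]_v (k v)%:E)%E.
  have mD : measurable ([set: R] `\ 0) by exact: measurableD.
  rewrite -(@integral_setD1 R _ 0 setT mD); last first.
    apply: (eq_measurable_fun (EFin \o k)); last exact: measurable_funTS mk.
    by move=> v; rewrite inE => -[_ /eqP vn]; rewrite /= E.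
  rewrite -[RHS](@integral_setD1 R _ 0 setT mD); last exact: measurable_funTS mk.
  by apply: eq_integral => v; rewrite inE => -[_ /eqP vn]; rewrite E.
rewrite (J_EFin ik) /k JZ; last by apply: itgB; [exact: itgZ|exact: ic].
rewrite JB; [|apply: itgZ; exact: ic|exact: ic]; rewrite JZ; last exact: ic.
rewrite !(fourier_inversion acor_cont acor_bound itg_acor acorN hat_acor_ge0) itg_energy.2.
by congr (_%:E); move: (pi) p0 => p p0; field; rewrite (gt_eqF p0).
Qed.
End autocorrelation.

(** * The Mellin transform of the digamma difference *)

Section psi_difference.
Context {R : realType}.
Implicit Types (u w a e : R).

(** With [x = e^u] this is [x p(x)]; the two functions below are [tanh (t / 4)] and [e^(-t / 2)] at
    [t = e^w]. *)
Definition xp u : R := expR u * (psi (1 + expR u) - psi (2^-1 + expR u)).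
Definition tnh w : R := sinh (expR w / 4) / cosh (expR w / 4).
Definition zed w : R := expR (- (expR w / 2)).

Lemma zed_gt0 w : 0 < zed w. Proof. exact: expR_gt0. Qed.
Lemma zed_lt1 w : zed w < 1.
Proof. by rewrite /zed expR_lt1 oppr_lt0 divr_gt0 // expR_gt0. Qed.

Lemma tnhE w : tnh w = 1 - 2 * (zed w / (1 + zed w)).
Proof.
have z0 := zed_gt0 w.
rewrite /tnh /sinh /cosh.
have -> : expR (- (expR w / 4)) = zed w * expR (expR w / 4) by rewrite /zed -expRD; congr expR; field.
have := expR_gt0 (expR w / 4); move: (expR (expR w / 4)) (zed w) z0 => a z z0 a0.
have h1 : 0 < 1 + z by rewrite addr_gt0.
have h2 : 0 < a + z * a by rewrite addr_gt0 ?mulr_gt0.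
by field; rewrite !gt_eqF.
Qed.

Lemma tnh_ge0 w : 0 <= tnh w.
Proof.
have y0 : 0 <= expR w / 4 by rewrite divr_ge0 // expR_ge0.
by rewrite divr_ge0 // ?sinh_ge0 // ltW // cosh_gt0.
Qed.

Lemma tnh_le1 w : tnh w <= 1.
Proof.
have z0 := zed_gt0 w; rewrite tnhE gerBl mulr_ge0 // divr_ge0 ?(ltW z0) //.
by rewrite addr_ge0 // ltW.
Qed.

Lemma tnh_le w : tnh w <= expR w / 4.
Proof.
have y0 : 0 <= expR w / 4 by rewrite divr_ge0 // expR_ge0.
rewrite /tnh ler_pdivrMr ?cosh_gt0 //.
have := sinh_bound (expR w / 4); rewrite (ger0_norm y0); apply: le_trans; exact: ler_norm.
Qed.

Lemma tnh_cont : cont tnh.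
Proof.
have c4 : cont (fun w : R => expR w / 4) by apply: contM; [exact: continuous_expR|exact: cont_cst].
rewrite /tnh; apply: contM; first exact: sinh_cont.
by apply: contV; [move=> w; rewrite gt_eqF // cosh_gt0|exact: cosh_cont].
Qed.

(** With [x = e^u] and [t = e^w] this is the integral of [x e^(-(x + a) t)] over [t > 0]; the added
    exponent [a] amounts to a translation of [gam_int 1]. *)
Lemma J_gexp u a : 0 <= a ->
  itg (fun w => expR (- (a * expR w)) * gam_int 1 (w + u)) /\
  J (fun w => expR (- (a * expR w)) * gam_int 1 (w + u)) = expR u / (expR u + a).
Proof.
move=> a0; have s0 : 0 < expR u + a by rewrite ltr_wpDr // expR_gt0.
have E : (fun w => expR (- (a * expR w)) * gam_int 1 (w + u)) =
  (fun w => expR u / (expR u + a) * gam_int 1 (w + ln (expR u + a))).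
  apply/funext => w.
  have gE r : gam_int 1 r = expR r * expR (- expR r) by rewrite /gam_int mul1r expRD.
  rewrite !gE ![expR (w + _)]expRD lnK // mulrDr opprD [expR (- _ - _)]expRD [a * _]mulrC.
  by field; rewrite gt_eqF.
have i := itg_shift (ln (expR u + a)) (itg_gam (@ltr01 R)).
rewrite E; split; first exact: itgZ.
by rewrite JZ // (J_shift _ (itg_gam (@ltr01 R))) -gamE gam1 mulr1.
Qed.

Lemma gam_int_ge0 e u : 0 <= gam_int e u.
Proof. exact: expR_ge0. Qed.

(** The Laplace representation of [p]: expanding [z / (1 + z)] in powers of [z = e^(-t/2)] gives
    terms [1 / (x + k/2)] with alternating signs. Consecutive ones are paired so that each pair is a
    difference of terms of the two digamma series. *)
Lemma J_zed u : itg (fun w => zed w / (1 + zed w) * gam_int 1 (w + u)) /\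
  J (fun w => zed w / (1 + zed w) * gam_int 1 (w + u)) = xp u.
Proof.
have x0 := expR_gt0 u.
have iG : itg (fun w => gam_int 1 (w + u)) := itg_shift u (itg_gam (@ltr01 R)).
pose S N w := \sum_(0 <= j < N) (zed w ^+ (j.*2.+1) - zed w ^+ (j.*2.+2)).
have SE N w : S N w = zed w / (1 + zed w) * (1 - (zed w ^+ 2) ^+ N).
  have z0 := zed_gt0 w; have z1 : 1 + zed w != 0 by rewrite gt_eqF // addr_gt0.
  rewrite /S; elim: N => [|N ih]; first by rewrite big_geq // expr0 subrr mulr0.
  have e : zed w ^+ N.*2 = (zed w ^+ 2) ^+ N by rewrite -exprM mul2n.
  have e1 : zed w ^+ N.*2.+1 = zed w * (zed w ^+ 2) ^+ N by rewrite exprS e.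
  have e2 : zed w ^+ N.*2.+2 = zed w ^+ 2 * (zed w ^+ 2) ^+ N by rewrite -addn2 exprD e mulrC.
  rewrite big_nat_recr //= ih e1 e2 [_ ^+ N.+1]exprS.
  by move: ((zed w ^+ 2) ^+ N) => t; field.
have zw w : 0 < zed w / (1 + zed w) by rewrite divr_gt0 ?addr_gt0 ?zed_gt0.
have cz : cont zed.
  by rewrite /zed; apply: cont_exp; apply: contN; apply: contM; [exact: continuous_expR|exact: cont_cst].
have mG : measurable_fun setT (fun w => gam_int 1 (w + u)) := itg_meas iG.
have pw (k : nat) w : zed w ^+ k = expR (- (k%:R / 2 * expR w)).
  by rewrite /zed -expRM_natr; congr expR; ring.
have [] // := @dct R (fun N w => S N w * gam_int 1 (w + u)) (fun w => zed w / (1 + zed w) * gam_int 1 (w + u)) (fun w => gam_int 1 (w + u)).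
- move=> N; apply: measurable_funM mG; apply: continuous_meas.
  rewrite (_ : S N = (fun w => zed w / (1 + zed w) * (1 - (zed w ^+ 2) ^+ N))); last by apply/funext => w; exact: SE.
  apply: contM; last by cauto.
  by apply: contM => //; apply: contV; [move=> w; rewrite gt_eqF // addr_gt0 ?zed_gt0|cauto].
- move=> w; apply: tendsM (@tends_cst R _).
  have H : tends (fun N => (zed w ^+ 2) ^+ N) 0.
    apply: cvg_expr; rewrite ger0_norm ?exprn_ge0 ?(ltW (zed_gt0 _)) //.
    by rewrite exprn_ilt1 ?zed_lt1 // ltW // zed_gt0.
  apply: (tends_eq (tends_ext (tendsM (@tends_cst R (zed w / (1 + zed w))) (tendsB (@tends_cst R 1) H)) _)) => [N|]; first by rewrite SE.
  by rewrite subr0 mulr1.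
- move=> N w; rewrite normrM [X in _ * X]ger0_norm ?gam_int_ge0 // ler_piMl ?gam_int_ge0 //.
  have t0 : 0 <= (zed w ^+ 2) ^+ N by rewrite !exprn_ge0 // ltW // zed_gt0.
  have t1 : (zed w ^+ 2) ^+ N <= 1 by rewrite !exprn_ile1 ?exprn_ge0 // ltW // ?zed_lt1 ?zed_gt0.
  rewrite SE ger0_norm; last by rewrite mulr_ge0 ?(ltW (zw _)) // subr_ge0.
  rewrite mulr_ile1 ?(ltW (zw _)) ?subr_ge0 // ?gerBl //.
  by rewrite ler_pdivrMr ?addr_gt0 ?zed_gt0 // mul1r lerDr.
move=> h1 h2; split=> //; apply: (tends_unique h2).
have p1 : 0 < 1 + expR u by rewrite addr_gt0.
have p2 : 0 < 2^-1 + expR u by rewrite addr_gt0.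
apply: (tends_eq (tends_ext (tendsM (@tends_cst R (expR u)) (tendsB (tends_psi p1) (tends_psi p2))) _)) => [N|//].
have iF j : itg (fun w => (zed w ^+ (j.*2.+1) - zed w ^+ (j.*2.+2)) * gam_int 1 (w + u)).
  have -> : (fun w => (zed w ^+ (j.*2.+1) - zed w ^+ (j.*2.+2)) * gam_int 1 (w + u)) = (fun w => expR (- (j.*2.+1%:R / 2 * expR w)) * gam_int 1 (w + u) - expR (- (j.*2.+2%:R / 2 * expR w)) * gam_int 1 (w + u)).
    by apply/funext => w; rewrite !pw mulrBl.
  by apply: itgB; apply J_gexp; rewrite divr_ge0.
have -> : J (fun w => S N w * gam_int 1 (w + u)) = \sum_(0 <= j < N) J (fun w => (zed w ^+ (j.*2.+1) - zed w ^+ (j.*2.+2)) * gam_int 1 (w + u)).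
  by rewrite -(J_sum N iF).2; apply: eq_J => w; rewrite mulr_suml.
have e0 (L a b : R) : L - a - (L - b) = b - a by ring.
rewrite e0 -sumrB mulr_sumr; apply: eq_bigr => j _.
under eq_J do rewrite !pw mulrBl.
have k1 : 0 <= j.*2.+1%:R / 2 :> R by rewrite divr_ge0.
have k2 : 0 <= j.*2.+2%:R / 2 :> R by rewrite divr_ge0.
rewrite JB ?(J_gexp u k1).1 ?(J_gexp u k2).1 //.
have d1 : j.*2.+1%:R = 2 * j%:R + 1 :> R by rewrite -addn1 natrD -muln2 natrM mulrC.
have d2 : j.*2.+2%:R = 2 * j%:R + 2 :> R by rewrite -addn2 natrD -muln2 natrM mulrC.
rewrite (J_gexp u k1).2 (J_gexp u k2).2 d1 d2.
have : 0 <= j%:R :> R by [].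
move: (j%:R) (expR u) x0 => m x x0 m0.
have h3 : 0 < 1 + x + m by rewrite addrC ltr_wpDl // addr_gt0.
have h4 : 0 < 2^-1 + x + m by rewrite addrC ltr_wpDl // addr_gt0.
have -> : x + (2 * m + 1) / 2 = 2^-1 + x + m by field.
have -> : x + (2 * m + 2) / 2 = 1 + x + m by field.
by rewrite mulrBr.
Qed.

Lemma itg_tnhG u : itg (fun w => tnh w * gam_int 1 (w + u)).
Proof.
have iG : itg (fun w => gam_int 1 (w + u)) := itg_shift u (itg_gam (@ltr01 R)).
have := itg_bddM iG (continuous_meas tnh_cont) (M := 1) _.
under eq_fun do rewrite mulrC; apply=> w.
by rewrite ger0_norm ?tnh_ge0 // tnh_le1.
Qed.

Lemma J_tnhG u : J (fun w => tnh w * gam_int 1 (w + u)) = 1 - 2 * xp u.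
Proof.
have iG : itg (fun w => gam_int 1 (w + u)) := itg_shift u (itg_gam (@ltr01 R)).
have [i j] := J_zed u.
have -> : (fun w => tnh w * gam_int 1 (w + u)) = (fun w => gam_int 1 (w + u) - 2 * (zed w / (1 + zed w) * gam_int 1 (w + u))).
  by apply/funext => w; rewrite tnhE; ring.
rewrite JB ?JZ ?j //; last exact: itgZ.
by rewrite (J_shift u (itg_gam (@ltr01 R))) -gamE gam1.
Qed.

Lemma xp_le_half u : xp u <= 2^-1.
Proof.
have : 0 <= J (fun w => tnh w * gam_int 1 (w + u)).
  by apply: J_ge0 => w; rewrite mulr_ge0 ?tnh_ge0 ?gam_int_ge0.
rewrite J_tnhG; move: (xp u) => x; lra.
Qed.

(** From [tanh (t / 4) <= t / 4]: the mean of [t] under the density [x e^(-x t)] is [1 / x]. *)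
Lemma xp_ge_half u : 2^-1 - expR (- u) / 8 <= xp u.
Proof.
have g2 : gam 2 = 1 :> R by have := gamD1 (@ltr01 R); rewrite mul1r gam1.
have i2 := itg_gam (@ltr0Sn R 1).
have H : J (fun w => tnh w * gam_int 1 (w + u)) <= J (fun w => expR (- u) / 4 * gam_int 2 (w + u)).
  apply: le_J; [exact: itg_tnhG|by apply: itgZ; exact: itg_shift|move=> w].
  have -> : gam_int 2 (w + u) = expR w * expR u * gam_int 1 (w + u).
    by rewrite /gam_int -!expRD; congr expR; ring.
  have -> : expR (- u) / 4 * (expR w * expR u * gam_int 1 (w + u)) = expR w / 4 * gam_int 1 (w + u).
    by rewrite expRN; have := expR_gt0 u => h; field; rewrite gt_eqF.
  by rewrite ler_wpM2r ?gam_int_ge0 // tnh_le.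
move: H; rewrite J_tnhG JZ; last exact: itg_shift.
rewrite (J_shift u i2) -gamE g2 mulr1; move: (xp u) (expR _) => x y; lra.
Qed.

Lemma xp_ge0 u : 0 <= xp u.
Proof.
have p2 : 0 < 2^-1 + expR u by rewrite addr_gt0 ?expR_gt0.
rewrite mulr_ge0 ?expR_ge0 // subr_ge0.
have h : 2^-1 + expR u <= 1 + expR u by rewrite lerD2r; lra.
by have /andP[] := psi_incr p2 h.
Qed.

Lemma xp_le u : xp u <= 4 * expR u.
Proof.
have p2 : 0 < 2^-1 + expR u by rewrite addr_gt0 ?expR_gt0.
have h : 2^-1 + expR u <= 1 + expR u by rewrite lerD2r; lra.
have /andP[_ h2] := psi_incr p2 h.
rewrite /xp [4 * _]mulrC ler_wpM2l ?expR_ge0 //; apply: le_trans h2 _.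
have -> : 1 + expR u - (2^-1 + expR u) = 2^-1 by field.
have l2 : 2^-1 <= low (2^-1 + expR u) by rewrite /low le_min lerDl expR_ge0 /=; lra.
have l0 := low_gt0 p2.
rewrite mulrA mulVf // mul1r invf_ple ?posrE ?exprn_gt0 //.
have -> : 4^-1 = 2^-1 ^+ 2 :> R by field.
by apply: lerXn2r; rewrite ?nnegrE // ltW.
Qed.

(* Subtracting 1/2 for u >= 0 removes the tail 1 / (2 x) of p. *)
Definition qf u : R := xp u - 2^-1 * ((0 <= u)%R)%:R.

Lemma qf_bound u : `|qf u| <= 4 * expR (- `|u|).
Proof.
rewrite /qf; have [u0|u0] := leP 0 u.
  rewrite mulr1 ler0_norm ?subr_le0 ?xp_le_half // (ger0_norm u0).
  have := xp_ge_half u; have := expR_ge0 (- u); move: (xp u) (expR _) => x y; lra.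
by rewrite mulr0 subr0 ger0_norm ?xp_ge0 // (ltr0_norm u0) opprK xp_le.
Qed.

Lemma xp_cont : cont xp.
Proof.
apply: contM; first exact: continuous_expR.
have c1 (a : R) : cont (fun u => a + expR u).
  by apply: contD; [exact: cont_cst|exact: continuous_expR].
by apply: contD; [|apply: contN]; apply: psi_cont => // u; rewrite addr_gt0 ?expR_gt0.
Qed.

Lemma qf_meas : measurable_fun setT qf.
Proof.
apply: measurable_funB; first exact: continuous_meas xp_cont.
by apply: measurable_funM => //; exact: measurable_ge.
Qed.

Lemma itg_tnh_exp e : 0 < e -> e <= 2^-1 -> itg (fun w => tnh w * expR (- (e * w))).
Proof.
move=> e0 e1; apply: (@itg_exp R _ 1 e) => //.
  apply: continuous_meas; apply: contM; [exact: tnh_cont|cauto].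
move=> w; rewrite mul1r normrM ger0_norm ?tnh_ge0 // ger0_norm ?expR_ge0 //.
have [w0|w0] := leP 0 w.
  by rewrite (ger0_norm w0) ler_piMl ?expR_ge0 // tnh_le1.
rewrite (ltr0_norm w0); apply: (@le_trans _ _ (expR w * expR (- (e * w)))).
  rewrite ler_wpM2r ?expR_ge0 //; apply: le_trans (tnh_le w) _.
  by have := expR_ge0 w; move: (expR w) => y; lra.
rewrite -expRD ler_expR.
have : 0 <= (2^-1 - e) * - w by rewrite mulr_ge0 // ?subr_ge0 // oppr_ge0 ltW.
rewrite mulrBl => h; lra.
Qed.

Definition ufun e : R := J (fun u => expR (e * u) * qf u).

(* Mellin convolution: [x ^ e (1/2 - x p x)] is the multiplicative convolution
   of the tanh kernel with the density of [Gamma (1 + e)]. *)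
Lemma ufunE e : 0 < e -> e <= 2^-1 ->
  ufun e = (2 * e)^-1 - 2^-1 * gam (1 + e) * J (fun w => tnh w * expR (- (e * w))).
Proof.
move=> e0 e1.
have e2 : 0 < 1 + e by rewrite addr_gt0.
pose a w := tnh (- w) * expR (- (e * - w)).
have it := itg_tnh_exp e0 e1.
have ia : itg a := itg_opp it.
have ig := itg_gam e2.
have bg u : `|gam_int (1 + e) u| <= expR (2 * (1 + e) ^+ 2).
  rewrite ger0_norm ?gam_int_ge0 //; apply: le_trans (gam_int_bound u e2) _.
  by rewrite ler_piMr ?expR_ge0 // -[leRHS]expR0 ler_expR oppr_le0 mulr_ge0 // ltW.
have H := J_conv ia ig bg.
have C u : J (fun w => a w * gam_int (1 + e) (u - w)) = expR (e * u) * (1 - 2 * xp u).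
  rewrite -J_tnhG -JZ; last exact: itg_tnhG.
  rewrite -(J_opp (itg_conv_in ia ig bg u)); apply: eq_J => w.
  rewrite /a !opprK [u + w]addrC.
  have -> : gam_int (1 + e) (w + u) = expR (e * w) * (expR (e * u) * gam_int 1 (w + u)).
    by rewrite /gam_int -!expRD; congr expR; ring.
  rewrite [expR (- _)]expRN; have := expR_gt0 (e * w) => h; field.
  by rewrite gt_eqF.
have IC := itg_conv ia ig bg.
have [i1 j1] : itg (fun u => expR (e * u) * ((u < 0)%R)%:R) /\ J (fun u => expR (e * u) * ((u < 0)%R)%:R) = e^-1 * expR (e * 0).
  apply: (@J_neg R (fun u => e^-1 * expR (e * u)) _ e) => //.
  - by move=> w; apply: drv_eq; [dauto|rewrite /=; field; rewrite gt_eqF].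
  - by cauto.
  - move=> w; case: (leP w 0) => w0; last by rewrite mulr0 normr0 expR_ge0.
    by rewrite mulr1 ger0_norm ?expR_ge0 // (ler0_norm w0) mulrN opprK.
  - apply: (tends_eq (tends_ext (tendsM (@tends_cst R e^-1) (tends_expN e0)) _)) => [n|]; last by rewrite mulr0.
    by rewrite mulrN.
rewrite mulr0 expR0 mulr1 in j1.
have Ca : J a = J (fun w => tnh w * expR (- (e * w))) by rewrite -(J_opp it).
rewrite -Ca gamE -mulrA [J _ * J a]mulrC -H invfM -j1 -!JZ // -JB; [|exact: itgZ|exact: itgZ].
apply: eq_J => u; rewrite C /qf leNgt; by case: (u < 0); rewrite /=; field.
Qed.
End psi_difference.

(** * The Mellin transform of tanh *)

Section mellin_tanh.
Context {R : realType}.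
Implicit Types (e r w a : R).

(** The index map [j -> 2 j + 1] doubles [j + 1], so for powers of [j + 1] it multiplies terms by a
    constant. Removing these terms leaves the odd integers; used for zeta and for the inverse
    squares. *)
Lemma tends_even_terms (F : nat -> R) (c Z : R) : (forall j, F j.*2.+1 = c * F j) ->
  tends (fun N => \sum_(0 <= j < N) F j) Z ->
  tends (fun N => \sum_(0 <= j < N) F j.*2) ((1 - c) * Z).
Proof.
move=> hF H.
have H2 : tends (fun N => \sum_(0 <= j < N.*2) F j) Z.
  by apply: (@tends_sub _ _ _ (fun N => N.*2) H) => n; rewrite -addnn leq_addr.
apply: (tends_eq (tends_ext (tendsB H2 (tendsM (@tends_cst R c) H)) _)) => [N|]; last by rewrite mulrBl mul1r.
rewrite sum_pairs big_split /= mulr_sumr.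
by under [X in _ + X - _]eq_bigr do rewrite hF; rewrite addrK.
Qed.

Definition sechx e r : R := expR (- (e * r)) / cosh r.

Lemma sechx_cont e : cont (sechx e).
Proof.
apply: contM; first by cauto.
by apply: contV; [move=> r; rewrite gt_eqF // cosh_gt0|exact: (cosh_cont (f := fun r => r)) (@cont_id R)].
Qed.

Lemma invcosh_le r : (cosh r)^-1 <= 2 * expR (- `|r|).
Proof.
have h := cosh_lower r; have c0 := cosh_gt0 r; have e0 := expR_gt0 `|r|.
by rewrite expRN -[X in X <= _]mul1r ler_pdivrMr // mulrAC ler_pdivlMr // mul1r.
Qed.

Lemma itg_sechx e : 0 <= e -> e <= 2^-1 -> itg (sechx e).
Proof.
move=> e0 e1; have half : 0 < 2^-1 :> R by rewrite invr_gt0.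
apply: (itg_exp (f := sechx e) (C := 2) half); first exact: continuous_meas (@sechx_cont e).
move=> r; rewrite /sechx normrM ger0_norm ?expR_ge0 // ger0_norm ?invr_ge0 ?(ltW (cosh_gt0 _)) //.
apply: (@le_trans _ _ (expR (2^-1 * `|r|) * (2 * expR (- `|r|)))).
  apply: ler_pM; rewrite ?expR_ge0 ?invr_ge0 ?(ltW (cosh_gt0 _)) ?invcosh_le //.
  rewrite ler_expR; apply: le_trans (ler_norm _) _.
  by rewrite normrN normrM (ger0_norm e0) ler_wpM2r.
rewrite mulrCA -expRD ler_pM2l // ler_expR; move: (`|r|) => s; lra.
Qed.

Definition secht e : R := J (sechx e).

(** Since [2 y b / (y^2 + b^2) = 1 / cosh (ln (y / b))], every partial fraction is a translate of
    [1 / cosh] in [w]. The translation [ln (2 pi) + ln (2 j + 1)] turns the dependence on [j] into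
    the power [(2 j + 1)^(-1 - e)]. *)
Lemma J_node_term e j : 0 < e -> e <= 2^-1 ->
  itg (fun w => 2 * (expR w / 4) / ((expR w / 4) ^+ 2 + node j ^+ 2) * expR (- (e * w))) /\
  J (fun w => 2 * (expR w / 4) / ((expR w / 4) ^+ 2 + node j ^+ 2) * expR (- (e * w))) =
  2 / pi * expR (- (e * ln (2 * pi))) * secht e * expR (- ((1 + e) * ln j.*2.+1%:R)).
Proof.
move=> e0 e1.
have b0 : 0 < node j :> R := node_gt0 j.
have b4 : 0 < 4 * node j :> R by rewrite mulr_gt0.
have i := itg_sechx (ltW e0) e1.
have p0 : 0 < pi :> R := pi_gt0 R.
pose K := (node j)^-1 * expR (- (e * ln (4 * node j))).
have E : (fun w => 2 * (expR w / 4) / ((expR w / 4) ^+ 2 + node j ^+ 2) * expR (- (e * w))) =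
  (fun w => K * sechx e (w + - ln (4 * node j))).
  apply/funext => w; rewrite /sechx /K /cosh.
  have -> : expR (- (e * w)) = expR (- (e * ln (4 * node j))) * expR (- (e * (w + - ln (4 * node j)))).
    by rewrite -expRD; congr expR; ring.
  have -> : expR (w + - ln (4 * node j)) = expR w / (4 * node j) by rewrite expRD expRN lnK.
  have -> : expR (- (w + - ln (4 * node j))) = (4 * node j) / expR w by rewrite opprD opprK expRD expRN lnK // mulrC.
  have := expR_gt0 w; move: (expR (- (e * ln _))) => A; move: (expR (- (e * _))) => B; move: (expR w) (node j) b0 => y b b0' y0.
  have h1 : 0 < y ^+ 2 + b ^+ 2 * 16 by rewrite addr_gt0 // ?mulr_gt0 // exprn_gt0.
  field; rewrite !gt_eqF //.
  by rewrite -expr2 (_ : _ + _ = y ^+ 2 + b ^+ 2 * 16) //; ring.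
have ishift := itg_shift (- ln (4 * node j)) i.
rewrite E; split; first exact: itgZ.
rewrite JZ // (J_shift _ i) -/(secht e) /K.
have -> : ln (4 * node j) = ln (2 * pi) + ln j.*2.+1%:R :> R.
  have d1 : j.*2.+1%:R = 2 * j%:R + 1 :> R by rewrite -addn1 natrD -muln2 natrM mulrC.
  by rewrite -lnM ?posrE ?mulr_gt0 // d1 /node; congr ln; field.
have -> : expR (- (e * (ln (2 * pi) + ln j.*2.+1%:R))) = expR (- (e * ln (2 * pi))) * expR (- (e * ln j.*2.+1%:R)) :> R.
  by rewrite -expRD; congr expR; ring.
have -> : expR (- ((1 + e) * ln j.*2.+1%:R)) = (j.*2.+1%:R)^-1 * expR (- (e * ln j.*2.+1%:R)) :> R.
  by rewrite -[in RHS](lnK (x := j.*2.+1%:R)) ?posrE // -expRN -expRD lnK ?posrE //; congr expR; ring.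
have d1 : j.*2.+1%:R = 2 * j%:R + 1 :> R by rewrite -addn1 natrD -muln2 natrM mulrC.
rewrite /node d1; have : 0 < 2 * j%:R + 1 :> R by rewrite -d1.
move: (expR (- (e * ln (2 * pi)))) => A; move: (expR (- (e * ln _))) => B.
move: (2 * j%:R + 1) (secht e) (pi) p0 => m s p p0 m0.
by field; rewrite !gt_eqF.
Qed.

(** The partial fractions of [tanh] are nonnegative, so the limit itself dominates their sums and
    termwise integration is allowed; the sum over odd integers yields the Euler factor at 2. *)
Lemma J_tnh_exp e Z : 0 < e -> e <= 2^-1 ->
  tends (fun N => \sum_(0 <= j < N) expR (- ((1 + e) * ln j.+1%:R))) Z ->
  J (fun w => tnh w * expR (- (e * w))) =
  2 / pi * expR (- (e * ln (2 * pi))) * secht e * ((1 - expR (- ((1 + e) * ln 2))) * Z).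
Proof.
move=> e0 e1 hZ.
pose T j w := 2 * (expR w / 4) / ((expR w / 4) ^+ 2 + node j ^+ 2) * expR (- (e * w)).
have iT j : itg (T j) := (J_node_term j e0 e1).1.
have y0 w : 0 <= expR w / 4 :> R by rewrite divr_ge0 ?expR_ge0.
have T0 j w : 0 <= T j w.
  by rewrite mulr_ge0 ?expR_ge0 // divr_ge0 ?mulr_ge0 // addr_ge0 ?sqr_ge0.
have H w : tends (fun N => \sum_(0 <= j < N) T j w) (tnh w * expR (- (e * w))).
  apply: (tends_ext (tendsM (series_tanh (y0 w)) (@tends_cst R (expR (- (e * w)))))) => N.
  by rewrite /series /= mulr_suml.
have [] // := @dct R (fun N w => \sum_(0 <= j < N) T j w) (fun w => tnh w * expR (- (e * w))) (fun w => tnh w * expR (- (e * w))).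
- by move=> N; apply: measurable_sum => j; exact: itg_meas (iT j).
- exact: itg_tnh_exp.
- move=> N w; rewrite ger0_norm ?sumr_ge0 //.
  apply: (tends_ge (H w)); near=> M; rewrite [leRHS](@big_cat_nat _ _ _ N) //=; last first.
    by near: M; exact: nbhs_infty_ge.
  by rewrite lerDl sumr_ge0.
move=> _ H2.
have F (j : nat) : expR (- ((1 + e) * ln j.*2.+1.+1%:R)) = expR (- ((1 + e) * ln 2)) * expR (- ((1 + e) * ln j.+1%:R)) :> R.
  have -> : j.*2.+1.+1 = (2 * j.+1)%N by rewrite -doubleS mul2n.
  by rewrite natrM lnM ?posrE // -expRD; congr expR; ring.
have H3 := tends_even_terms F hZ.
apply: (tends_unique (tends_ext H2 _) (tendsM (@tends_cst R _) H3)) => N.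
rewrite (J_sum N iT).2 mulr_sumr; apply: eq_bigr => j _.
exact: (J_node_term j e0 e1).2.
Unshelve. all: by end_near. Qed.
End mellin_tanh.

(** * Expansions to second order *)

Section expansions.
Context {R : realType}.
Implicit Types (a : R).

Lemma exp_tail (m : nat) a : `|expR a - \sum_(0 <= k < m) a ^+ k / k`!%:R| <= `|a| ^+ m * expR `|a|.
Proof.
have H : tends (series (exp_coeff a)) (expR a) by exact: is_cvg_series_exp_coeff.
have H2 := tends_norm (tendsB H (@tends_cst R (\sum_(0 <= k < m) a ^+ k / k`!%:R))).
apply: (tends_le H2); near=> n.
have mn : (m <= n)%N by near: n; exact: nbhs_infty_ge.
rewrite /series /= (@big_cat_nat _ _ _ m) //= [X in `|X|]addrAC.
rewrite [X in _ - X](_ : _ = \sum_(0 <= k < m) exp_coeff a k); last by apply: eq_bigr.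
rewrite subrr add0r; apply: le_trans (ler_norm_sum _ _ _) _.
have a0 : 0 <= `|a| by [].
apply: le_trans (ler_wpM2l (exprn_ge0 m a0) (exp_series_le (n - m) a0)).
rewrite -{1}[m]add0n big_addn mulr_sumr; apply: ler_sum => k _.
rewrite /exp_coeff /= normrM normfV normr_nat normrX exprD [_ ^+ k * _]mulrC -mulrA ler_wpM2l ?exprn_ge0 //.
rewrite ler_wpM2l ?exprn_ge0 // lef_pV2 ?posrE ?ltr0n ?fact_gt0 // ler_nat.
by apply: leq_fact; rewrite leq_addr.
Unshelve. all: by end_near. Qed.

(** The expansion [u = 1 + m1 eps + m2 eps^2 + o(eps^2)]. With constant term 1, expansions of
    products follow from [ex2M]. *)
Definition ex2 (u : nat -> R) (m1 m2 : R) := tends (fun n => (u n - 1 - m1 * eps n) / eps n ^+ 2) m2.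

Lemma ex2_1 u m1 m2 : ex2 u m1 m2 -> tends u 1 /\ tends (fun n => (u n - 1) / eps n) m1.
Proof.
move=> h; have e0 n : eps n != 0 :> R by rewrite gt_eqF // eps_gt0.
have h1 : tends (fun n => (u n - 1) / eps n) m1.
  apply: (tends_eq (tends_ext (tendsD (tendsM h (@tends_eps R)) (@tends_cst R m1)) _)) => [n|]; last by rewrite mulr0 add0r.
  by have := e0 n; move: (eps n) => e en; field.
split=> //.
apply: (tends_eq (tends_ext (tendsD (tendsM h1 (@tends_eps R)) (@tends_cst R 1)) _)) => [n|]; last by rewrite mulr0 add0r.
by rewrite divfK ?subrK.
Qed.

Lemma ex2M u v m1 m2 k1 k2 : ex2 u m1 m2 -> ex2 v k1 k2 ->
  ex2 (fun n => u n * v n) (m1 + k1) (m2 + k2 + m1 * k1).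
Proof.
move=> hu hv; have [u1 u2] := ex2_1 hu; have [v1 v2] := ex2_1 hv.
apply: (tends_eq (tends_ext (tendsD (tendsD hu hv) (tendsM u2 v2)) _)) => [n|//].
have e0 : eps n != 0 :> R by rewrite gt_eqF // eps_gt0.
by move: (eps n) (u n) (v n) e0 => e a b e0; field.
Qed.

Lemma ex2_exp (a : nat -> R) (al be : R) : tends (fun n => (a n - al * eps n) / eps n ^+ 2) be ->
  ex2 (fun n => expR (a n)) al (be + al ^+ 2 / 2).
Proof.
move=> h; have e0 n : eps n != 0 :> R by rewrite gt_eqF // eps_gt0.
have h1 : tends (fun n => a n / eps n) al.
  apply: (tends_eq (tends_ext (tendsD (tendsM h (@tends_eps R)) (@tends_cst R al)) _)) => [n|]; last by rewrite mulr0 add0r.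
  by have := e0 n; move: (eps n) => e en; field.
have h2 : tends a 0.
  apply: (tends_eq (tends_ext (tendsM h1 (@tends_eps R)) _)) => [n|]; last by rewrite mulr0.
  by rewrite divfK.
have hR : tends (fun n => (expR (a n) - 1 - a n - a n ^+ 2 / 2) / eps n ^+ 2) 0.
  apply: (@tends_norm0 _ _ (fun n => (`|a n / eps n| ^+ 2 * `|a n|) * expR `|a n|)).
    apply: nearW => n; have := exp_tail 3 (a n).
    rewrite !big_nat_recr //= big_geq // !factS fact0 expr0 expr1 !mul1n muln1 add0r divr1 => H.
    rewrite normrM normfV [`|eps n ^+ 2|]ger0_norm ?exprn_ge0 ?(ltW (eps_gt0 _)) //.
    rewrite ler_pdivrMr ?exprn_gt0 ?eps_gt0 //.
    have E : expR (a n) - 1 - a n - a n ^+ 2 / 2 = expR (a n) - (1 + a n / 1 + a n ^+ 2 / 2) by field.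
    rewrite E; apply: le_trans H _.
    rewrite normrM normfV [`|eps n|]ger0_norm ?(ltW (eps_gt0 _)) //.
    rewrite le_eqVlt; apply/orP; left; apply/eqP.
    by have := e0 n; move: (expR `|_|) => E'; move: (eps n) (`|a n|) => e b en; field.
  have hn0 := tends_norm h2; rewrite normr0 in hn0.
  apply: (tends_eq (tendsM (tendsM (tendsX (k := 2) (tends_norm h1)) hn0) (tends_exp hn0))).
  by rewrite mulr0 mul0r.
apply: (tends_eq (tends_ext (tendsD (tendsD hR h) (tendsM (tendsX (k := 2) h1) (@tends_cst R 2^-1))) _)) => [n|].
  by have := e0 n; move: (eps n) => e en; field.
by rewrite add0r.
Qed.

(** Divide the partial fractions of [tanh eps] by [eps]: the left side tends to 1, and the right
    side to twice the sum, with an error of at most [4 eps^2]. *)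
Lemma sum_invsq_node : tends (fun N => \sum_(0 <= j < N) (node j ^+ 2)^-1) (2^-1 : R).
Proof.
have b0 j : 0 < node j :> R := node_gt0 j.
have nd : nondecreasing_seq (fun N => \sum_(0 <= j < N) (node j ^+ 2)^-1 : R).
  apply/nondecreasing_seqP => N; rewrite big_nat_recr //= lerDl invr_ge0 exprn_ge0 // ltW //.
have ub N : \sum_(0 <= j < N) (node j ^+ 2)^-1 <= 2 :> R.
  apply: le_trans (@sum_invsq_le R N); apply: ler_sum => j _; exact: invsq_node.
have [S hS] : exists S : R, tends (fun N => \sum_(0 <= j < N) (node j ^+ 2)^-1) S.
  have : cvgn (fun N => \sum_(0 <= j < N) (node j ^+ 2)^-1 : R).
    by apply: nondecreasing_is_cvgn nd _; exists 2 => _ [N _ <-].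
  by move=> /cvg_ex[S hS]; exists S.
suff E : tends (fun n => sinh (eps n) / (cosh (eps n) * eps n) - 2 * S) 0 /\ tends (fun n => sinh (eps n) / (cosh (eps n) * eps n)) (1 : R).
  have H : 2 * S = 1 by apply: tends_unique E.2; apply: (tends_dist0 _ _).2; exact: E.1.
  by apply: tends_eq hS _; rewrite -[S](mulKf (x := 2)) // H mulr1.
split; last first.
  apply: (tends_squeeze (u := fun n => (cosh (eps n))^-1) (w := fun=> 1)).
  - apply: nearW => n; have e0 := @eps_gt0 R n; have c0 := cosh_gt0 (@eps R n).
    apply/andP; split.
      have -> : sinh (eps n) / (cosh (eps n) * eps n) = (cosh (eps n))^-1 * (sinh (eps n) / eps n) :> R.
        by move: c0 e0; move: (@eps R n) (sinh (@eps R n)) (cosh (@eps R n)) => e s c c0 e0; field; rewrite !gt_eqF.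
      rewrite -[leLHS]mulr1 ler_pM2l ?invr_gt0 // ler_pdivlMr // mul1r.
      apply: (tends_le (@cvg_sinhN R (eps n))); apply: nearW => k; apply: sinh_pow; exact: ltW.
    rewrite (ler_pdivrMr _ _ (mulr_gt0 c0 e0)) mul1r mulrC.
    have := sinh_bound (@eps R n); rewrite (gtr0_norm e0); apply: le_trans; exact: ler_norm.
  - have h := tends_cont (cosh_cont (f := fun r => r) (@cont_id R)) (@tends_eps R).
    by apply: tends_eq (tendsV _ h) _; rewrite cosh0 ?invr1 ?oner_eq0.
  - exact: tends_cst.
apply: (@tends_norm0 _ _ (fun n => eps n ^+ 2 * 4)).
  apply: nearW => n; have e0 := @eps_gt0 R n; have c0 := cosh_gt0 (@eps R n).
  have H := tendsB (tendsM (series_tanh (ltW e0)) (@tends_cst R (eps n)^-1)) (tendsM (@tends_cst R 2) hS).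
  rewrite (_ : sinh _ / (_ * _) = sinh (eps n) / cosh (eps n) * (eps n)^-1); last by move: c0 e0; move: (@eps R n) (sinh (@eps R n)) (cosh (@eps R n)) => e s c c0 e0; field; rewrite !gt_eqF.
  apply: (tends_le (tends_norm H)); apply: nearW => N.
  rewrite /series /= mulr_suml mulr_sumr -sumrB.
  apply: le_trans (ler_norm_sum _ _ _) _.
  apply: (@le_trans _ _ (\sum_(0 <= j < N) (eps n ^+ 2 * 2) * (j.+1%:R ^+ 2)^-1)).
    apply: ler_sum => j _; have := invsq_node (R := R) j; have := b0 j; have := node_lower (R := R) j.
    have : 1 <= j.+1%:R :> R by rewrite ler1n.
    move: (j.+1%:R) (node j) (eps n) e0 => m b e e0 m1 mb b0' h.
    have b1 : 1 <= b by apply: le_trans mb.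
    have s0 : 0 < e ^+ 2 + b ^+ 2 by rewrite addr_gt0 ?exprn_gt0.
    have -> : 2 * e / (e ^+ 2 + b ^+ 2) / e - 2 * b ^- 2 = - (e ^+ 2 * 2 * (b ^- 2 * (e ^+ 2 + b ^+ 2)^-1)).
      by field; rewrite !gt_eqF.
    rewrite normrN ger0_norm; last by rewrite !mulr_ge0 ?invr_ge0 ?exprn_ge0 ?(ltW e0) ?(ltW b0') ?(ltW s0).
    rewrite ler_wpM2l ?mulr_ge0 ?exprn_ge0 ?(ltW e0) //.
    apply: le_trans h; rewrite ler_piMr ?invr_ge0 ?exprn_ge0 ?(ltW b0') // invf_le1 //.
    by rewrite ler_wpDl ?exprn_ge0 ?(ltW e0) // exprn_ege1.
  rewrite -mulr_sumr -mulrA ler_wpM2l ?exprn_ge0 ?(ltW e0) //.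
  have := @sum_invsq_le R N; move: (\sum_(_ <= _ < _) _) => z; lra.
by apply: tends_eq (tendsM (tendsX (k := 2) (@tends_eps R)) (@tends_cst R 4)) _; rewrite expr0n mul0r.
Qed.

(** By [sum_invsq_node] the odd inverse squares add up to [pi^2 / 8], and they are three quarters of
    the whole sum. *)
Lemma basel : limn (series (fun k : nat => (k.+1%:R ^+ 2)^-1 : R)) = pi ^+ 2 / 6.
Proof.
have H : tends (series (fun k : nat => (k.+1%:R ^+ 2)^-1 : R)) (limn (series (fun k : nat => (k.+1%:R ^+ 2)^-1 : R))) by exact: cvgn_invsq.
have F (j : nat) : (j.*2.+1.+1%:R ^+ 2)^-1 = 4^-1 * (j.+1%:R ^+ 2)^-1 :> R.
  have -> : j.*2.+1.+1 = (2 * j.+1)%N by rewrite -doubleS mul2n.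
  by rewrite natrM exprMn invfM (_ : 2 ^+ 2 = 4 :> R) //; ring.
have H2 := tends_even_terms F H.
have p0 : 0 < pi :> R := pi_gt0 R.
have H3 := tendsM (@tends_cst R (4 / pi ^+ 2)) H2.
have E : 4 / pi ^+ 2 * ((1 - 4^-1) * limn (series (fun k : nat => (k.+1%:R ^+ 2)^-1 : R))) = 2^-1.
  apply: tends_unique H3 (tends_ext sum_invsq_node _) => N.
  rewrite mulr_sumr; apply: eq_bigr => j _.
  have d1 : j.*2.+1%:R = 2 * j%:R + 1 :> R by rewrite -addn1 natrD -muln2 natrM mulrC.
  rewrite d1 /node; have : 0 < 2 * j%:R + 1 :> R by rewrite -d1.
  by move: (2 * j%:R + 1) (pi) p0 => m p p0 m0; field; rewrite !gt_eqF.
move: E; move: (limn _) (pi) p0 => Z p p0 E.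
have -> : Z = (4 / p ^+ 2 * ((1 - 4^-1) * Z)) * (p ^+ 2 / 3) by field; rewrite gt_eqF.
by rewrite E; field.
Qed.

Lemma ex2_gam : ex2 (fun n => gam (1 + eps n)) (- euler_mascheroni) (pi ^+ 2 / 12 + euler_mascheroni ^+ 2 / 2 : R).
Proof.
have H : ex2 (fun n => expR (lgam (1 + eps n))) (psi 1) (pi ^+ 2 / 12 + psi 1 ^+ 2 / 2 : R).
  apply: ex2_exp.
  apply: (tends_squeeze (u := fun n => pi ^+ 2 / 12 - 2 / 3 * eps n) (w := fun=> pi ^+ 2 / 12)).
  - apply: nearW => n; have e0 := @eps_gt0 R n.
    have e1 : eps n <= 1 :> R by apply: le_trans (@eps_le R n) _; lra.
    have := lgam_taylor2 e0 e1; rewrite basel => /andP[h1 h2].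
    rewrite ler_pdivlMr ?exprn_gt0 // ler_pdivrMr ?exprn_gt0 //.
    move: h1 h2; move: (lgam (1 + eps n)) => l; move: (psi 1) (pi) (eps n) => q p e h1 h2.
    by apply/andP; split; [rewrite lerBrDl; apply: le_trans h1|rewrite lerBlDl; apply: le_trans h2 _];
      rewrite le_eqVlt; apply/orP; left; apply/eqP; field.
  - apply: (tends_eq (tendsB (@tends_cst R (pi ^+ 2 / 12)) (tendsM (@tends_cst R (2 / 3)) (@tends_eps R)))).
    by rewrite mulr0 subr0.
  - exact: tends_cst.
rewrite psi1 sqrrN in H.
apply: (tends_ext H) => n; rewrite lgamE lnK // posrE gam_gt0 // addr_gt0 ?eps_gt0 //.
Qed.

Lemma ex2_expN (L : R) : ex2 (fun n => expR (- (eps n * L))) (- L) (L ^+ 2 / 2).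
Proof.
have e0 n : eps n != 0 :> R by rewrite gt_eqF // eps_gt0.
have -> : L ^+ 2 / 2 = 0 + (- L) ^+ 2 / 2 by rewrite sqrrN add0r.
apply: ex2_exp; apply: (tends_ext (@tends_cst R 0)) => n.
by rewrite (_ : _ - _ = 0) ?mul0r //; ring.
Qed.

Lemma ex2_2sub u m1 m2 : ex2 u m1 m2 -> ex2 (fun n => 2 - u n) (- m1) (- m2).
Proof.
move=> h; apply: (tends_ext (tendsN h)) => n.
by move: (_ ^+ 2) => e; rewrite -mulNr; congr (_ / _); ring.
Qed.

(** The Laurent expansion is used along the real points [1 + eps] only; multiplication by [eps]
    shifts its coefficients and makes the constant term 1. *)
Lemma ex2_zeta (zeta : R[i]^o -> R[i]^o) (gamma1 : R) : is_stieltjes1 zeta gamma1 ->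
  ex2 (fun n => eps n * zr zeta 0 (1 + eps n)) euler_mascheroni (- gamma1).
Proof.
move=> H.
have e0 n : 0 < eps n :> R := eps_gt0 n.
pose D n := zr zeta 0 (1 + eps n) - ((eps n)^-1 + euler_mascheroni - gamma1 * eps n).
have [K [K0 hK]] : exists K : R, 0 <= K /\ \forall n \near \oo, `|D n| <= K * eps n ^+ 2.
  move: H => /eqO_exP[k k0 hk].
  have [d d0 hd] := @near_line R _ 1 0 hk.
  exists (complex.Re k); split.
    by move: k0; rewrite ltcE => /andP[_ /ltW].
  have hE : \forall n \near \oo, `|eps n : R| < d.
    have /cvgrPdist_lt/(_ _ d0) := @tends_eps R; apply: filterS => n.
    by rewrite sub0r normrN.
  apply: filterS hE => n hn.
  have E1 : (((1 + eps n) +i* 0)%C : R[i]^o) - 1 = (eps n)%:C%C.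
    by apply/eqP; rewrite eq_complex /=; apply/andP; split; apply/eqP; ring.
  have := hd _ hn; rewrite E1 => /(_ _)/wrap[].
    by rewrite -subr_eq0 E1 eq_complex /= negb_and gt_eqF.
  have -> : ((eps n)%:C%C : R[i]^o)^-1 + euler_mascheroni%:C%C - gamma1%:C%C * (eps n)%:C%C =
    ((eps n)^-1 + euler_mascheroni - gamma1 * eps n)%:C%C.
    have -> : ((eps n)%:C%C : R[i]^o)^-1 = ((eps n)^-1)%:C%C.
      apply/eqP; rewrite eq_complex /=.
      have := e0 n; move: (eps n) => e en.
      have en2 : 0 < e ^+ 2 + 0 ^+ 2 by rewrite expr0n /= addr0 exprn_gt0.
      apply/andP; split; apply/eqP; last by rewrite mul0r oppr0.
      by rewrite expr0n /= addr0; field; rewrite gt_eqF.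
    by apply/eqP; rewrite eq_complex /=; apply/andP; split; apply/eqP; ring.
  rewrite -rmorphXn /= !normCE => h.
  have k1 : k = (complex.Re k)%:C%C.
    by move: k0; rewrite ltcE => /andP[/eqP]; case: (k) => a b /= -> _.
  have : Normc.normc (zeta ((1 + eps n) +i* 0)%C - ((eps n)^-1 + euler_mascheroni - gamma1 * eps n)%:C%C) <= complex.Re k * eps n ^+ 2.
    rewrite -lecR; apply: le_trans h _; rewrite {1}k1 rmorphM /=.
    rewrite -expr2 !mulr0 !mul0r subr0 addr0 expr0n /= addr0 sqrtr_sqr ger0_norm ?exprn_ge0 ?(ltW (e0 n)) //.
    rewrite le_eqVlt; apply/orP; left.
    by rewrite eq_complex /=; apply/andP; split; apply/eqP; ring.
  apply: le_trans; apply: le_trans (Re_le_normc _); rewrite /D /zr.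
  by case: (zeta _).
suff h : tends (fun n => D n / eps n) 0.
  apply: (tends_eq (tends_ext (tendsB h (@tends_cst R gamma1)) _)) => [n|]; last by rewrite sub0r.
  have := e0 n; rewrite /D; move: (eps n) (zr _ _ _) => e z en; field.
  by rewrite gt_eqF.
apply: (@tends_norm0 _ _ (fun n => K * eps n)).
  apply: filterS hK => n hn; rewrite normrM normfV (gtr0_norm (e0 n)) ler_pdivrMr //.
  by rewrite -mulrA -expr2.
by apply: tends_eq (tendsM (@tends_cst R K) (@tends_eps R)) _; rewrite mulr0.
Qed.

Lemma J_invcosh : J (fun r : R => (cosh r)^-1) = pi.
Proof.
have H : J (@sech2 R) = pi.
  have := J_sech2_cos (0 : R); under eq_J do rewrite mul0r cos0 mulr1.
  by rewrite mulr0 cosh0 divr1.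
have t2 : 0 < 2 :> R by [].
have E : (fun r : R => (cosh r)^-1) = (fun r => 2 * sech2 (2 * r)).
  apply/funext => r; rewrite /sech2 (_ : 2 * r / 2 = r); last by field.
  by have := cosh_gt0 r; move: (cosh r) => c c0; field; rewrite gt_eqF.
rewrite E JZ; last exact: itg_scale itg_sech2.
by rewrite (J_scale t2 itg_sech2) H mulrA mulfV ?mul1r.
Qed.

Lemma J_sqr_invcosh : itg (fun r : R => r ^+ 2 / cosh r) /\ J (fun r : R => r ^+ 2 / cosh r) = pi ^+ 3 / 4.
Proof.
have t2 : 0 < 2 :> R by [].
have half : 0 < 2^-1 :> R by rewrite invr_gt0.
have i : itg (fun r : R => sech2 r * r ^+ 2).
  apply: (itg_sqr_exp (a := 2^-1) (C := 1) half).
    by apply: contM; [exact: sech2_cont|cauto].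
  move=> r; rewrite mul1r normrM [`|r ^+ 2|]ger0_norm ?sqr_ge0 // mulrC ler_wpM2l ?sqr_ge0 //.
  by rewrite ger0_norm ?(ltW (sech2_gt0 _)) // sech2_bound.
have E : (fun r : R => r ^+ 2 / cosh r) = (fun r => 2^-1 * (sech2 (2 * r) * (2 * r) ^+ 2)).
  apply/funext => r; rewrite /sech2 (_ : 2 * r / 2 = r); last by field.
  by have := cosh_gt0 r; move: (cosh r) => c c0; field; rewrite gt_eqF.
rewrite E; split; first by apply: itgZ; exact: (itg_scale t2 i).
rewrite JZ; last exact: (itg_scale t2 i).
by rewrite (J_scale t2 i) J_sech2_sqr; field.
Qed.

(** The first moment of [1 / cosh] vanishes by parity, and half of the second one, [pi^3 / 8], is
    divided by the mass [pi]. *)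
Lemma ex2_secht : ex2 (fun n => secht (eps n) / pi) 0 (pi ^+ 2 / 8 : R).
Proof.
have p0 : 0 < pi :> R := pi_gt0 R.
have e0 n : 0 < eps n :> R := eps_gt0 n.
have [iq jq] := J_sqr_invcosh.
have i0 : itg (fun r : R => (cosh r)^-1).
  have := @itg_sechx R 0 (lexx _); rewrite invr_ge0 => /(_ (ler0n _ _)).
  by congr itg; apply/funext => r; rewrite /sechx mul0r oppr0 expR0 mul1r.
have half : 0 < 2^-1 :> R by rewrite invr_gt0.
have cc : cont (fun r : R => (cosh r)^-1).
  by apply: contV; [move=> r; rewrite gt_eqF // cosh_gt0|exact: (cosh_cont (f := fun r => r)) (@cont_id R)].
have ir : itg (fun r : R => r / cosh r).
  apply: (itg_le _ (itgD i0 iq)); first by apply: continuous_meas; apply: contM => //; exact: cont_id.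
  move=> r; have c0 := cosh_gt0 r; rewrite -[X in X + _]mul1r -mulrDl normrM [`|_^-1|]gtr0_norm ?invr_gt0 // ler_pM2r ?invr_gt0 //.
  have := sqr_ge0 (`|r| - 1); have := normr_ge0 r; rewrite -[r ^+ 2]real_normK ?num_real //.
  by move: (`|r|) => s s0 h; rewrite (_ : (s - 1) ^+ 2 = s ^+ 2 - 2 * s + 1) in h; [lra|ring].
have jr : J (fun r : R => r / cosh r) = 0.
  by apply: J_odd => // r; rewrite coshN mulNr.
pose f n r : R := (expR (- (eps n * r)) - 1 + eps n * r) / eps n ^+ 2 / cosh r.
have E n : J (f n) = (secht (eps n) - pi) / eps n ^+ 2.
  have isx := itg_sechx (ltW (e0 n)) (@eps_le R n).
  have -> : f n = (fun r => (eps n ^+ 2)^-1 * (sechx (eps n) r - (cosh r)^-1 + eps n * (r / cosh r))).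
    by apply/funext => r; rewrite /f /sechx; ring.
  have i3 : itg (fun r : R => eps n * (r / cosh r)) by exact: itgZ.
  have i4 : itg (fun r : R => sechx (eps n) r - (cosh r)^-1) by exact: itgB.
  rewrite JZ; last exact: itgD.
  by rewrite JD // JB // JZ // jr J_invcosh mulr0 addr0 mulrC.
have [] // := @dct R f (fun r => 2^-1 * (r ^+ 2 / cosh r)) (fun r => 4 * (r ^+ 2 * expR (- (2^-1 * `|r|)))).
- move=> n; apply: continuous_meas; apply: contM => //; cauto.
- move=> r; rewrite /f mulrA; apply: tendsM (@tends_cst R _).
  have H := @ex2_expN r.
  by apply: (tends_eq (tends_ext H _)) => [n|]; [rewrite mulNr opprK [r * _]mulrC|rewrite mulrC].
- apply: itgZ; apply: (itg_sqr_exp (a := 2^-1) (C := 1) half); first by cauto.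
  by move=> r; rewrite mul1r ger0_norm // mulr_ge0 ?sqr_ge0 ?expR_ge0.
- move=> n r; have en := e0 n.
  have := exp_tail 2 (- (eps n * r)).
  rewrite !big_nat_recr //= big_geq // !factS fact0 expr0 expr1 !mul1n add0r !divr1 opprD opprK addrA => H.
  rewrite /f normrM normrM normfV [`|eps n ^+ 2|]gtr0_norm ?exprn_gt0 // [`|(cosh r)^-1|]gtr0_norm ?invr_gt0 ?cosh_gt0 //.
  apply: (@le_trans _ _ (r ^+ 2 * expR (2^-1 * `|r|) * (2 * expR (- `|r|)))).
    apply: ler_pM; rewrite ?invcosh_le ?invr_ge0 ?(ltW (cosh_gt0 _)) //.
      by rewrite divr_ge0 // exprn_ge0 // ltW.
    rewrite ler_pdivrMr ?exprn_gt0 //; apply: le_trans H _.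
    rewrite normrN normrM (gtr0_norm en) exprMn real_normK ?num_real // -mulrA mulrC -mulrA.
    rewrite -[leRHS]mulrA ler_wpM2l ?sqr_ge0 // ler_wpM2r ?exprn_ge0 ?(ltW en) // ler_expR ler_wpM2r //.
    exact: eps_le.
  have -> : - (2^-1 * `|r|) = 2^-1 * `|r| + - `|r| by field.
  rewrite expRD; have := sqr_ge0 r; have := expR_gt0 (2^-1 * `|r|); have := expR_gt0 (- `|r|).
  move: (r ^+ 2) (expR _) (expR _) => a b c c0 b0 a0.
  have : 0 <= a * b * c by rewrite !mulr_ge0 // ltW.
  lra.
rewrite JZ // jq => _ H.
apply: (tends_eq (tends_ext (tendsM H (@tends_cst R pi^-1)) _)) => [n|]; last by move: (pi) p0 => p p0; field; rewrite gt_eqF.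
rewrite E; have := e0 n; move: (secht (@eps R n)) => S; move: (@eps R n) (pi) p0 => e p p0 en.
by field; rewrite !gt_eqF.
Qed.
End expansions.

(** * The logarithmic moment and the final evaluation *)

Section log_moment.
Context {R : realType}.
Implicit Types (u e : R).

Lemma itg_exp_qf e : 0 <= e -> e <= 2^-1 -> itg (fun u => expR (e * u) * qf u).
Proof.
move=> e0 e1; have half : 0 < 2^-1 :> R by rewrite invr_gt0.
apply: (itg_exp (f := fun u => expR (e * u) * qf u) (C := 4) half).
  by apply: measurable_funM (@qf_meas R); apply: continuous_meas; cauto.
move=> u; rewrite normrM ger0_norm ?expR_ge0 //.
apply: (@le_trans _ _ (expR (2^-1 * `|u|) * (4 * expR (- `|u|)))).
  apply: ler_pM; rewrite ?expR_ge0 ?qf_bound //.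
  rewrite ler_expR; apply: le_trans (ler_norm _) _.
  by rewrite normrM (ger0_norm e0) ler_wpM2r.
by rewrite mulrCA -expRD ler_pM2l // ler_expR; move: (`|u|) => s; lra.
Qed.

(** As [u = ln x], the logarithmic moment is the derivative at 0 of the Mellin transform [ufun],
    taken here along [eps]. *)
Lemma log_moment_quotient :
  [/\ itg (@qf R), itg (fun u => u * qf u) &
    tends (fun n => (ufun (eps n) - J qf) / eps n) (J (fun u => u * qf u))].
Proof.
have half : 0 < 2^-1 :> R by rewrite invr_gt0.
have e0 n : 0 < eps n :> R := eps_gt0 n.
have iq : itg (@qf R).
  by have := @itg_exp_qf 0 (lexx _) (ltW half); congr itg; apply/funext => u; rewrite mul0r expR0 mul1r.
have ie : itg (fun u : R => expR (- (2^-1 * `|u|))) by exact: itg_expN.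
have ise : itg (fun u : R => u ^+ 2 * expR (- (2^-1 * `|u|))).
  apply: (itg_sqr_exp (a := 2^-1) (C := 1) half); first by cauto.
  by move=> r; rewrite mul1r ger0_norm // mulr_ge0 ?sqr_ge0 ?expR_ge0.
have ld u : `|u| <= 1 + u ^+ 2.
  rewrite -[u ^+ 2]real_normK ?num_real //; have := sqr_ge0 (`|u| - 1); have := normr_ge0 u.
  by move: (`|u|) => s s0 h; rewrite (_ : (s - 1) ^+ 2 = s ^+ 2 - 2 * s + 1) in h; [lra|ring].
have iD := itgZ 4 (itgD ie ise).
have [] // := @dct R (fun n u => (expR (eps n * u) - 1) / eps n * qf u) (fun u => u * qf u) (fun u => 4 * (expR (- (2^-1 * `|u|)) + u ^+ 2 * expR (- (2^-1 * `|u|)))).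
- by move=> n; apply: measurable_funM (@qf_meas R); apply: continuous_meas; cauto.
- move=> u; apply: tendsM (@tends_cst R _).
  have [_ h] := ex2_1 (@ex2_expN R (- u)).
  by apply: (tends_eq (tends_ext h _)) => [n|]; rewrite ?mulrN opprK.
- move=> n u; have en := e0 n.
  have := exp_tail 1 (eps n * u).
  rewrite big_nat1 expr0 fact0 divr1 expr1 => H.
  rewrite normrM normrM normfV (gtr0_norm en).
  apply: (@le_trans _ _ (`|u| * expR (2^-1 * `|u|) * (4 * expR (- `|u|)))).
    apply: ler_pM; rewrite ?qf_bound ?divr_ge0 ?(ltW en) //.
    rewrite ler_pdivrMr //; apply: le_trans H _.
    rewrite normrM (gtr0_norm en) -mulrA mulrC -mulrA -[leRHS]mulrA ler_wpM2l //.
    by rewrite ler_wpM2r ?(ltW en) // ler_expR ler_wpM2r // eps_le.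
  have -> : `|u| * expR (2^-1 * `|u|) * (4 * expR (- `|u|)) = 4 * (`|u| * expR (- (2^-1 * `|u|))).
    have -> : - (2^-1 * `|u|) = 2^-1 * `|u| + - `|u| by field.
    by rewrite expRD; ring.
  by rewrite ler_pM2l // -[X in X + _]mul1r -mulrDl ler_wpM2r ?expR_ge0.
move=> h1 h2; split=> //.
apply: (tends_ext h2) => n.
have i1 := itg_exp_qf (ltW (e0 n)) (@eps_le R n).
rewrite /ufun -JB // mulrC -JZ; last exact: itgB.
by apply: eq_J => u; ring.
Qed.

Variables (zeta : R[i]^o -> R[i]^o) (gamma1 : R).
Hypothesis zetaP : is_riemann_zeta zeta.
Hypothesis gamma1P : is_stieltjes1 zeta gamma1.

(** Since [ufun eps = (1 - Pr) / (2 eps)], the moment is [- m2 / 2] for the second coefficient [m2]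
    of [Pr]. The first-order coefficients of Gamma and zeta cancel, and [ln (2 pi)] combines with
    [ln 2] to leave [ln^2 pi / 2 - ln^2 2]. *)
Lemma log_moment : J (fun u => u * qf u) =
  - (5 * pi ^+ 2 / 24 + ln pi ^+ 2 / 2 - ln 2 ^+ 2 - euler_mascheroni ^+ 2 / 2 - gamma1) / 2.
Proof.
have p0 : 0 < pi :> R := pi_gt0 R.
have e0 n : 0 < eps n :> R := eps_gt0 n.
pose Pr n : R := gam (1 + eps n) * expR (- (eps n * ln (2 * pi))) * (2 - expR (- (eps n * ln 2))) * (eps n * zr zeta 0 (1 + eps n)) * (secht (eps n) / pi).
have hP := ex2M (ex2M (ex2M (ex2M (@ex2_gam R) (@ex2_expN R (ln (2 * pi)))) (ex2_2sub (@ex2_expN R (ln 2)))) (ex2_zeta gamma1P)) (@ex2_secht R).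
have hU n : ufun (eps n) = (1 - Pr n) / (2 * eps n).
  have en := e0 n.
  have s1 : 1 < 1 + eps n :> R by rewrite ltrDl.
  have hZ : tends (fun N => \sum_(0 <= j < N) expR (- ((1 + eps n) * ln j.+1%:R))) (zr zeta 0 (1 + eps n)).
    apply: (tends_ext (@tends_zr R zeta zetaP (1 + eps n) 0 s1)) => N.
    by apply: eq_bigr => j _; rewrite mul0r cos0 mulr1.
  rewrite (ufunE en (@eps_le R n)) (J_tnh_exp en (@eps_le R n) hZ) /Pr.
  (* This rewrites [2 (1 - 2^(-1 - eps))] as [2 - 2^(- eps)], the factor normalised to 1 at 0. *)
  have -> : expR (- ((1 + eps n) * ln 2)) = 2^-1 * expR (- (eps n * ln 2)) :> R.
    rewrite -[X in _ = X^-1 * _](lnK (x := 2)) ?posrE // -expRN -expRD; congr expR; ring.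
  move: (zr _ _ _) (secht _) (expR (- (_ * ln 2))) => z s b; move: (expR _) (gam _) => a g.
  by move: (eps n) (pi) en p0 => e p en p0; field; rewrite !gt_eqF.
have [iq iuq hK] := log_moment_quotient.
set K2 := J (fun u => u * qf u) in hK *; set K1 := J qf in hK.
set m1 := _ + 0 in hP; set m2 := _ + _ in hP.
(* Two evaluations of one limit force [K1 = - m1 / 2]. This turns the difference quotient of [ufun]
   into the second-order quotient of [Pr]. *)
have k1 : tends (fun n => 2 * (ufun (eps n) - K1)) 0.
  apply: (tends_eq (tends_ext (tendsM (tendsM (@tends_cst R 2) hK) (@tends_eps R)) _)) => [n|]; last by rewrite mulr0.
  by have := e0 n; move: (eps n) (ufun _) => e U en; field; rewrite gt_eqF.
have k2 : tends (fun n => 2 * (ufun (eps n) - K1)) (- m1 - 2 * K1).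
  apply: (tends_eq (tends_ext (tendsB (tendsB (tendsN (tendsM hP (@tends_eps R))) (@tends_cst R m1)) (@tends_cst R (2 * K1))) _)) => [n|]; last by rewrite mulr0 oppr0 sub0r.
  rewrite hU -/(Pr n); have := e0 n; move: (eps n) (Pr n) => e P en; field.
  by rewrite gt_eqF.
have E1 := tends_unique k2 k1.
have k3 : tends (fun n => (Pr n - 1 - m1 * eps n) / eps n ^+ 2) (- (2 * K2)).
  apply: (tends_ext (tendsN (tendsM (@tends_cst R 2) hK))) => n.
  rewrite hU; have -> : K1 = - m1 / 2 by move: E1; move: (K1) (m1) => a b; lra.
  by have := e0 n; move: (eps n) (Pr n) => e P en; field; rewrite gt_eqF.
have E2 := tends_unique k3 hP.
have -> : K2 = - m2 / 2 by move: E2; move: (K2) (m2) => a b; lra.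
congr (_ / _); congr (- _).
by rewrite /m2 lnM ?posrE //; field.
Qed.
End log_moment.

(** * Telescoping of the squares of psi *)

Section energy_integral.
Context {R : realType}.
Implicit Types (u x : R).

(** The base point lies in []0, 1/2[], so that [Psi2] is differentiable at [1/2], the lower end of
    the interval that matters. *)
Definition Psi2 x : R := \int[lebesgue_measure]_(t in `[4^-1, x]) psi t ^+ 2.

Lemma psi2_cont_at x : 0 < x -> {for x, continuous (fun t => psi t ^+ 2)}.
Proof.
move=> x0; have c : cont (fun t : R => t ^+ 2) by apply: contX; exact: cont_id.
by apply: (@continuous_comp _ _ _ (@psi R) (fun t => t ^+ 2)); [exact: psi_cont_at|exact: c].
Qed.

Lemma drv_Psi2 x : 4^-1 < x -> drv x Psi2 (psi x ^+ 2).
Proof.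
move=> x4; have x0 : 0 < x by apply: lt_trans x4; rewrite invr_gt0.
have xu : x < x + 1 by rewrite ltrDl.
have ci : (@lebesgue_measure R).-integrable `[4^-1, x + 1] (EFin \o (fun t => psi t ^+ 2)).
  apply: continuous_compact_integrable; first exact: segment_compact.
  apply: continuous_in_subspaceT => t; rewrite inE /= in_itv /= => /andP[h _].
  by apply: psi2_cont_at; apply: lt_le_trans h; rewrite invr_gt0.
have [h1 h2] := continuous_FTC1_closed xu ci x4 (psi2_cont_at x0).
split; first exact: h1.
by rewrite -h2 derive1E.
Qed.

Lemma int_psi2 : \int[lebesgue_measure]_(t in `[2^-1, 1]) digamma t ^+ 2 = Psi2 1 - Psi2 2^-1 :> R.
Proof.
have -> : \int[lebesgue_measure]_(t in `[2^-1, 1]) digamma t ^+ 2 = \int[lebesgue_measure]_(t in `[2^-1, 1]) psi t ^+ 2 :> R.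
  apply: eq_Rintegral => t; rewrite inE /= in_itv /= => /andP[h _].
  by rewrite digamma_psi //; apply: lt_le_trans h; rewrite invr_gt0.
have c x : 4^-1 < x -> {for x, continuous Psi2}.
  move=> h; apply: differentiable_continuous; apply/derivable1_diffP.
  by case: (drv_Psi2 h).
have q : 4^-1 < 2^-1 :> R by lra.
rewrite /Rintegral (@continuous_FTC2 _ (fun t => psi t ^+ 2) Psi2) //.
- lra.
- apply: continuous_in_subspaceT => t; rewrite inE /= in_itv /= => /andP[h _].
  by apply: psi2_cont_at; apply: lt_le_trans h; rewrite invr_gt0.
- split.
  + move=> x; rewrite in_itv /= => /andP[h _].
    by have [] := drv_Psi2 (lt_trans q h).
  + exact/cvg_at_right_filter/c.
  + by apply/cvg_at_left_filter/c; lra.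
- move=> x; rewrite in_itv /= => /andP[h _].
  by rewrite derive1E; have [_ ->] := drv_Psi2 (lt_trans q h).
Qed.

Definition gap u : R := Psi2 (1 + expR u) - Psi2 (2^-1 + expR u).
Definition dgap u : R := expR u * (psi (1 + expR u) ^+ 2 - psi (2^-1 + expR u) ^+ 2).

Lemma drv_gap u : drv u gap (dgap u).
Proof.
have x0 := expR_gt0 u.
have d (a : R) : drv u (fun u => a + expR u) (expR u).
  by apply: drv_eq; [dauto|rewrite /=; ring].
apply: drv_eq.
  by apply: drvB; apply: drv_comp; [apply: drv_Psi2; lra|exact: d|apply: drv_Psi2; lra|exact: d].
by rewrite /dgap; ring.
Qed.

Lemma dgap_cont : cont dgap.
Proof.
have c1 (a : R) : cont (fun u => a + expR u).
  by apply: contD; [exact: cont_cst|exact: continuous_expR].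
apply: contM; first exact: continuous_expR.
by apply: contD; [|apply: contN]; apply: contX; apply: psi_cont => // u; rewrite addr_gt0 ?expR_gt0.
Qed.

(** In the expanded squares the cross term is [- 2 u xp]; adding [2 u qf] cancels it except for
    [- u] on [u >= 0]. *)
Lemma energy_dgap u : energy u + 2 * (u * qf u) = dgap u - u * ((0 <= u)%R)%:R.
Proof. by rewrite /energy /qf /xp /dgap; field. Qed.

(** By the mean value theorem the gap is [psi(c)^2 / 2] with [c] between [x + 1/2] and [x + 1],
    where [x = e^n]; there [psi(c)] differs from [n] by at most [1 / x], which beats the factor
    [2 n + 1]. *)
Lemma tends_gap_pos : tends (fun n => gap n%:R - n%:R ^+ 2 / 2) (0 : R).
Proof.
have half : 0 < 2^-1 :> R by rewrite invr_gt0.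
apply: (@tends_norm0 _ _ (fun n => 2 * expR (- (2^-1 * n%:R)))); last first.
  by apply: tends_eq (tendsM (@tends_cst R 2) (tends_expN half)) _; rewrite mulr0.
apply: nearW => n.
have x0 := expR_gt0 (n%:R : R); set x : R := expR n%:R in x0.
have hx : 2^-1 + x < 1 + x by rewrite ltrD2r; lra.
have D t : 2^-1 + x <= t -> t <= 1 + x -> drv t Psi2 (psi t ^+ 2).
  by move=> h _; apply: drv_Psi2; lra.
have [c /andP[c1 c2] E] := mvt hx D.
have cx : x < c by apply: lt_trans c1; rewrite ltrDr.
have c0 : 0 < c by apply: lt_trans cx.
have h1 := psi_le c0; have h2 := psi_ge c0.
have lx : ln x = n%:R by rewrite /x expRK.
have h3 : n%:R <= ln c by rewrite -lx ler_ln ?posrE // ltW.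
have h4 : ln c - n%:R <= x^-1.
  rewrite -lx; apply: le_trans (lnB_le x0 c0) _.
  rewrite ler_pdivrMr // mulVf ?gt_eqF //; lra.
have h5 : c^-1 <= x^-1 by rewrite lef_pV2 ?posrE // ltW.
have -> : gap n%:R - n%:R ^+ 2 / 2 = 2^-1 * ((psi c - n%:R) * (psi c + n%:R)).
  by rewrite /gap -/x E; field.
have n0 : 0 <= n%:R :> R by [].
have x1 : x^-1 <= 1 by rewrite invf_le1 // /x -[leLHS]expR0 ler_expR.
have b1 : `|psi c - n%:R| <= x^-1.
  by rewrite ler_norml; apply/andP; split; move: h1 h2 h3 h4 h5; move: (psi c) (ln c) (c^-1) (x^-1) (n%:R) => p l k y N *; lra.
have b2 : `|psi c + n%:R| <= 2 * n%:R + 1.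
  have := ler_normD (psi c - n%:R) (n%:R + n%:R).
  rewrite addrA subrK [`|_ + n%:R| in X in _ <= X]ger0_norm ?addr_ge0 //.
  move: b1 x1; move: (n%:R) (x^-1) (`|psi c + n%:R|) (`|psi c - n%:R|) => N y l p; clear; move=> *; lra.
rewrite normrM normrM ger0_norm //.
apply: (@le_trans _ _ (2^-1 * (x^-1 * (2 * n%:R + 1)))).
  by rewrite ler_pM2l // ler_pM.
have h6 := expR_ge1Dx (2^-1 * n%:R : R).
have -> : x^-1 = expR (- (2^-1 * n%:R)) * (expR (2^-1 * n%:R))^-1.
  by rewrite /x -!expRN -expRD; congr expR; field.
have e1 := expR_gt0 (2^-1 * n%:R : R); have e2 := expR_gt0 (- (2^-1 * n%:R) : R).
rewrite [leLHS](_ : _ = (2^-1 * (2 * n%:R + 1) / expR (2^-1 * n%:R)) * expR (- (2^-1 * n%:R))); last by ring.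
rewrite ler_pM2r // ler_pdivrMr //.
move: h6 n0; move: (expR (2^-1 * n%:R)) => e; move: (n%:R) => N; clear; move=> *; lra.
Qed.

Lemma tends_gap_neg : tends (fun n => gap (- n%:R)) (Psi2 1 - Psi2 2^-1).
Proof.
have c x : 4^-1 < x -> {for x, continuous Psi2}.
  move=> h; apply: differentiable_continuous; apply/derivable1_diffP.
  by case: (drv_Psi2 h).
have E0 : tends (fun n => expR (- n%:R)) (0 : R).
  by apply: (tends_ext (@tends_expN R 1 ltr01)) => n; rewrite mul1r.
have E (a : R) : tends (fun n => a + expR (- n%:R)) a.
  by apply: tends_eq (tendsD (@tends_cst R a) E0) (addr0 _).
by apply: tendsB; apply: tends_at => //; apply: c; lra.
Qed.

(** On [[-n, n]] the integral is an increment of [gap] minus [n^2 / 2]. The growth cancels at the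
    upper end, and the lower end leaves the integral of [psi^2] over [[1/2, 1]]. *)
Lemma J_energy : J energy + 2 * J (fun u => u * qf u) = - (Psi2 1 - Psi2 2^-1).
Proof.
have [iE _] := @itg_energy R.
have [_ iK _] := @log_moment_quotient R.
have i2 : itg (fun u => 2 * (u * qf u)) := itgZ 2 iK.
rewrite -JZ // -JD //.
have L := @J_lim R _ (fun n => - n%:R) (fun n => n%:R) (itgD iE i2).
have L' : tends (fun n => J ((fun u => energy u + 2 * (u * qf u)) \_ `[- n%:R, n%:R])) (J (fun u => energy u + 2 * (u * qf u))).
  apply: L => u; near=> n.
  have : `|u| <= n%:R by near: n; exact: nbhs_infty_ger.
  by rewrite ler_norml in_itv.
have V n : J ((fun u => energy u + 2 * (u * qf u)) \_ `[- n%:R, n%:R]) = (gap n%:R - n%:R ^+ 2 / 2) - gap (- n%:R).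
  have n0 : 0 <= n%:R :> R by [].
  have nn : - n%:R <= n%:R :> R by rewrite (@le_trans _ _ 0) ?oppr_le0.
  have -> : (fun u => energy u + 2 * (u * qf u)) \_ `[- n%:R, n%:R] =
      (fun u => (dgap \_ `[- n%:R, n%:R]) u - ((fun u => u) \_ `[0, n%:R]) u).
    apply/funext => u; rewrite !patchE !mem_setE !in_itv /= energy_dgap.
    have [u0|u0] := leP 0 u; last first.
      rewrite mulr0 subr0 /=; case: ifP => _; by rewrite subr0.
    have -> : - n%:R <= u by rewrite (le_trans _ u0) // oppr_le0.
    by rewrite mulr1 /=; case: ifP => _; rewrite ?subr0.
  have d2 u : drv u (fun u => u ^+ 2 / 2) u.
    by apply: drv_eq; [dauto|rewrite /=; field].
  rewrite JB; [|exact: itg_cut dgap_cont|exact: itg_cut (@cont_id R)].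
  rewrite (@J_cut R gap) //; [|exact: drv_gap|exact: dgap_cont].
  rewrite (@J_cut R (fun u => u ^+ 2 / 2)) //; last exact: cont_id.
  by rewrite expr0n mul0r subr0 addrAC.
rewrite (tends_unique (tends_ext L' V) (tendsB tends_gap_pos tends_gap_neg)).
by rewrite sub0r.
Unshelve. all: by end_near. Qed.
End energy_integral.

Theorem mainTheorem6 (R : realType) (zeta : R[i]^o -> R[i]^o) (gamma1 : R)
    (zetaP : is_riemann_zeta zeta) (gamma1P : is_stieltjes1 zeta gamma1) :
  (\int[lebesgue_measure]_v
     (Normc.normc (zeta (2^-1 +i* v)%C) ^+ 2
        * (Num.sqrt 2 * cos (v * ln 2) - 1) / cosh (pi * v) ^+ 2)%:E)%E
  = (- pi^-1 * (\int[lebesgue_measure]_(v in `[2^-1, 1]) digamma v ^+ 2)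
     + 5 * pi / 24
     + pi^-1 * (2^-1 * ln pi ^+ 2 - ln 2 ^+ 2
                - euler_mascheroni ^+ 2 / 2 - gamma1))%:E.
Proof.
rewrite (parseval zetaP); congr (_%:E).
have := @J_energy R; rewrite (log_moment zetaP gamma1P) int_psi2.
have p0 : 0 < pi :> R := pi_gt0 R.
move: (J _) (Psi2 1 - Psi2 2^-1) (ln pi) (ln 2) => E I lp l H.
have -> : E = (5 * pi ^+ 2 / 24 + lp ^+ 2 / 2 - l ^+ 2 - euler_mascheroni ^+ 2 / 2 - gamma1) - I.
  by move: H; move: (pi ^+ 2) (euler_mascheroni ^+ 2) (lp ^+ 2) (l ^+ 2) => a b c d; lra.
by move: (pi) p0 => p p0; field; rewrite gt_eqF.
Qed.
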